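(* Let $0<\alpha<1$, $0<\tilde\alpha<1$, $\rho>0$, $\eta\ge 0$, and let $\mathcal H$ and $\mathcal A$ be the Hilbert space and operator defined in the context. Consider the Cauchy problem $$V_t=\mathcal A V,\qquad V(0)=V_0. \qquad (\ast)$$ (1) If $V_0\in D(\mathcal A)$, then $(\ast)$ has a unique strong solution $$V\in C^0(\mathbb R_+,D(\mathcal A))\cap C^1(\mathbb R_+,\mathcal H).$$ (2) If $V_0\in\mathcal H$, then $(\ast)$ has a unique weak solution $$V\in C^0(\mathbb R_+,\mathcal H).$$
   Context: All functions are complex valued and $\imath$ is the imaginary unit. Define $$H^1_\alpha(0,1)=\{v\in L^2(0,1): v \text{ locally absolutely continuous in }(0,1],\ x^{\alpha/2}v_x\in L^2(0,1)\},$$ $$H^2_\alpha(0,1)=\{v\in H^1_\alpha(0,1): x^\alpha v_x\in H^1(0,1)\}.$$ Since $0<\alpha<1$, $H^1_\alpha(0,1)\hookrightarrow C([0,1])$, so $v(0)$ makes sense for $v\in H^1_\alpha(0,1)$; also $(x^\alpha v_x)(0)$ and $v_x(1)$ make sense for $v\in H^2_\alpha(0,1)$. Let $\mu(\xi)=|\xi|^{(2\tilde\alpha-1)/2}$ for $\xi\in\mathbb R$, and $\zeta=\rho\,\pi^{-1}\sin(\tilde\alpha\pi)$. Let $\mathcal H=L^2(0,1)\times L^2(\mathbb R)$ with inner product $$\langle (v,\phi),(\tilde v,\tilde\phi)\rangle_{\mathcal H}=\int_0^1 v\,\overline{\tilde v}\,dx+\zeta\int_{-\infty}^{+\infty}\phi(\xi)\overline{\tilde\phi(\xi)}\,d\xi.$$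 The operator $\mathcal A$ is $$\mathcal A\begin{pmatrix}v\\ \phi\end{pmatrix}=\begin{pmatrix}-\imath(x^\alpha v_x)_x\\ -(\xi^2+\eta)\phi+\mu(\xi)v(0)\end{pmatrix}$$ with domain $D(\mathcal A)$ (equipped with the graph norm) the set of all $(v,\phi)\in\mathcal H$ such that $v\in H^2_\alpha(0,1)$, $v_x(1)=0$, $(x^\alpha v_x)(0)=\imath\zeta\int_{-\infty}^{\infty}\mu(\xi)\phi(\xi)\,d\xi$, $-(\xi^2+\eta)\phi+\mu(\xi)v(0)\in L^2(\mathbb R)$ and $|\xi|\phi\in L^2(\mathbb R)$. ''Weak solution'' is understood in the usual sense of semigroup theory (mild solution): $V\in C^0(\mathbb R_+,\mathcal H)$ with $\int_0^tV(s)\,ds\in D(\mathcal A)$ and $V(t)=V_0+\mathcal A\int_0^tV(s)\,ds$ for all $t\ge0$. *)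

(* Defs.v *)
From mathcomp Require Import all_boot all_order all_algebra.
From mathcomp Require Import complex.
From mathcomp Require Import all_classical all_reals all_analysis.

Set Implicit Arguments.
Unset Strict Implicit.
Unset Printing Implicit Defensive.

Import Order.TTheory GRing.Theory Num.Theory.
Import numFieldNormedType.Exports.

Local Open Scope classical_set_scope.
Local Open Scope ring_scope.
Local Open Scope complex_scope.

Local Notation Re := (@complex.Re _).
Local Notation Im := (@complex.Im _).

Section FunctionSpaces.
Context {R : realType}.
Local Notation leb := (@lebesgue_measure R).

Definition I01 : set R := `]0, 1[.

(* Only the values on D matter: the restriction is extended by 0. *)
Definition L2 (D : set R) (f : R -> R[i]) : Prop :=
  ((Re \o f) \_ D : R -> R) \in Lfun leb 2%:E /\
  ((Im \o f) \_ D : R -> R) \in Lfun leb 2%:E.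

Definition cint (D : set R) (f : R -> R[i]) : R[i] :=
  (\int[leb]_(x in D) Re (f x)) +i* (\int[leb]_(x in D) Im (f x)).

(* The intervals [x i, y i], i < n, are listed from left to right; this loses
   no generality for finite families of non-overlapping intervals. *)
Definition abs_cont (a b : R) (f : R -> R[i]) : Prop :=
  forall e : R, 0 < e -> exists2 d : R, 0 < d &
    forall (n : nat) (x y : nat -> R),
      (forall k, (k < n)%N -> [/\ a <= x k, x k <= y k & y k <= b]) ->
      (forall k, (k.+1 < n)%N -> y k <= x k.+1) ->
      \sum_(k < n) (y k - x k) < d ->
      \sum_(k < n) Normc.normc (f (y k) - f (x k)) < e.

(* df is a version of the almost everywhere derivative of f on (0, 1). *)
Definition ae_derivative (f df : R -> R[i]) : Prop :=
  {ae leb, forall x : R, I01 x ->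
    is_derive x 1 (Re \o f : R -> R) (Re (df x)) /\
    is_derive x 1 (Im \o f : R -> R) (Im (df x))}.

(* v belongs to H^1_alpha(0, 1) and v_x = dv. *)
Definition H1alpha (alpha : R) (v dv : R -> R[i]) : Prop :=
  [/\ L2 I01 v,
      forall e : R, 0 < e -> e <= 1 -> abs_cont e 1 v,
      ae_derivative v dv &
      L2 I01 (fun x => (x `^ (alpha / 2))%:C * dv x)].

(* w is the absolutely continuous representative, on [0, 1], of an element of
   H^1(0, 1), and w_x = dw. *)
Definition H1 (w dw : R -> R[i]) : Prop :=
  [/\ L2 I01 w, abs_cont 0 1 w, ae_derivative w dw & L2 I01 dw].

(* v belongs to H^2_alpha(0, 1), v_x = dv, x^alpha v_x = w and
   (x^alpha v_x)_x = dw. Among the versions of v_x, dv is the one for which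
   x^alpha dv is continuous on (0, 1]; so dv 1 is the trace v_x(1), and w 0 is
   the trace (x^alpha v_x)(0). *)
Definition H2alpha (alpha : R) (v dv w dw : R -> R[i]) : Prop :=
  [/\ H1alpha alpha v dv,
      forall x : R, 0 < x -> x <= 1 -> w x = (x `^ alpha)%:C * dv x &
      H1 w dw].

(* The value at 0 of the continuous extension to [0, 1] of a function which is
   continuous on (0, 1]. *)
Definition trace0 (v : R -> R[i]) : R[i] :=
  lim (Re (v x) @[x --> 0^'+]) +i* lim (Im (v x) @[x --> 0^'+]).

End FunctionSpaces.

(* Elements of the Hilbert space are handled through representatives: a state
   is a pair of functions (v, phi), of which only the class for eqH matters. *)
Definition state (R : realType) : Type :=
  ((R -> R[i]) * (R -> R[i]))%type.

Section StateSpace.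
Context {R : realType}.
Variable zeta : R.
Local Notation leb := (@lebesgue_measure R).
Implicit Types (U W : state R) (V : R -> state R).

Definition inH : set (state R) := [set U | L2 I01 U.1 /\ L2 setT U.2].

Definition eqH U W : Prop :=
  U.1 = W.1 %[ae leb in I01] /\ U.2 = W.2 %[ae leb in setT].

Definition dotH U W : R[i] :=
  cint I01 (fun x => U.1 x * ((W.1 x)^*)%C) +
  zeta%:C * cint setT (fun xi => U.2 xi * ((W.2 xi)^*)%C).

Definition normH U : R := Num.sqrt (Re (dotH U U)).

(* V belongs to C^0([0, +oo), H). *)
Definition contH V : Prop :=
  (forall t : R, 0 <= t -> inH (V t)) /\
  (forall t : R, 0 <= t ->
    normH (V s - V t) @[s --> within `[0, +oo[ (nbhs t)] --> 0).

(* dV t is the derivative of V at t in H, for all t >= 0 (one-sided at 0). *)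
Definition is_derivH V (dV : R -> state R) : Prop :=
  forall t : R, 0 <= t ->
    normH (((s - t)^-1)%:C *: (V s - V t) - dV t)
      @[s --> within `[0, +oo[ t^'] --> 0.

(* I is the (H-valued) Riemann integral of V over [a, b]. *)
Definition is_RintH V (a b : R) (I : state R) : Prop :=
  inH I /\
  forall e : R, 0 < e -> exists2 d : R, 0 < d &
    forall (n : nat) (x tag : nat -> R),
      x 0%N = a -> x n = b ->
      (forall k, (k < n)%N ->
        [/\ x k <= tag k, tag k <= x k.+1 & x k.+1 - x k < d]) ->
      normH (\sum_(k < n) (x k.+1 - x k)%:C *: V (tag k) - I) < e.

End StateSpace.

Section CauchyProblem.
Context {R : realType}.
Variables alpha alphat rho eta : R.
Implicit Types (U F : state R) (V : R -> state R).

Definition weight (xi : R) : R := `|xi| `^ ((2 * alphat - 1) / 2).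

Definition zeta : R := rho * pi^-1 * sin (alphat * pi).

Definition diffusive (phi : R -> R[i]) (c : R[i]) (xi : R) : R[i] :=
  - (xi ^+ 2 + eta)%:C * phi xi + (weight xi)%:C * c.

(* U belongs to the domain of the operator A, v being the continuous
   representative of its first component. *)
Definition domA_spec U (v dv w dw : R -> R[i]) : Prop :=
  [/\ inH U, U.1 = v %[ae @lebesgue_measure R in I01] &
      H2alpha alpha v dv w dw] /\
  [/\ dv 1 = 0,
      w 0 = 'i%C * zeta%:C * cint setT (fun xi => (weight xi)%:C * U.2 xi),
      L2 setT (diffusive U.2 (trace0 v)) &
      L2 setT (fun xi => `|xi|%:C * U.2 xi)].

Definition domA : set (state R) :=
  [set U | exists v dv w dw, domA_spec U v dv w dw].

Definition graphA U F : Prop :=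
  inH F /\ exists v dv w dw, domA_spec U v dv w dw /\
    eqH F (fun x => - 'i%C * dw x, diffusive U.2 (trace0 v)).

(* graphA determines the image up to eqH; opA picks a representative. *)
Definition opA U : state R := xget 0 [set F | graphA U F].

Definition graph_norm U : R := normH zeta U + normH zeta (opA U).

(* V belongs to C^0([0, +oo), D(A)). *)
Definition contD V : Prop :=
  (forall t : R, 0 <= t -> domA (V t)) /\
  (forall t : R, 0 <= t ->
    graph_norm (V s - V t) @[s --> within `[0, +oo[ (nbhs t)] --> 0).

Definition strong_solution (V0 : state R) V : Prop :=
  [/\ contD V, contH zeta V, eqH (V 0) V0 &
      exists dV : R -> state R,
        [/\ contH zeta dV, is_derivH zeta V dV &
            forall t : R, 0 <= t -> eqH (dV t) (opA (V t))]].

Definition weak_solution (V0 : state R) V : Prop :=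
  contH zeta V /\
  forall t : R, 0 <= t -> exists I : state R,
    [/\ is_RintH zeta V 0 t I, domA I & eqH (V t) (V0 + opA I)].

End CauchyProblem.

(* Main.v *)
Require Import Defs.
From HB Require Import structures.
From mathcomp Require Import all_boot all_order all_algebra.
From mathcomp Require Import complex.
From mathcomp Require Import all_classical all_reals all_analysis.
From mathcomp Require Import measurable_realfun ring lra.

(** The states modulo equality almost everywhere form a real Hilbert space X
    (energy_space), and A is a dissipative operator on X such that u - h A u = x
    is solvable for some h > 0 and all x. A linear operator with these two
    properties generates a semigroup of contractions, which provides the
    solutions; dissipativity alone gives uniqueness.

    Dissipativity (graphA_dissipative). Integration by parts turns
    Re int -i w' conj(v), with w = x^alpha v', into a boundary term at 0, since
    w(1) = 0 and Im (w conj(v')) = 0. The condition w(0) = i zeta int mu phi makes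
    it cancel the term coming from mu v(0) in the second component, and what is
    left is - zeta int (xi^2 + eta) |phi|^2. The integration by parts rests on the
    fundamental theorem of calculus for absolutely continuous functions
    (abs_cont_FTC), and the traces at 0 exist because x^(- alpha / 2) is square
    integrable for alpha < 1.

    Range condition (generator_resolvable). The equation lam U - A U = (f, g) is
    solved for small lam > 0. Given c = v(0), its second component is solved by
    phi = (g + mu c) / (lam + eta + xi^2). The moment int mu phi is then affine in
    c with a positive slope, the impedance, so that the boundary condition at 0
    determines c. In the first component the term lam v is treated as a
    perturbation: with v frozen there, the equation is solved by integrating
    twice, and the resulting map v |-> res_state v is a contraction of
    L^2(0, 1) for small lam, because the impedance does not decrease when lam
    tends to 0.

    Generation. The range condition extends from h to h / 2 (resolvable_half),
    hence to all dyadic fractions. The resolvents J_n with step h_n = h 2^-n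
    converge strongly to the identity (resolvent_cvg), so the domain of A^2 is
    dense. There, halving the step changes the implicit Euler approximation
    J_n^k x of the solution at time t = k h_n by O(h_n), and so does it for
    its Riemann sums; both are therefore uniformly Cauchy on bounded time
    intervals, first on the domain of A^2 and then everywhere by contractivity.
    The limits are flow t x and flow_int t x. Since A is closed, the exact
    relations between the Euler scheme, its sums and A pass to the limit:
    A (flow_int t x) = flow t x - x in general, and flow t x - x =
    flow_int t (A x) for x in the domain. Together with flow_int_increment, which
    says that flow_int is a primitive of the flow, the second relation gives
    strong solutions, and the first one gives weak solutions.

    Uniqueness. If D' = A D and D(0) = 0, then going back from t by r gives
    D(t - r) = D(t) - r A D(t) + o(r), whose norm is at least |D(t)| - o(r), so the
    norm of D does not increase (dissipative_trajectory0). For two weak solutions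
    this applies to the integral of their difference (mild_trajectory0). *)

Set Implicit Arguments.
Unset Strict Implicit.
Unset Printing Implicit Defensive.
Import Order.TTheory GRing.Theory Num.Theory.
Import numFieldNormedType.Exports.
Local Open Scope classical_set_scope.
Local Open Scope ring_scope.
Local Notation Re := (@complex.Re _).
Local Notation Im := (@complex.Im _).


(** * Real inner product spaces *)

Record inner_product (R : realType) (X : lmodType R) (q : X -> X -> R) : Prop :=
  InnerProduct {
    ipC : forall x y, q x y = q y x;
    ipDl : forall x y z, q (x + y) z = q x z + q y z;
    ipZl : forall a x z, q (a *: x) z = a * q x z;
    ip_ge0 : forall x, 0 <= q x x;
    ip_eq0 : forall x, q x x = 0 -> x = 0 }.

Section InnerProductTheory.
Context {R : realType} {X : lmodType R} (q : X -> X -> R)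
  (ipq : inner_product q).

Definition ipnorm (x : X) : R := Num.sqrt (q x x).
Local Notation N := ipnorm.

Let qC := ipC ipq.
Let qDl := ipDl ipq.
Let qZl := ipZl ipq.

Lemma ipDr x y z : q x (y + z) = q x y + q x z.
Proof. by rewrite qC qDl !(qC x). Qed.

Lemma ipZr a x y : q x (a *: y) = a * q x y.
Proof. by rewrite qC qZl qC. Qed.

Lemma ipNl x y : q (- x) y = - q x y.
Proof. by rewrite -scaleN1r qZl mulN1r. Qed.

Lemma ipNr x y : q x (- y) = - q x y.
Proof. by rewrite qC ipNl qC. Qed.

Lemma ip0l x : q 0 x = 0.
Proof. by rewrite -(scale0r x) qZl mul0r. Qed.

Lemma ip0r x : q x 0 = 0.
Proof. by rewrite qC ip0l. Qed.

Definition ipE := (qDl, qZl, ipDr, ipZr, ipNl, ipNr, ip0l, ip0r).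

(** Linear identities in the space become ring identities between scalars
    once both sides are paired with an arbitrary vector. *)
Lemma ip_ext x y : (forall z, q x z = q y z) -> x = y.
Proof.
move=> h; apply/eqP; rewrite -subr_eq0; apply/eqP/(ip_eq0 ipq).
by rewrite qDl ipNl h subrr.
Qed.

Lemma ipnorm_ge0 x : 0 <= N x. Proof. exact: sqrtr_ge0. Qed.

Lemma sqr_ipnorm x : N x ^+ 2 = q x x.
Proof. by rewrite sqr_sqrtr // (ip_ge0 ipq). Qed.

Lemma ipnorm0 : N 0 = 0. Proof. by rewrite /N ip0l sqrtr0. Qed.

Lemma ipnorm0_eq0 x : N x = 0 -> x = 0.
Proof. by move=> h; apply: (ip_eq0 ipq); rewrite -sqr_ipnorm h expr0n. Qed.

Lemma ipnormZ a x : N (a *: x) = `|a| * N x.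
Proof.
by rewrite /N qZl ipZr mulrA -expr2 sqrtrM ?sqr_ge0 // sqrtr_sqr.
Qed.

Lemma ipnormN x : N (- x) = N x.
Proof. by rewrite /N ipNl ipNr opprK. Qed.

Lemma ipnormB x y : N (x - y) = N (y - x).
Proof. by rewrite -ipnormN opprB. Qed.

Lemma cauchy_schwarz x y : q x y <= N x * N y.
Proof.
have [y0|y0] := eqVneq (N y) 0.
  by rewrite (ipnorm0_eq0 y0) ip0r ipnorm0 mulr0.
have [x0|x0] := eqVneq (N x) 0.
  by rewrite (ipnorm0_eq0 x0) ip0l ipnorm0 mul0r.
have Nx : 0 < N x by rewrite lt_neqAle eq_sym x0 ipnorm_ge0.
have Ny : 0 < N y by rewrite lt_neqAle eq_sym y0 ipnorm_ge0.
have := ip_ge0 ipq (N y *: x - N x *: y).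
rewrite !ipE (qC y x) -!sqr_ipnorm => h.
have {h} : 0 <= (2 * (N x * N y)) * (N x * N y - q x y) by nra.
by rewrite pmulr_rge0 ?subr_ge0 // mulr_gt0 // mulr_gt0.
Qed.

Lemma ler_ipnorm x c : 0 <= c -> q x x <= c ^+ 2 -> N x <= c.
Proof. by move=> c0; rewrite -sqr_ipnorm ler_pXn2r // nnegrE ipnorm_ge0. Qed.

Lemma ipnormD x y : N (x + y) <= N x + N y.
Proof.
apply: ler_ipnorm; first by rewrite addr_ge0 ?ipnorm_ge0.
rewrite !ipE (qC y x) -!sqr_ipnorm; have := cauchy_schwarz x y; nra.
Qed.

Lemma ipnorm_split z x y : N (x - y) <= N (x - z) + N (z - y).
Proof. by rewrite (le_trans _ (ipnormD _ _)) // addrA subrK. Qed.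

Lemma ipnorm_sub x y : N x <= N (x - y) + N y.
Proof. by rewrite -{1}(subrK y x) ipnormD. Qed.

Lemma ipnormDB x y : N (x - y) <= N x + N y.
Proof. by rewrite (le_trans (ipnormD _ _)) // ipnormN. Qed.

Lemma ipnorm_sum n (F : nat -> X) (c : nat -> R) :
  (forall i, (i < n)%N -> N (F i) <= c i) ->
  N (\sum_(i < n) F i) <= \sum_(i < n) c i.
Proof.
elim: n => [|n IH] h; first by rewrite !big_ord0 ipnorm0.
rewrite !big_ord_recr /= (le_trans (ipnormD _ _)) // lerD ?h //.
by apply: IH => i il; rewrite h // ltnS ltnW.
Qed.

Lemma ipnorm_le_eps x c : (forall e, 0 < e -> N x <= c + e) -> N x <= c.
Proof. by move=> h; apply/ler_addgt0Pr. Qed.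

Lemma ipnorm_eps0 x : (forall e, 0 < e -> N x <= e) -> x = 0.
Proof.
move=> h; apply: ipnorm0_eq0; apply/eqP; rewrite eq_le ipnorm_ge0 andbT.
by apply/ler_addgt0Pr => e e0; rewrite add0r h.
Qed.

Definition converges (u : nat -> X) (l : X) : Prop :=
  forall e, 0 < e -> exists n0, forall n, (n0 <= n)%N -> N (u n - l) <= e.

Definition is_cauchy (u : nat -> X) : Prop :=
  forall e, 0 < e -> exists n0, forall m n, (n0 <= m)%N -> (n0 <= n)%N ->
    N (u m - u n) <= e.

Definition complete : Prop :=
  forall u, is_cauchy u -> exists l, converges u l.

Lemma converges_uniq u l l' : converges u l -> converges u l' -> l = l'.
Proof.
move=> h h'; apply/eqP; rewrite -subr_eq0; apply/eqP/ipnorm_eps0 => e e0.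
have e2 : 0 < e / 2 by rewrite divr_gt0.
have [n hn] := h _ e2; have [m hm] := h' _ e2.
rewrite (le_trans (ipnorm_split (u (maxn n m)) _ _)) //.
rewrite [leRHS](splitr e) lerD //; last by rewrite hm // leq_maxr.
by rewrite ipnormB hn // leq_maxl.
Qed.

Lemma converges_le u l x c n0 : converges u l ->
  (forall n, (n0 <= n)%N -> N (u n - x) <= c) -> N (l - x) <= c.
Proof.
move=> h hc; apply: ipnorm_le_eps => e e0; have [n hn] := h _ e0.
rewrite (le_trans (ipnorm_split (u (maxn n n0)) _ _)) // addrC lerD //.
  by rewrite hc // leq_maxr.
by rewrite ipnormB hn // leq_maxl.
Qed.

Lemma convergesD u v l m :
  converges u l -> converges v m -> converges (fun n => u n + v n) (l + m).
Proof.
move=> h h' e e0; have e2 : 0 < e / 2 by rewrite divr_gt0.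
have [n hn] := h _ e2; have [k hk] := h' _ e2.
exists (maxn n k) => i; rewrite geq_max => /andP[ni ki].
rewrite opprD addrACA (le_trans (ipnormD _ _)) // (splitr e).
by rewrite lerD // ?hn ?hk.
Qed.

Lemma convergesZ a u l :
  converges u l -> converges (fun n => a *: u n) (a *: l).
Proof.
move=> h e e0; have a0 : 0 < `|a| + 1 by rewrite ltr_wpDl.
have [n hn] := h _ (divr_gt0 e0 a0); exists n => i /hn.
rewrite ler_pdivlMr // -scalerBr ipnormZ; apply: le_trans.
by rewrite mulrC ler_wpM2l ?ipnorm_ge0 // lerDl.
Qed.

Lemma converges_cst l : converges (fun=> l) l.
Proof. by move=> e e0; exists 0%N => n _; rewrite subrr ipnorm0 ltW. Qed.

Lemma convergesB u v l m :
  converges u l -> converges v m -> converges (fun n => u n - v n) (l - m).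
Proof.
move=> h /(convergesZ (-1)) h'; have := convergesD h h'.
by rewrite scaleN1r; under eq_fun do rewrite scaleN1r.
Qed.

Lemma geometric_small (C e : R) : 0 <= C -> 0 < e ->
  exists n0 : nat, forall n, (n0 <= n)%N -> C * 2^-1 ^+ n <= e.
Proof.
move=> C0 e0; exists (Num.trunc (C / e)).+1 => n hn.
rewrite exprVn ler_pdivrMr ?exprn_gt0 // -ler_pdivrMl // mulrC.
apply: le_trans (ltW (truncnS_gt (C / e))) _.
apply: (@le_trans _ _ (n%:R)); first by rewrite ler_nat.
by rewrite -natrX ler_nat ltnW // ltn_expl.
Qed.

(** Telescoping against the geometric series; keeping the factor 1 - 2^-k
    makes the induction on k close. *)
Lemma geometric_cauchy (u : nat -> X) (C : R) : 0 <= C ->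
  (forall n, N (u n.+1 - u n) <= C * 2^-1 ^+ n) ->
  forall n k, N (u (n + k)%N - u n) <= 2 * C * 2^-1 ^+ n.
Proof.
move=> C0 h n k.
suff : N (u (n + k)%N - u n) <= 2 * C * 2^-1 ^+ n * (1 - 2^-1 ^+ k).
  have p0 m : 0 <= 2^-1 ^+ m :> R by rewrite exprn_ge0 // invr_ge0.
  move=> /le_trans; apply; rewrite ler_piMr ?gerBl ?p0 //.
  by rewrite mulr_ge0 ?p0 // mulr_ge0.
elim: k => [|k IH]; first by rewrite addn0 expr0 !subrr mulr0 ipnorm0.
rewrite addnS (le_trans (ipnorm_split (u (n + k)%N) _ _)) //.
apply: (le_trans (lerD (h _) IH)).
by rewrite exprD exprS; lra.
Qed.

Lemma geometric_converges (u : nat -> X) (C : R) : complete -> 0 <= C ->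
  (forall n, N (u n.+1 - u n) <= C * 2^-1 ^+ n) -> exists l, converges u l.
Proof.
move=> cX C0 /(geometric_cauchy C0) h; apply: cX => e e0.
have C40 : 0 <= 2 * C + 2 * C by rewrite addr_ge0 // mulr_ge0.
have [n0 hn0] := geometric_small C40 e0.
exists n0 => m n /subnKC <- /subnKC <-.
rewrite (le_trans (ipnorm_split (u n0) _ _)) //.
rewrite (le_trans _ (hn0 n0 (leqnn _))) // mulrDl lerD ?h //.
by rewrite ipnormB h.
Qed.

(** Banach's fixed point theorem. *)
Lemma contraction_fixpoint (T : X -> X) : complete ->
  (forall x y, N (T x - T y) <= 2^-1 * N (x - y)) -> exists x, T x = x.
Proof.
move=> cX hT; pose u n := iter n T 0.
have hu n : N (u n.+1 - u n) <= N (u 1%N - u 0%N) * 2^-1 ^+ n.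
  elim: n => [|n IH]; first by rewrite expr0 mulr1.
  by rewrite (le_trans (hT _ _)) // exprS mulrCA ler_wpM2l ?invr_ge0.
have [l hl] := geometric_converges cX (ipnorm_ge0 _) hu.
exists l; apply: (@converges_uniq (fun n => u n.+1)).
  move=> e e0; have [n hn] := hl _ e0; exists n => m /hn hm.
  by rewrite (le_trans (hT _ _)) // (le_trans _ hm) // ler_piMl ?ipnorm_ge0 //; lra.
by move=> e e0; have [n hn] := hl _ e0; exists n => m nm; rewrite hn // leqW.
Qed.

End InnerProductTheory.

(** * Maximal dissipative operators and their resolvents *)

(** An unbounded operator is represented by its graph, so that its domain is
    carried along. *)
Record dissipative_op (R : realType) (X : lmodType R) (q : X -> X -> R)
    (A : X -> X -> Prop) : Prop := DissipativeOp {
  opD : forall u v f g, A u f -> A v g -> A (u + v) (f + g);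
  opZ : forall a u f, A u f -> A (a *: u) (a *: f);
  op_fun : forall f, A 0 f -> f = 0;
  op_diss : forall u f, A u f -> q u f <= 0 }.

(** The range condition: A u (h^-1 (u - x)) says that u - h A u = x. *)
Definition resolvable (R : realType) (X : lmodType R) (A : X -> X -> Prop)
    (h : R) : Prop :=
  forall x, exists u, A u (h^-1 *: (u - x)).

Section Resolvent.
Context {R : realType} {X : lmodType R} {q : X -> X -> R}
  (ipq : inner_product q) (cX : complete q)
  {A : X -> X -> Prop} (oA : dissipative_op q A).
Local Notation N := (ipnorm q).
Let ipEq := ipE ipq.

Lemma opN u f : A u f -> A (- u) (- f).
Proof. by move=> /(opZ oA (-1)); rewrite !scaleN1r. Qed.

Lemma opB u v f g : A u f -> A v g -> A (u - v) (f - g).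
Proof. by move=> h /opN; exact: (opD oA h). Qed.

Lemma op_single u f g : A u f -> A u g -> f = g.
Proof.
move=> h h'; apply/eqP; rewrite -subr_eq0; apply/eqP/(op_fun oA).
by rewrite -(subrr u); exact: opB.
Qed.

(** In the square of the right-hand norm the cross term - 2 h <u, f> is
    nonnegative. *)
Lemma dissipative_norm u f (h : R) : 0 <= h -> A u f -> N u <= N (u - h *: f).
Proof.
move=> h0 /(op_diss oA) d; apply: (ler_ipnorm ipq); first exact: ipnorm_ge0.
rewrite (sqr_ipnorm ipq) !ipEq (ipC ipq f u).
have : 0 <= h ^+ 2 * q f f by rewrite mulr_ge0 ?sqr_ge0 ?(ip_ge0 ipq).
nra.
Qed.

Lemma resolvent_contract (h : R) u v x y : 0 < h ->
  A u (h^-1 *: (u - x)) -> A v (h^-1 *: (v - y)) -> N (u - v) <= N (x - y).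
Proof.
move=> h0 Au Av; have := dissipative_norm (ltW h0) (opB Au Av).
congr (_ <= N _); apply: (ip_ext ipq) => z; rewrite !ipEq.
by field; rewrite gt_eqF.
Qed.

Lemma resolvent_uniq (h : R) u v x : 0 < h ->
  A u (h^-1 *: (u - x)) -> A v (h^-1 *: (v - x)) -> u = v.
Proof.
move=> h0 Au Av; apply/eqP; rewrite -subr_eq0; apply/eqP/(ipnorm_eps0 ipq).
move=> e e0; rewrite (le_trans (resolvent_contract h0 Au Av)) //.
by rewrite subrr (ipnorm0 ipq) ltW.
Qed.

(** Solving u - h' A u = x amounts to finding a fixed point of
    u |-> (1 - h A)^-1 ((1 - c) u + c x) with c = h / h', which is a
    contraction when c is close to 1. *)
Lemma resolvable_near (h h' : R) : 0 < h -> 0 < h' ->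
  2^-1 <= h / h' <= 3 / 2 -> resolvable A h -> resolvable A h'.
Proof.
move=> h0 h'0 /andP[c1 c2] /choice[J JP] x; set c := h / h' in c1 c2.
pose T u := J ((1 - c) *: u + c *: x).
have [u v|u Tu] := @contraction_fixpoint _ _ _ ipq T cX.
  apply: le_trans (resolvent_contract h0 (JP _) (JP _)) _.
  rewrite opprD addrACA subrr addr0 -scalerBr ipnormZ //.
  by rewrite ler_wpM2r ?ipnorm_ge0 // ler_norml; lra.
exists u; have := JP ((1 - c) *: u + c *: x); rewrite -/(T u) Tu.
congr (A _ _); apply: (ip_ext ipq) => z; rewrite !ipEq /c.
by field; rewrite !gt_eqF.
Qed.

(** One contraction does not reach h / 2 from h, so one passes through
    2 h / 3. *)
Lemma resolvable_half (h : R) : 0 < h -> resolvable A h -> resolvable A (h / 2).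
Proof.
move=> h0 r.
have h1 : 0 < h * (2 / 3) by rewrite mulr_gt0 // divr_gt0.
have h2 : 0 < h / 2 by rewrite divr_gt0.
apply: (resolvable_near h1 h2); last apply: (resolvable_near h0 h1 _ r).
  have -> : h * (2 / 3) / (h / 2) = 4 / 3 by field; rewrite gt_eqF.
  by lra.
have -> : h / (h * (2 / 3)) = 3 / 2 by field; rewrite gt_eqF.
by lra.
Qed.

End Resolvent.

Section DyadicResolvents.
Context {R : realType} {X : lmodType R} {q : X -> X -> R}
  (ipq : inner_product q) (cX : complete q)
  {A : X -> X -> Prop} (oA : dissipative_op q A)
  {h0 : R} (h0_gt0 : 0 < h0) (rA : resolvable A h0).
Local Notation N := (ipnorm q).
Let ipEq := ipE ipq.

Definition step (n : nat) : R := h0 * 2^-1 ^+ n.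

Lemma step_gt0 n : 0 < step n.
Proof. by rewrite mulr_gt0 // exprn_gt0 // invr_gt0. Qed.

Lemma stepS n : step n = 2 * step n.+1.
Proof. by rewrite /step exprS; lra. Qed.

Lemma resolvable_step n : resolvable A (step n).
Proof.
elim: n => [|n IH]; first by rewrite /step mulr1.
have -> : step n.+1 = step n / 2 by rewrite /step exprS; lra.
by apply: (resolvable_half ipq cX oA) => //; exact: step_gt0.
Qed.

Lemma resolvent_ex : exists J : nat -> X -> X,
  forall n x, A (J n x) ((step n)^-1 *: (J n x - x)).
Proof.
have /choice[J JP] : forall n, exists J : X -> X,
    forall x, A (J x) ((step n)^-1 *: (J x - x)).
  move=> n; have /choice[J JP] : forall x, exists u,
    A u ((step n)^-1 *: (u - x)) by exact: resolvable_step.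
  by exists J.
by exists J.
Qed.

Definition resolvent : nat -> X -> X := sval (cid resolvent_ex).
Local Notation J := resolvent.
Local Notation h := step.

Lemma resolventP n x : A (J n x) ((h n)^-1 *: (J n x - x)).
Proof. exact: (svalP (cid resolvent_ex)). Qed.

Lemma resolvent_eq n u x : A u ((h n)^-1 *: (u - x)) -> u = J n x.
Proof.
move=> /(resolvent_uniq ipq oA (step_gt0 n)); apply; exact: resolventP.
Qed.

Lemma resolvent_eqB n u f x : A u f -> u - h n *: f = x -> u = J n x.
Proof.
move=> Au <-; apply: resolvent_eq; rewrite opprB addrCA subrr addr0 scalerA.
by rewrite mulVf ?scale1r // gt_eqF // step_gt0.
Qed.

Lemma resolventD n x y : J n (x + y) = J n x + J n y.
Proof.
symmetry; apply: resolvent_eq.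
rewrite opprD addrACA scalerDr; apply: (opD oA); exact: resolventP.
Qed.

Lemma resolventZ n a x : J n (a *: x) = a *: J n x.
Proof.
symmetry; apply: resolvent_eq.
rewrite -scalerBr scalerA mulrC -scalerA; apply: (opZ oA); exact: resolventP.
Qed.

Lemma resolventB n x y : J n (x - y) = J n x - J n y.
Proof. by rewrite -scaleN1r resolventD resolventZ scaleN1r. Qed.

Lemma resolvent_le n x : N (J n x) <= N x.
Proof.
have := resolvent_contract ipq oA (step_gt0 n) (resolventP n x) (resolventP n 0).
rewrite -(scale0r 0) resolventZ !scale0r !subr0; exact.
Qed.

Lemma resolvent_shift n x y : A x y -> J n x - x = h n *: J n y.
Proof.
move=> Axy; have hn0 : h n != 0 by rewrite gt_eqF // step_gt0.
suff <- : (h n)^-1 *: (J n x - x) = J n y by rewrite scalerA divff // scale1r.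
apply: resolvent_eq.
by apply: (opZ oA); apply: (opB oA) => //; exact: resolventP.
Qed.

Lemma resolvent_op n x y : A x y -> A (J n x) (J n y).
Proof.
move=> Axy; have := resolventP n x; rewrite (resolvent_shift n Axy) scalerA.
by rewrite mulVf ?scale1r // gt_eqF // step_gt0.
Qed.

(** The graph is closed because it is the set of pairs with
    u = J (u - h f), and J is continuous. *)
Lemma op_closed (u f : nat -> X) l g :
  (forall n, A (u n) (f n)) -> converges q u l -> converges q f g -> A l g.
Proof.
move=> Auf ul fg.
have uE n : u n = J 0 (u n - h 0 *: f n) by apply: resolvent_eqB (Auf n) _.
have lE : l = J 0 (l - h 0 *: g).
  apply: (converges_uniq ipq ul) => e e0.
  have [n hn] := convergesB ipq ul (convergesZ ipq (h 0) fg) e0.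
  exists n => m /hn hm.
  by rewrite uE -resolventB (le_trans (resolvent_le _ _)).
have := resolventP 0 (l - h 0 *: g); rewrite -lE opprB addrCA subrr addr0.
by rewrite scalerA mulVf ?scale1r // gt_eqF // step_gt0.
Qed.

(** Put p = J_m x - x = s A (J_m x) and r = J_n x - x = t A (J_n x) with steps
    t < s. Dissipativity gives <p - r, p / s - r / t> <= 0, and this forces
    <r, r> <= <p, r>, which is the claim. *)
Lemma resolvent_defect_decr m k x :
  N (J m x - x - (J (m + k)%N x - x)) ^+ 2 <=
  N (J m x - x) ^+ 2 - N (J (m + k)%N x - x) ^+ 2.
Proof.
case: k => [|k].
  by rewrite addn0 !subrr (ipnorm0 ipq) expr0n.
rewrite addnS -addSn.
have := op_diss oA (opB oA (resolventP m x) (resolventP (m.+1 + k)%N x)).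
have -> : J m x - J (m.+1 + k)%N x = (J m x - x) - (J (m.+1 + k)%N x - x).
  by rewrite opprB addrA subrK.
have ts : h (m.+1 + k)%N < h m.
  apply: (@le_lt_trans _ _ (h m.+1)).
    rewrite /step exprD mulrA ler_piMr ?(ltW (step_gt0 _)) //.
    by rewrite exprn_ile1 ?invr_ge0 ?invf_le1 ?ler1n.
  by rewrite [ltRHS]stepS; have := step_gt0 m.+1; lra.
move: (J m x - x) (J (m.+1 + k)%N x - x) (h m) (h (m.+1 + k)%N) (step_gt0 m)
  (step_gt0 (m.+1 + k)%N) ts => p r s t s0 t0 ts.
have := ip_ge0 ipq (p - r).
rewrite !(sqr_ipnorm ipq) !ipEq (ipC ipq r p).
move: (q p p) (q p r) (q r r) => a b c hpr H.
have H2 : t * (a - b) <= s * (b - c).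
  rewrite -subr_le0.
  have -> : t * (a - b) - s * (b - c) = s * t *
      (s^-1 * a - t^-1 * b + (- (s^-1 * b) - - (t^-1 * c))).
    by field; rewrite !gt_eqF.
  by rewrite pmulr_rle0 // mulr_gt0.
suff : 0 <= b - c by lra.
have [//|bc] := leP 0 (b - c).
have : t * (b - c) <= s * (b - c).
  by rewrite (le_trans _ H2) // ler_pM2l //; lra.
by rewrite ler_nM2r // leNgt ts.
Qed.

Lemma nonincreasing_tail_small (a : nat -> R) (e : R) :
  (forall n, 0 <= a n) -> 0 < e ->
  exists n0, forall m, a n0 - a m <= e.
Proof.
move=> a0 e0; pose E := range a.
have hE : has_inf E by split; [exists (a 0%N), 0%N | exists 0 => _ [n _ <-]].
have [_ [n0 _ <-] hn] := inf_adherent e0 hE.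
exists n0 => m; have : inf E <= a m by apply: ge_inf; [exact: hE.2|exists m].
by move: hn; rewrite -/E; lra.
Qed.

Lemma converges_ip u v l m (e : R) : converges q u l -> converges q v m ->
  0 < e -> exists n0, forall n, (n0 <= n)%N -> `|q (u n) (v n) - q l m| <= e.
Proof.
have cs x y : `|q x y| <= N x * N y.
  rewrite ler_norml cauchy_schwarz // andbT lerNl -(ipNl ipq).
  by rewrite -(ipnormN ipq x) cauchy_schwarz.
move=> ul vm e0; have Nl0 := ipnorm_ge0 q l; have Nm0 := ipnorm_ge0 q m.
pose d := e / (N l + N m + 2).
have d0 : 0 < d by rewrite divr_gt0 //; lra.
have [n1 h1] := ul _ d0; have [n2 h2] := vm _ d0; have [n3 h3] := vm _ ltr01.
exists (maxn n1 (maxn n2 n3)) => n; rewrite !geq_max => /and3P[/h1 {}h1 /h2 {}h2 /h3 {}h3].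
have -> : q (u n) (v n) - q l m = q (u n - l) (v n) + q l (v n - m).
  by rewrite !ipEq; ring.
rewrite (le_trans (ler_normD _ _)) //.
have H1 : `|q (u n - l) (v n)| <= d * (N m + 1).
  rewrite (le_trans (cs _ _)) // ler_pM ?ipnorm_ge0 //.
  by rewrite (le_trans (ipnorm_sub ipq _ m)) // addrC lerD2l.
have H2 : `|q l (v n - m)| <= N l * d.
  by rewrite (le_trans (cs _ _)) // ler_wpM2l.
have : d * (N l + N m + 2) = e by rewrite divfK // gt_eqF //; lra.
nra.
Qed.

(** Since their norms decrease, the defects J_n x - x converge
    (resolvent_defect_decr);
    the limit is orthogonal to the domain by dissipativity, and a vector p
    orthogonal to the domain satisfies J p = 0, hence A 0 (- p / h) and p = 0. *)
Lemma resolvent_cvg x : converges q (J^~ x) x.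
Proof.
have dom_orth p : (forall z f, A z f -> q p z = 0) -> p = 0.
  move=> orth; have Az := resolventP 0 p; have := op_diss oA Az.
  rewrite !ipEq (ipC ipq _ p) (orth _ _ Az) subr0 pmulr_rle0 ?invr_gt0 ?step_gt0 //.
  move=> z0; have z0E : J 0 p = 0.
    by apply: (ip_eq0 ipq); apply/eqP; rewrite eq_le z0 (ip_ge0 ipq).
  rewrite z0E in Az; have := op_fun oA Az.
  move/eqP; rewrite scaler_eq0 invr_eq0 gt_eqF ?step_gt0 //= sub0r oppr_eq0.
  by move/eqP.
pose p n := J n x - x.
have [l pl] : exists l, converges q p l.
  apply: cX => e e0; have e2 : 0 < e / 2 by rewrite divr_gt0.
  have [n0 hn0] := @nonincreasing_tail_small (fun n => N (p n) ^+ 2) _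
    (fun n => sqr_ge0 _) (exprn_gt0 2 e2).
  have H m : (n0 <= m)%N -> N (p n0 - p m) <= e / 2.
    move=> /subnKC <-; rewrite -(@ler_pXn2r _ 2) ?nnegrE ?ipnorm_ge0 ?(ltW e2) //.
    by rewrite (le_trans (resolvent_defect_decr _ _ _)) // hn0.
  exists n0 => m n /H hm /H hn; rewrite (le_trans (ipnorm_split ipq (p n0) _ _)) //.
  by rewrite [leRHS](splitr e) lerD // ipnormB.
suff l0 : l = 0.
  by move=> e e0; have [n0 hn0] := pl _ e0; exists n0 => n /hn0; rewrite l0 subr0.
apply: dom_orth => z f Az.
have Jl : converges q (J^~ x) (l + x).
  move=> e e0; have [n0 hn0] := pl _ e0; exists n0 => n /hn0.
  by rewrite /p opprD [- l - x]addrC addrA.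
(* Dissipativity is tested against c z; as c is arbitrary, q l z must vanish. *)
have key c : q l (l + x) - c * q l z <= 0.
  apply/ler_addgt0Pr => e e0; rewrite add0r.
  have e2 : 0 < e / 2 by rewrite divr_gt0.
  have Acz := opZ oA c Az.
  have [n1 hn1] := converges_ip pl
    (convergesB ipq Jl (converges_cst ipq (c *: z))) e2.
  have C0 : 0 <= h0 * (N (c *: f) * (N x + N (c *: z))).
    by rewrite !mulr_ge0 ?addr_ge0 ?ipnorm_ge0 // ltW.
  have [n2 hn2] := geometric_small C0 e2.
  have := hn1 _ (leq_maxl n1 n2); have := hn2 _ (leq_maxr n1 n2).
  set n := maxn n1 n2 => H2 H1.
  have := op_diss oA (opB oA (resolventP n x) Acz).
  rewrite -/(p n) => H3.
  have H4 : q (p n) (J n x - c *: z) <= h n * q (c *: f) (J n x - c *: z).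
    move: H3; move: (J n x - c *: z) (c *: f) (p n) => d g r.
    rewrite (ipDr ipq) (ipNr ipq) (ipZr ipq) (ipC ipq r) (ipC ipq g) subr_le0.
    by rewrite ler_pdivrMl ?step_gt0.
  have H5 : h n * q (c *: f) (J n x - c *: z) <= e / 2.
    rewrite (le_trans _ H2) // [leRHS]mulrAC -/(step n) ler_wpM2l ?(ltW (step_gt0 n)) //.
    rewrite (le_trans (cauchy_schwarz ipq _ _)) // ler_wpM2l ?ipnorm_ge0 //.
    by rewrite (le_trans (ipnormDB ipq _ _)) // lerD2r resolvent_le.
  move: H1; rewrite ler_norml => /andP[H1 _].
  have : q l (l + x - c *: z) <= e by lra.
  by rewrite (ipDr ipq) (ipNr ipq) (ipZr ipq).
have [//|b0] := eqVneq (q l z) 0.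
have := key ((q l (l + x) - 1) / q l z).
by rewrite divfK //; lra.
Qed.

(** Applying a resolvent twice lands in the domain of A^2. *)
Lemma domain2_dense x (e : R) : 0 < e ->
  exists y y1 y2, [/\ A y y1, A y1 y2 & N (x - y) <= e].
Proof.
move=> e0; have e2 : 0 < e / 2 by rewrite divr_gt0.
have [n /(_ n (leqnn _)) hn] := resolvent_cvg x e2.
exists (J n (J n x)), ((h n)^-1 *: (J n (J n x) - J n x)),
  ((h n)^-1 *: ((h n)^-1 *: (J n (J n x) - J n x) - (h n)^-1 *: (J n x - x))).
split; first exact: resolventP.
  by apply: (opZ oA); apply: (opB oA); exact: resolventP.
rewrite (le_trans (ipnorm_split ipq (J n x) _ _)) // (splitr e) lerD //.
  by rewrite ipnormB.
by rewrite -resolventB (le_trans (resolvent_le _ _)) // ipnormB.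
Qed.

(** * The implicit Euler scheme *)

Definition nsteps (n : nat) (t : R) : nat := Num.trunc (t / h n).

Definition euler (n : nat) (t : R) (x : X) : X := iter (nsteps n t) (J n) x.

(** The Riemann sum of the scheme, sampled at the right ends of the steps:
    with this choice A maps it exactly to an increment of the scheme. *)
Definition euler_sum (n : nat) (t : R) (x : X) : X :=
  h n *: \sum_(i < nsteps n t) iter i.+1 (J n) x.

Lemma nsteps_le n t : 0 <= t -> (nsteps n t)%:R * h n <= t.
Proof.
move=> t0; rewrite -ler_pdivlMr ?step_gt0 // truncn_le.
by rewrite divr_ge0 // ltW // step_gt0.
Qed.

Lemma nsteps_gt n t : t < (nsteps n t)%:R * h n + h n.
Proof.
rewrite -[X in _ + X]mul1r -mulrDl natr1 -ltr_pdivrMr ?step_gt0 //.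
exact: truncnS_gt.
Qed.

Lemma nsteps_step n k : nsteps n (k%:R * h n) = k.
Proof. by rewrite /nsteps mulfK ?gt_eqF ?step_gt0 // natrK. Qed.

Lemma le_nsteps n s t : s <= t -> (nsteps n s <= nsteps n t)%N.
Proof. by move=> st; rewrite le_truncn // ler_pM2r // invr_gt0 step_gt0. Qed.

Lemma nsteps_double n t : 0 <= t ->
  nsteps n.+1 t = (nsteps n t).*2 \/ nsteps n.+1 t = (nsteps n t).*2.+1.
Proof.
move=> t0; have h1 := step_gt0 n.+1; have hn := stepS n.
have [l0 l1] := (nsteps_le n t0, nsteps_gt n t).
have [k0 k1] := (nsteps_le n.+1 t0, nsteps_gt n.+1 t).
move: (nsteps n t) (nsteps n.+1 t) l0 l1 k0 k1 => m k l0 l1 k0 k1.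
have m2 : m.*2%:R = m%:R * 2 :> R by rewrite -muln2 natrM.
have kS : k.+1%:R = k%:R + 1 :> R by rewrite natr1.
have mS : m.*2.+2%:R = m%:R * 2 + 2 :> R by rewrite -doubleS -muln2 natrM; rewrite -natr1; ring.
have : (m.*2 < k.+1)%N.
  rewrite -(ltr_nat R) m2 kS -(ltr_pM2r h1) mulrDl mul1r.
  by apply: le_lt_trans k1; rewrite (le_trans _ l0) // hn; lra.
have : (k < m.*2.+2)%N.
  rewrite -(ltr_nat R) mS -(ltr_pM2r h1).
  by apply: le_lt_trans k0 _; rewrite (lt_le_trans l1) // hn; lra.
rewrite !ltnS leq_eqVlt => /orP[/eqP -> _|]; first by right.
by rewrite ltnS => k2 k3; left; apply/eqP; rewrite eqn_leq k2 k3.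
Qed.

Lemma iter_resolventB n k x y :
  iter k (J n) (x - y) = iter k (J n) x - iter k (J n) y.
Proof. by elim: k => //= k ->; rewrite resolventB. Qed.

Lemma iter_resolvent_le n k x : N (iter k (J n) x) <= N x.
Proof. by elim: k => //= k IH; rewrite (le_trans (resolvent_le _ _)). Qed.

Lemma iter_resolvent_op n k x y :
  A x y -> A (iter k (J n) x) (iter k (J n) y).
Proof. by move=> Axy; elim: k => //= k IH; exact: resolvent_op. Qed.

Lemma eulerB n t x y : euler n t (x - y) = euler n t x - euler n t y.
Proof. exact: iter_resolventB. Qed.

Lemma euler_le n t x : N (euler n t x) <= N x.
Proof. exact: iter_resolvent_le. Qed.

Lemma euler_op n t x y : A x y -> A (euler n t x) (euler n t y).
Proof. exact: iter_resolvent_op. Qed.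

Lemma euler_sumB n t x y :
  euler_sum n t (x - y) = euler_sum n t x - euler_sum n t y.
Proof.
rewrite /euler_sum -scalerBr -sumrB; congr (_ *: _).
by apply: eq_bigr => i _; rewrite iter_resolventB.
Qed.

Lemma sum_iter_resolvent_le n k x :
  N (\sum_(i < k) iter i.+1 (J n) x) <= k%:R * N x.
Proof.
apply: (@le_trans _ _ (\sum_(i < k) N x)).
  apply: (ipnorm_sum ipq (c := fun=> N x) (F := fun i => iter i.+1 (J n) x)).
  by move=> i _; exact: iter_resolvent_le.
by rewrite sumr_const card_ord mulr_natl.
Qed.

Lemma euler_sum_le n t x : 0 <= t -> N (euler_sum n t x) <= t * N x.
Proof.
move=> t0; rewrite /euler_sum ipnormZ // gtr0_norm ?step_gt0 //.
rewrite (le_trans (ler_wpM2l (ltW (step_gt0 n)) (sum_iter_resolvent_le _ _ _))) //.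
by rewrite mulrA ler_wpM2r ?ipnorm_ge0 // mulrC nsteps_le.
Qed.

(** A telescoping sum: the increment of one Euler step is h times the
    operator at the new point. *)
Lemma euler_sum_op n t x : A (euler_sum n t x) (euler n t x - x).
Proof.
rewrite /euler_sum /euler; elim: (nsteps n t) => [|k IH].
  rewrite big_ord0 subrr; have := opZ oA 0 (resolventP 0 0).
  by rewrite !scale0r scaler0.
rewrite big_ord_recr scalerDr /=.
have -> : J n (iter k (J n) x) - x = iter k (J n) x - x +
    (J n (iter k (J n) x) - iter k (J n) x) by rewrite [RHS]addrC addrA subrK.
apply: (opD oA IH); have := opZ oA (h n) (resolventP n (iter k (J n) x)).
by rewrite scalerA divff ?scale1r // gt_eqF // step_gt0.
Qed.

Lemma euler_increment n t x y : A x y -> euler n t x - x = euler_sum n t y.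
Proof.
move=> Axy; rewrite /euler_sum /euler; elim: (nsteps n t) => [|k IH].
  by rewrite big_ord0 scaler0 subrr.
rewrite big_ord_recr scalerDr /= -IH -(resolvent_shift n (iter_resolvent_op _ _ Axy)).
by rewrite [RHS]addrC addrA subrK.
Qed.

(** Halving the step changes one step of the scheme by O(h^2), because
    (1 - h A)^-1 and (1 - h/2 A)^-2 agree to first order. *)
Lemma euler_halving n x y z : A x y -> A y z ->
  N (J n.+1 (J n.+1 x) - J n x) <= h n.+1 ^+ 2 * N z.
Proof.
move=> Axy Ayz; set K := J n.+1.
have AKK u v : A u v -> A (K (K u)) (K (K v)).
  by move=> Auv; do 2! apply: resolvent_op.
have e1 : K (K x) - x = h n *: K (K y) - h n.+1 ^+ 2 *: K (K z).
  have a1 : K x - x = h n.+1 *: K y := resolvent_shift n.+1 Axy.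
  have a2 : K (K x) - K x = h n.+1 *: K (K y).
    exact: resolvent_shift (resolvent_op n.+1 Axy).
  have a3 : K (K y) - K y = h n.+1 *: K (K z).
    exact: resolvent_shift (resolvent_op n.+1 Ayz).
  have -> : K (K x) - x = (K (K x) - K x) + (K x - x) by rewrite addrA subrK.
  have a4 : K y = K (K y) - h n.+1 *: K (K z) by rewrite -a3 opprB addrC subrK.
  rewrite a1 a2 [in X in _ + X]a4 (stepS n).
  by apply: (ip_ext ipq) => w; rewrite !ipEq; ring.
have e2 : K (K x) - J n x = - (h n.+1 ^+ 2 *: J n (K (K z))).
  have := resolvent_shift n (AKK _ _ Axy); move: (congr1 (J n) e1).
  rewrite !resolventB !resolventZ => e3 e4.
  have -> : K (K x) - J n x = (J n (K (K x)) - J n x) -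
    (J n (K (K x)) - K (K x)) by rewrite opprB [RHS]addrC addrA subrK.
  by rewrite e3 e4 [LHS]addrC addKr.
rewrite e2 (ipnormN ipq) (ipnormZ ipq) ger0_norm ?sqr_ge0 // ler_wpM2l ?sqr_ge0 //.
by rewrite (le_trans (resolvent_le _ _)) // (iter_resolvent_le n.+1 2).
Qed.

Lemma euler_halving_iter n j x y z : A x y -> A y z ->
  N (iter j.*2 (J n.+1) x - iter j (J n) x) <= j%:R * (h n.+1 ^+ 2 * N z).
Proof.
move=> Axy Ayz; elim: j => [|j IH]; first by rewrite subrr (ipnorm0 ipq) mul0r.
rewrite doubleS !iterS -natr1 mulrDl mul1r [leRHS]addrC.
set w := iter j.*2 _ x.
rewrite (le_trans (ipnorm_split ipq (J n w) _ _)) // lerD //.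
  have := euler_halving n (iter_resolvent_op n.+1 j.*2 Axy)
    (iter_resolvent_op n.+1 j.*2 Ayz).
  move=> /le_trans; apply; rewrite ler_wpM2l ?sqr_ge0 //.
  exact: iter_resolvent_le.
by rewrite -resolventB (le_trans (resolvent_le _ _)).
Qed.

(** The O(h^2) errors of t / h steps add up to O(h), and the finer grid may
    contain one more step, of length O(h). *)
Lemma euler_consecutive n t x y z : 0 <= t -> A x y -> A y z ->
  N (euler n.+1 t x - euler n t x) <= h n.+1 * (N y + t * N z).
Proof.
move=> t0 Axy Ayz; rewrite /euler.
have h1 := step_gt0 n.+1; have mt := nsteps_le n t0.
have B : N (iter (nsteps n t).*2 (J n.+1) x - iter (nsteps n t) (J n) x) <=
    h n.+1 * (t * N z).
  rewrite (le_trans (euler_halving_iter _ _ Axy Ayz)) //.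
  rewrite [in leLHS]mulrA [in leRHS]mulrA ler_wpM2r ?ipnorm_ge0 // expr2 mulrA mulrC.
  by rewrite ler_wpM2l ?(ltW h1) // (le_trans _ mt) // ler_wpM2l // (stepS n); lra.
have y0 := ipnorm_ge0 q y.
case: (nsteps_double n t0) => ->; first by rewrite mulrDr (le_trans B) // lerDr mulr_ge0 // ltW.
rewrite (le_trans (ipnorm_split ipq (iter (nsteps n t).*2 (J n.+1) x) _ _)) //.
rewrite mulrDr lerD // iterS.
rewrite (resolvent_shift n.+1 (iter_resolvent_op _ _ Axy)) (ipnormZ ipq).
rewrite gtr0_norm // ler_wpM2l ?(ltW h1) //.
by rewrite -iterS iter_resolvent_le.
Qed.

(** Each term of the coarse sum is compared with the two terms of the fine sum
    that cover the same step. *)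
Lemma euler_sum_consecutive n t x y z : 0 <= t -> A x y -> A y z ->
  N (euler_sum n.+1 t x - euler_sum n t x) <=
  h n.+1 * (N x + t * (N y + t * N z)).
Proof.
move=> t0 Axy Ayz; rewrite /euler_sum.
have h1 := step_gt0 n.+1; have mt := nsteps_le n t0; have hE := stepS n.
have [[x0 y0] z0] := (ipnorm_ge0 q x, ipnorm_ge0 q y, ipnorm_ge0 q z).
have := nsteps_double n t0; set m := nsteps n t in mt *.
set k := h n.+1 in h1 hE * => m2.
have mk : m%:R * k * 2 <= t by rewrite -mulrA -(mulrC 2) -hE.
have B : N (k *: (\sum_(i < m.*2) iter i.+1 (J n.+1) x) -
    h n *: \sum_(i < m) iter i.+1 (J n) x) <= k * (t * (N y + t * N z)).
  have -> : h n *: \sum_(i < m) iter i.+1 (J n) x =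
      k *: \sum_(i < m) (iter i.+1 (J n) x + iter i.+1 (J n) x).
    rewrite big_split /=; move: (\sum_(i < m) _) => S.
    by rewrite hE; apply: (ip_ext ipq) => w; rewrite !ipEq; ring.
  have -> : \sum_(i < m.*2) iter i.+1 (J n.+1) x =
      \sum_(i < m) (iter i.*2.+1 (J n.+1) x + iter i.*2.+2 (J n.+1) x).
    elim: (m) => [|j IH]; first by rewrite !big_ord0.
    by rewrite doubleS !big_ord_recr /= IH addrA.
  rewrite -scalerBr -sumrB (ipnormZ ipq) gtr0_norm // ler_wpM2l ?(ltW h1) //.
  pose c := k * N y + 2 * (m%:R * (k ^+ 2 * N z)).
  apply: (@le_trans _ _ (\sum_(i < m) c)); last first.
    rewrite sumr_const card_ord -mulr_natl /c.
    have mk0 : 0 <= m%:R * k by rewrite mulr_ge0 // ltW.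
    have -> : m%:R * (k * N y + 2 * (m%:R * (k ^+ 2 * N z))) =
      (m%:R * k) * N y + (m%:R * k) * (m%:R * k * 2) * N z by ring.
    have H1 : m%:R * k <= t by lra.
    have H2 : (m%:R * k) * (m%:R * k * 2) <= t * t by rewrite ler_pM // mulr_ge0.
    by rewrite [leRHS]mulrDr [X in _ <= _ + X]mulrA lerD // ler_wpM2r.
  apply: (ipnorm_sum ipq (c := fun=> c)
    (F := fun i => iter i.*2.+1 (J n.+1) x + iter i.*2.+2 (J n.+1) x
      - (iter i.+1 (J n) x + iter i.+1 (J n) x))) => i im.
  have D : N (iter i.*2.+2 (J n.+1) x - iter i.+1 (J n) x) <= m%:R * (k ^+ 2 * N z).
    rewrite -doubleS (le_trans (euler_halving_iter _ _ Axy Ayz)) //.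
    by rewrite ler_wpM2r ?ler_nat // mulr_ge0 // sqr_ge0.
  rewrite opprD addrACA (le_trans (ipnormD ipq _ _)) // /c mulrDl mul1r addrA lerD //.
  rewrite (le_trans (ipnorm_split ipq (iter i.*2.+2 (J n.+1) x) _ _)) // lerD //.
  rewrite (ipnormB ipq) iterS (resolvent_shift n.+1 (iter_resolvent_op _ _ Axy)).
  rewrite (ipnormZ ipq) gtr0_norm // ler_wpM2l ?(ltW h1) //.
  by rewrite -iterS iter_resolvent_le.
case: m2 => ->; first by rewrite mulrDr (le_trans B) // lerDr mulr_ge0 // ltW.
rewrite big_ord_recr scalerDr addrAC [leRHS]mulrDr (le_trans (ipnormD ipq _ _)) // [leRHS]addrC lerD //.
rewrite (ipnormZ ipq) gtr0_norm // ler_wpM2l ?(ltW h1) //.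
exact: iter_resolvent_le.
Qed.

(** * The contraction semigroup and its primitive *)

(** The consecutive estimates are available on a dense set, and the families
    are equicontinuous, so they are uniformly Cauchy everywhere. *)
Lemma dense_uniform_cauchy (F : nat -> R -> X -> X) (T c : R) :
  0 <= c ->
  (forall n t x y, F n t (x - y) = F n t x - F n t y) ->
  (forall n t x, 0 <= t <= T -> N (F n t x) <= c * N x) ->
  (forall x y z, A x y -> A y z -> exists2 C, 0 <= C &
    forall n t, 0 <= t <= T -> N (F n.+1 t x - F n t x) <= C * 2^-1 ^+ n) ->
  forall x e, 0 < e -> exists n0, forall n, (n0 <= n)%N ->
    forall k t, 0 <= t <= T -> N (F (n + k)%N t x - F n t x) <= e.
Proof.
move=> c0 FB Fc Fs x e e0; pose d := e / (2 * (2 * c + 1)).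
have c20 : 0 < 2 * (2 * c + 1) by lra.
have d0 : 0 < d by rewrite divr_gt0.
have [y [y1 [y2 [Ay Ay1 xy]]]] := domain2_dense x d0.
have [C C0 hC] := Fs _ _ _ Ay Ay1.
have C20 : 0 <= 2 * C by lra.
have [n0 hn0] := geometric_small C20 d0.
exists n0 => n /hn0 hn k t tT.
have B m : N (F m t x - F m t y) <= c * d.
  by rewrite -FB (le_trans (Fc _ _ _ tT)) // ler_wpM2l.
rewrite (le_trans (ipnorm_split ipq (F (n + k)%N t y) _ _)) //.
have H1 : N (F (n + k)%N t y - F n t x) <= d + c * d.
  rewrite (le_trans (ipnorm_split ipq (F n t y) _ _)) // lerD //; last first.
    by rewrite (ipnormB ipq).
  rewrite (le_trans _ hn) //.
  by apply: (@geometric_cauchy _ _ _ ipq (fun m => F m t y)) => // m; exact: hC.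
apply: (le_trans (lerD (B _) H1)).
have : d * (2 * (2 * c + 1)) = e by rewrite divfK // gt_eqF.
by nra.
Qed.

Lemma euler_uniform_cauchy T x (e : R) : 0 < e ->
  exists n0, forall n, (n0 <= n)%N -> forall k t, 0 <= t <= T ->
    N (euler (n + k)%N t x - euler n t x) <= e.
Proof.
move: x e; apply: (@dense_uniform_cauchy euler T 1) => //.
- exact: eulerB.
- by move=> n t x _; rewrite mul1r; exact: euler_le.
move=> x y z Axy Ayz; have [y0 z0] := (ipnorm_ge0 q y, ipnorm_ge0 q z).
exists (h0 * (N y + `|T| * N z)).
  by rewrite mulr_ge0 ?(ltW h0_gt0) // addr_ge0 // mulr_ge0.
move=> n t /andP[t0 tT]; rewrite (le_trans (euler_consecutive n t0 Axy Ayz)) //.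
rewrite [leRHS]mulrAC; apply: ler_pM.
- exact: ltW (step_gt0 _).
- by rewrite addr_ge0 // mulr_ge0.
- by have := step_gt0 n.+1; rewrite -/(h n) (stepS n); lra.
- by rewrite lerD2l ler_wpM2r // (le_trans tT) // ler_norm.
Qed.

Lemma euler_sum_uniform_cauchy T x (e : R) : 0 <= T -> 0 < e ->
  exists n0, forall n, (n0 <= n)%N -> forall k t, 0 <= t <= T ->
    N (euler_sum (n + k)%N t x - euler_sum n t x) <= e.
Proof.
move=> T0; move: x e; apply: (@dense_uniform_cauchy euler_sum T T) => //.
- exact: euler_sumB.
- move=> n t x /andP[t0 tT]; rewrite (le_trans (euler_sum_le _ _ t0)) //.
  by rewrite ler_wpM2r // ipnorm_ge0.
move=> x y z Axy Ayz.
have [[x0 y0] z0] := (ipnorm_ge0 q x, ipnorm_ge0 q y, ipnorm_ge0 q z).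
exists (h0 * (N x + T * (N y + T * N z))).
  rewrite mulr_ge0 ?(ltW h0_gt0) // addr_ge0 // mulr_ge0 // addr_ge0 //.
  by rewrite mulr_ge0.
move=> n t /andP[t0 tT]; rewrite (le_trans (euler_sum_consecutive n t0 Axy Ayz)) //.
have B : N y + t * N z <= N y + T * N z by rewrite lerD2l ler_wpM2r.
have B0 : 0 <= N y + t * N z by rewrite addr_ge0 // mulr_ge0.
rewrite [leRHS]mulrAC; apply: ler_pM.
- exact: ltW (step_gt0 _).
- by rewrite addr_ge0 // mulr_ge0.
- by have := step_gt0 n.+1; rewrite -/(h n) (stepS n); lra.
- by rewrite lerD2l ler_pM.
Qed.

Lemma uniform_cauchy_ex (F : nat -> R -> X -> X) :
  (forall T x e, 0 <= T -> 0 < e -> exists n0, forall n, (n0 <= n)%N ->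
    forall k t, 0 <= t <= T -> N (F (n + k)%N t x - F n t x) <= e) ->
  exists S : R -> X -> X, forall T x e, 0 <= T -> 0 < e ->
    exists n0, forall n, (n0 <= n)%N ->
      forall t, 0 <= t <= T -> N (F n t x - S t x) <= e.
Proof.
move=> Fc.
have /choice[S SP] : forall tx : R * X, exists l,
    0 <= tx.1 -> converges q (fun n => F n tx.1 tx.2) l.
  move=> [t x] /=; have [t0|t0] := leP 0 t; last by exists 0.
  suff [l hl] : exists l, converges q (fun n => F n t x) l by exists l.
  apply: cX => e e0; have e2 : 0 < e / 2 by rewrite divr_gt0.
  have [n0 hn0] := Fc t x _ t0 e2; have tt : 0 <= t <= t by rewrite t0 lexx.
  exists n0 => m n /subnKC <- /subnKC <-.
  rewrite (le_trans (ipnorm_split ipq (F n0 t x) _ _)) // [leRHS](splitr e).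
  by rewrite lerD ?hn0 // ipnormB // hn0.
exists (fun t x => S (t, x)) => T x e T0 e0.
have [n0 hn0] := Fc T x _ T0 e0; exists n0 => n nn0 t tT.
rewrite (ipnormB ipq); have /andP[t0 _] := tT.
apply: (converges_le ipq (SP (t, x) t0) (n0 := n)) => m /subnKC <- /=.
exact: hn0.
Qed.

Lemma flow_ex : exists S : R -> X -> X, forall T x e, 0 <= T -> 0 < e ->
  exists n0, forall n, (n0 <= n)%N ->
    forall t, 0 <= t <= T -> N (euler n t x - S t x) <= e.
Proof.
by apply: uniform_cauchy_ex => T x e _; exact: euler_uniform_cauchy.
Qed.

Lemma flow_int_ex : exists S : R -> X -> X, forall T x e, 0 <= T -> 0 < e ->
  exists n0, forall n, (n0 <= n)%N ->
    forall t, 0 <= t <= T -> N (euler_sum n t x - S t x) <= e.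
Proof. by apply: uniform_cauchy_ex; exact: euler_sum_uniform_cauchy. Qed.

Definition flow : R -> X -> X := sval (cid flow_ex).

(** The limit of the Riemann sums; flow_int_increment identifies it with the
    integral of the flow from time 0. *)
Definition flow_int : R -> X -> X := sval (cid flow_int_ex).

Lemma flow_uniform T x (e : R) : 0 <= T -> 0 < e ->
  exists n0, forall n, (n0 <= n)%N ->
    forall t, 0 <= t <= T -> N (euler n t x - flow t x) <= e.
Proof. exact: (svalP (cid flow_ex)). Qed.

Lemma euler_cvg t x : 0 <= t -> converges q (fun n => euler n t x) (flow t x).
Proof.
move=> t0 e e0; have [n0 hn0] := flow_uniform x t0 e0.
by exists n0 => n nn0; rewrite hn0 // t0 lexx.
Qed.

Lemma euler_sum_cvg t x :
  0 <= t -> converges q (fun n => euler_sum n t x) (flow_int t x).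
Proof.
move=> t0 e e0; have [n0 hn0] := svalP (cid flow_int_ex) t x e t0 e0.
by exists n0 => n nn0; rewrite hn0 // t0 lexx.
Qed.

Lemma flow_op t x y : 0 <= t -> A x y -> A (flow t x) (flow t y).
Proof.
move=> t0 Axy; apply: op_closed (euler_cvg x t0) (euler_cvg y t0) => n.
exact: euler_op.
Qed.

Lemma flow_int_op t x : 0 <= t -> A (flow_int t x) (flow t x - x).
Proof.
move=> t0; apply: op_closed (euler_sum_cvg x t0)
  (convergesB ipq (euler_cvg x t0) (converges_cst ipq x)) => n.
exact: euler_sum_op.
Qed.

Lemma flow_increment t x y : 0 <= t -> A x y -> flow t x - x = flow_int t y.
Proof.
move=> t0 Axy; apply: (converges_uniq ipq) (euler_sum_cvg y t0).
have := convergesB ipq (euler_cvg x t0) (converges_cst ipq x).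
by under eq_fun do rewrite (euler_increment _ _ Axy).
Qed.

Lemma flowB t x y : 0 <= t -> flow t (x - y) = flow t x - flow t y.
Proof.
move=> t0; apply: (converges_uniq ipq (euler_cvg _ t0)).
have := convergesB ipq (euler_cvg x t0) (euler_cvg y t0).
by under eq_fun do rewrite -eulerB.
Qed.

Lemma flow_le t x : 0 <= t -> N (flow t x) <= N x.
Proof.
move=> t0; rewrite -[flow t x]subr0.
by apply: (converges_le ipq (euler_cvg x t0) (n0 := 0)) => n _; rewrite subr0 euler_le.
Qed.

Lemma nsteps0 n : nsteps n 0 = 0%N.
Proof. by rewrite -(mul0r (h n)) -[0](mulr0n 1) nsteps_step. Qed.

Lemma flow0 x : flow 0 x = x.
Proof.
apply: (converges_uniq ipq (euler_cvg x (lexx 0))).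
by rewrite /euler; under eq_fun do rewrite nsteps0; exact: converges_cst.
Qed.

Lemma flow_int0 x : flow_int 0 x = 0.
Proof.
apply: (converges_uniq ipq (euler_sum_cvg x (lexx 0))).
rewrite /euler_sum; under eq_fun do rewrite nsteps0 big_ord0 scaler0.
exact: converges_cst.
Qed.

(** The discrete form of flow_int_increment. *)
Lemma euler_sum_increment n j m y z (M : R) :
  (forall i, (j <= i < j + m)%N -> N (iter i.+1 (J n) y - z) <= M) ->
  N (h n *: (\sum_(i < j + m) iter i.+1 (J n) y) -
     h n *: (\sum_(i < j) iter i.+1 (J n) y) - (m%:R * h n) *: z) <=
  m%:R * h n * M.
Proof.
elim: m => [|m IH] hm.
  by rewrite addn0 subrr !mul0r scale0r subrr (ipnorm0 ipq).
rewrite addnS big_ord_recr /=.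
set a := h n *: \sum_(i < j) _; set s := \sum_(i < j + m) _.
have -> : h n *: (s + J n (iter (j + m) (J n) y)) - a - (m.+1%:R * h n) *: z =
    (h n *: s - a - (m%:R * h n) *: z) + h n *: (iter (j + m).+1 (J n) y - z).
  move: s a (J n) => s a K; rewrite -natr1.
  by apply: (ip_ext ipq) => w; rewrite !ipEq; ring.
rewrite (le_trans (ipnormD ipq _ _)) // -natr1 !mulrDl mul1r lerD //.
  by apply: IH => i /andP[ji im]; rewrite hm // ji addnS ltnW.
rewrite (ipnormZ ipq) gtr0_norm ?step_gt0 // ler_wpM2l ?(ltW (step_gt0 n)) //.
by rewrite hm // leq_addr addnS leqnn.
Qed.

(** This mean value inequality says that flow_int is a primitive of the flow. *)
Lemma flow_int_increment s t y z (M : R) : 0 <= s -> s <= t ->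
  (forall r, s <= r <= t -> N (flow r y - z) <= M) ->
  N (flow_int t y - flow_int s y - (t - s) *: z) <= (t - s) * M.
Proof.
move=> s0 st hM; have t0 := le_trans s0 st.
have M0 : 0 <= M by rewrite (le_trans _ (hM s _)) ?ipnorm_ge0 // lexx.
have z0 := ipnorm_ge0 q z.
apply: ipnorm_le_eps => eps eps0.
pose C := 3 + (t - s) + M + N z; have C0 : 0 < C by rewrite /C; lra.
pose e := Num.min 1 (eps / C).
have e0 : 0 < e by rewrite lt_min ltr01 divr_gt0.
have e1 : e <= 1 by rewrite ge_min lexx.
have eC : e * C <= eps by rewrite -ler_pdivlMr // ge_min lexx orbT.
have [n1 H1] := flow_uniform y t0 e0.
have [n2 H2] := euler_sum_cvg y t0 e0.
have [n3 H3] := euler_sum_cvg y s0 e0.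
have [n4 H4] := geometric_small (ltW h0_gt0) e0.
pose n := maxn (maxn n1 n2) (maxn n3 n4).
have /H1 {}H1 : (n1 <= n)%N by rewrite !leq_max leqnn.
have /H2 {}H2 : (n2 <= n)%N by rewrite !leq_max leqnn orbT.
have /H3 {}H3 : (n3 <= n)%N by rewrite !leq_max leqnn !orbT.
have /H4 {}H4 : (n4 <= n)%N by rewrite !leq_max leqnn !orbT.
rewrite -/(h n) in H4; have hn0 := step_gt0 n.
have /subnKC := le_nsteps n st; set m := (_ - _)%N; set j := nsteps n s => kE.
have [t1 t2] := (nsteps_le n t0, nsteps_gt n t).
have [s1 s2] := (nsteps_le n s0, nsteps_gt n s).
rewrite -/j in s1 s2; rewrite -kE natrD in t1 t2.
have H5 : N (euler_sum n t y - euler_sum n s y - (m%:R * h n) *: z) <=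
    m%:R * h n * (M + e).
  rewrite /euler_sum -kE -/j; apply: euler_sum_increment => i /andP[ji ik].
  have jiR : j%:R <= i%:R :> R by rewrite ler_nat.
  have ikR : i%:R + 1 <= j%:R + m%:R :> R by rewrite natr1 -natrD ler_nat.
  have b1 : s <= i.+1%:R * h n by rewrite -natr1; nra.
  have b2 : i.+1%:R * h n <= t by rewrite -natr1; nra.
  rewrite (le_trans (ipnorm_split ipq (flow (i.+1%:R * h n) y) _ _)) //.
  rewrite addrC lerD ?hM ?b1 ?b2 //.
  have := H1 (i.+1%:R * h n); rewrite /euler nsteps_step; apply.
  by rewrite b2 andbT (le_trans s0).
have m0 : 0 <= m%:R :> R by [].
have mh : `|m%:R * h n - (t - s)| <= h n by rewrite ler_norml; apply/andP; split; lra.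
have -> : flow_int t y - flow_int s y - (t - s) *: z =
    (flow_int t y - euler_sum n t y) - (flow_int s y - euler_sum n s y) +
    ((euler_sum n t y - euler_sum n s y - (m%:R * h n) *: z) +
    (m%:R * h n - (t - s)) *: z).
  by apply: (ip_ext ipq) => w; rewrite !ipEq; ring.
rewrite (le_trans (ipnormD ipq _ _)) //.
have K1 := ipnormDB ipq (flow_int t y - euler_sum n t y) (flow_int s y - euler_sum n s y).
have K2 := ipnormD ipq (euler_sum n t y - euler_sum n s y - (m%:R * h n) *: z)
  ((m%:R * h n - (t - s)) *: z).
rewrite (ipnormZ ipq) in K2.
rewrite (ipnormB ipq) in H2; rewrite (ipnormB ipq) in H3.
have K3 : `|m%:R * h n - (t - s)| * N z <= e * N z.
  by rewrite ler_wpM2r // (le_trans mh).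
have K4 : m%:R * h n * (M + e) <= (t - s + e) * (M + e).
  by rewrite ler_wpM2r ?addr_ge0 ?(ltW e0) //; move: mh; rewrite ler_norml; lra.
have K5 : e * e <= e by rewrite ler_piMr // ltW.
have eCE : e * C = 3 * e + e * (t - s) + e * M + e * N z by rewrite /C; ring.
move: K1 K2 K3 K4 H2 H3 H5 eC K5; rewrite eCE; lra.
Qed.

Lemma flow_lipschitz s t x y : 0 <= s -> s <= t -> A x y ->
  N (flow t x - flow s x) <= (t - s) * N y.
Proof.
move=> s0 st Axy; have t0 := le_trans s0 st.
have -> : flow t x - flow s x = flow_int t y - flow_int s y - (t - s) *: 0.
  by rewrite scaler0 subr0 -!(flow_increment _ Axy) // opprB addrA subrK.
apply: flow_int_increment => // r /andP[sr rt].
by rewrite subr0 flow_le // (le_trans s0).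
Qed.

(** The flow is Lipschitz in time on the domain, which is dense, and it
    consists of contractions. *)
Lemma flow_uniform_continuous x (e : R) : 0 < e -> exists2 d, 0 < d &
  forall s t, 0 <= s -> 0 <= t -> `|s - t| <= d -> N (flow s x - flow t x) <= e.
Proof.
move=> e0; have e3 : 0 < e / 3 by rewrite divr_gt0.
have [y [y1 [_ [Ay _ xy]]]] := domain2_dense x e3.
have y10 := ipnorm_ge0 q y1.
exists (e / 3 / (N y1 + 1)); first by rewrite divr_gt0 // ltr_wpDl.
move=> s t; wlog ts : s t / t <= s.
  move=> W s0 t0; have [ts|/ltW st] := leP t s; first exact: W.
  by rewrite distrC (ipnormB ipq); exact: W.
move=> s0 t0; rewrite ger0_norm ?subr_ge0 // ler_pdivlMr ?ltr_wpDl // => hd.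
have B r : 0 <= r -> N (flow r x - flow r y) <= e / 3.
  by move=> r0; rewrite -flowB // (le_trans (flow_le _ r0)).
have L := flow_lipschitz t0 ts Ay.
have := ipnorm_split ipq (flow s y) (flow s x) (flow t x).
have := ipnorm_split ipq (flow t y) (flow s y) (flow t x).
have := B s s0; have := B t t0; rewrite (ipnormB ipq (flow t x)).
have : (s - t) * N y1 <= (s - t) * (N y1 + 1) by rewrite ler_wpM2l ?subr_ge0 // lerDl.
lra.
Qed.

End DyadicResolvents.

(** * Uniqueness of trajectories and Riemann integrals *)

(** Let m be the infimum of the times t with f T - e T <= f t - e t. By
    continuity m is such a time, and if m > 0 then the hypothesis on left slopes
    would produce an earlier one. *)
Lemma left_slope_nonincreasing (R : realType) (f : R -> R) (T : R) :
  0 <= T ->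
  (forall t e, 0 <= t -> 0 < e -> exists2 d, 0 < d &
     forall s, 0 <= s -> `|s - t| < d -> `|f s - f t| <= e) ->
  (forall t e, 0 < t -> 0 < e -> exists2 d, 0 < d &
     forall r, 0 < r -> r < d -> r <= t -> f t <= f (t - r) + e * r) ->
  f T <= f 0.
Proof.
move=> T0 fc fl; suff H e : 0 < e -> f T <= f 0 + e * T.
  apply/ler_addgt0Pr => e e0; have T1 : 0 < T + 1 by rewrite ltr_wpDl.
  rewrite (le_trans (H _ (divr_gt0 e0 T1))) // lerD2l mulrAC.
  by rewrite ler_pdivrMr // ler_wpM2l ?(ltW e0) // lerDl.
move=> e0; pose g t := f t - e * t.
pose E := [set t | 0 <= t /\ g T <= g t]%classic.
have ET : E T by [].
have hE : has_inf E by split; [exists T | exists 0 => t []].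
pose m := inf E.
have m0 : 0 <= m by apply: lb_le_inf; [exists T|move=> t []].
have mE t : E t -> m <= t by move=> Et; apply: ge_inf => //; exact: hE.2.
have gm : g T <= g m.
  apply/ler_addgt0Pr => d d0; have d2 : 0 < d / 2 by rewrite divr_gt0.
  have [r r0 hr] := fc m _ m0 d2.
  have er : 0 < Num.min r (d / 2 / e) by rewrite lt_min r0 divr_gt0.
  have [t Et tm] := inf_adherent er hE.
  have mt := mE _ Et; have [t0 gt] := Et.
  have tmr : t - m < Num.min r (d / 2 / e) by rewrite ltrBlDr addrC.
  move: tmr; rewrite lt_min ltr_pdivlMr // => /andP[tr te].
  have := hr t t0; rewrite ger0_norm ?subr_ge0 // => /(_ tr).
  by rewrite ler_norml; move: gt; rewrite /g; nra.
have [mp|mn] := ltP 0 m; last first.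
  have m00 : m = 0 by apply/eqP; rewrite eq_le mn m0.
  by move: gm; rewrite m00 /g; lra.
have e2 : 0 < e / 2 by rewrite divr_gt0.
have [d d0 hd] := fl m _ mp e2.
pose r := Num.min (d / 2) m.
have r0 : 0 < r by rewrite lt_min mp divr_gt0.
have rd : r < d by rewrite gt_min; apply/orP; left; lra.
have rm : r <= m by rewrite ge_min lexx orbT.
have H := hd r r0 rd rm.
have : E (m - r).
  split; first by rewrite subr_ge0.
  by move: gm; rewrite /g; nra.
by move=> /mE; lra.
Qed.

Section Trajectories.
Context {R : realType} {X : lmodType R} (q : X -> X -> R)
  (ipq : inner_product q).
Local Notation N := (ipnorm q).
Let ipEq := ipE ipq.

(** Continuity and differentiability on the closed half line, with one sided
    limits at 0. *)
Definition curve_continuous (V : R -> X) : Prop :=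
  forall t e, 0 <= t -> 0 < e -> exists2 d, 0 < d &
    forall s, 0 <= s -> `|s - t| < d -> N (V s - V t) <= e.

Definition curve_derivative (V dV : R -> X) : Prop :=
  forall t e, 0 <= t -> 0 < e -> exists2 d, 0 < d &
    forall s, 0 <= s -> `|s - t| < d ->
      N (V s - V t - (s - t) *: dV t) <= e * `|s - t|.

(** G is a primitive of V, expressed by a mean value inequality: no integral
    is involved. *)
Definition increments_bounded (V G : R -> X) : Prop :=
  forall s t z (M : R), 0 <= s -> s <= t ->
  (forall r, s <= r <= t -> N (V r - z) <= M) ->
  N (G t - G s - (t - s) *: z) <= (t - s) * M.

Definition Riemann_integral (V : R -> X) (a b : R) (I : X) : Prop :=
  forall e : R, 0 < e -> exists2 d : R, 0 < d &
    forall (n : nat) (x tag : nat -> R),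
      x 0%N = a -> x n = b ->
      (forall k, (k < n)%N ->
        [/\ x k <= tag k, tag k <= x k.+1 & x k.+1 - x k < d]) ->
      N (\sum_(k < n) (x k.+1 - x k) *: V (tag k) - I) < e.

Lemma curve_derivative_continuous V dV :
  curve_derivative V dV -> curve_continuous V.
Proof.
move=> h t e t0 e0; have [d d0 hd] := h t 1 t0 ltr01.
have N0 := ipnorm_ge0 q (dV t).
have c0 : 0 < 1 + N (dV t) by lra.
exists (Num.min d (e / (1 + N (dV t)))); first by rewrite lt_min d0 divr_gt0.
move=> s s0; rewrite lt_min ltr_pdivlMr // => /andP[/(hd _ s0) H1 H2].
have -> : V s - V t = V s - V t - (s - t) *: dV t + (s - t) *: dV t.
  by rewrite subrK.
rewrite (le_trans (ipnormD ipq _ _)) // (ipnormZ ipq).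
by move: H1; rewrite mul1r; lra.
Qed.

Lemma increments_derivative V G :
  curve_continuous V -> increments_bounded V G -> curve_derivative G V.
Proof.
move=> Vc VG t e t0 e0; have [d d0 hd] := Vc t e t0 e0; exists d => // s s0 std.
have [ts|/ltW st] := leP t s.
  rewrite ger0_norm ?subr_ge0 // mulrC; apply: VG => // r /andP[tr rs].
  apply: hd; first exact: le_trans tr.
  move: std; rewrite !ger0_norm ?subr_ge0 //; lra.
rewrite ler0_norm ?subr_le0 // opprB mulrC.
have -> : G s - G t - (s - t) *: V t = - (G t - G s - (t - s) *: V t).
  by apply: (ip_ext ipq) => w; rewrite !ipEq; ring.
rewrite (ipnormN ipq); apply: VG => // r /andP[sr rt].
apply: hd; first exact: le_trans sr.
by move: std; rewrite !ler0_norm ?subr_le0 //; lra.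
Qed.

(** The norm of a trajectory does not increase: going back by r from time t
    gives D (t - r) = D t - r A (D t) + o(r), and the norm of u - r A u is at
    least that of u. *)
Lemma dissipative_trajectory0 (A : X -> X -> Prop) D D' :
  dissipative_op q A -> curve_derivative D D' ->
  (forall t, 0 <= t -> A (D t) (D' t)) -> D 0 = 0 ->
  forall t, 0 <= t -> D t = 0.
Proof.
move=> oA hD AD D0 T T0; apply: (ipnorm0_eq0 ipq); apply/eqP.
rewrite eq_le ipnorm_ge0 andbT -(ipnorm0 ipq) -D0.
apply: (left_slope_nonincreasing (f := fun t => N (D t))) => // t e t0 e0.
  have [d d0 hd] := curve_derivative_continuous hD t0 e0.
  exists d => // s s0 /(hd _ s0) H.
  have := ipnorm_sub ipq (D s) (D t); have := ipnorm_sub ipq (D t) (D s).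
  by rewrite (ipnormB ipq (D t)) ler_norml; lra.
have [d d0 hd] := hD t e (ltW t0) e0; exists d => // r r0 rd rt.
have := hd (t - r); rewrite subr_ge0 addrAC subrr add0r normrN gtr0_norm //.
move=> /(_ rt rd); have := dissipative_norm ipq oA (ltW r0) (AD t (ltW t0)).
have -> : D (t - r) - D t - - r *: D' t = D (t - r) - (D t - r *: D' t).
  by apply: (ip_ext ipq) => w; rewrite !ipEq; ring.
move: (D t - r *: D' t) => w H1; rewrite (ipnormB ipq) => H2.
by have := ipnorm_sub ipq w (D (t - r)); lra.
Qed.

Lemma Riemann_sum_increment V n (x tag : nat -> R) z (M : R) :
  (forall k, (k < n)%N -> x k <= x k.+1) ->
  (forall k, (k < n)%N -> N (V (tag k) - z) <= M) ->
  N (\sum_(k < n) (x k.+1 - x k) *: V (tag k) - (x n - x 0%N) *: z) <=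
  (x n - x 0%N) * M.
Proof.
elim: n => [|n IH] mx hM.
  by rewrite big_ord0 subrr scale0r mul0r subrr (ipnorm0 ipq).
rewrite big_ord_recr /=; set S := \sum_(i < n) _.
have -> : S + (x n.+1 - x n) *: V (tag n) - (x n.+1 - x 0%N) *: z =
    S - (x n - x 0%N) *: z + (x n.+1 - x n) *: (V (tag n) - z).
  by move: S => S; apply: (ip_ext ipq) => w; rewrite !ipEq; ring.
have -> : (x n.+1 - x 0%N) * M = (x n - x 0%N) * M + (x n.+1 - x n) * M by ring.
rewrite (le_trans (ipnormD ipq _ _)) // lerD //.
  by apply: IH => k kn; [apply: mx|apply: hM]; rewrite ltnS ltnW.
by rewrite (ipnormZ ipq) ger0_norm ?subr_ge0 ?mx // ler_wpM2l ?subr_ge0 ?mx ?hM.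
Qed.

Lemma chain_mono n (x : nat -> R) :
  (forall k, (k < n)%N -> x k <= x k.+1) ->
  forall i j, (i <= j)%N -> (j <= n)%N -> x i <= x j.
Proof.
move=> mx i j /subnKC <-; elim: (j - i)%N => [|m IH] h; first by rewrite addn0.
rewrite addnS in h *; apply: le_trans (mx _ h).
exact: IH (ltnW h).
Qed.

Lemma increments_Riemann V G (b : R) : 0 <= b ->
  increments_bounded V G ->
  (forall e, 0 < e -> exists2 d, 0 < d & forall s t, 0 <= s -> 0 <= t ->
     `|s - t| <= d -> N (V s - V t) <= e) ->
  Riemann_integral V 0 b (G b - G 0).
Proof.
move=> b0 VG Vu e e0; have b1 : 0 < b + 1 by rewrite ltr_wpDl.
have [d d0 hd] := Vu _ (divr_gt0 e0 b1).
exists d => // n x tag x0 xn hx.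
have mx k : (k < n)%N -> x k <= x k.+1.
  by move=> /hx[h1 h2 _]; exact: le_trans h2.
have xk0 k : (k <= n)%N -> 0 <= x k.
  by move=> kn; rewrite -x0 (chain_mono mx).
suff H m : (m <= n)%N -> N (\sum_(k < m) (x k.+1 - x k) *: V (tag k) -
    (G (x m) - G (x 0%N))) <= (x m - x 0%N) * (e / (b + 1)).
  have := H n (leqnn n); rewrite xn x0 subr0 => /le_lt_trans; apply.
  by rewrite mulrCA gtr_pMr // ltr_pdivrMr // mul1r ltrDl.
elim: m => [|m IH] mn; first by rewrite big_ord0 !subrr mul0r (ipnorm0 ipq).
rewrite big_ord_recr /=; move: (IH (ltnW mn)); set S := \sum_(i < m) _ => HS.
have -> : S + (x m.+1 - x m) *: V (tag m) - (G (x m.+1) - G (x 0%N)) =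
    (S - (G (x m) - G (x 0%N))) -
    (G (x m.+1) - G (x m) - (x m.+1 - x m) *: V (tag m)).
  by move: S HS => S _; apply: (ip_ext ipq) => w; rewrite !ipEq; ring.
have -> : (x m.+1 - x 0%N) * (e / (b + 1)) =
  (x m - x 0%N) * (e / (b + 1)) + (x m.+1 - x m) * (e / (b + 1)) by ring.
rewrite (le_trans (ipnormDB ipq _ _)) // lerD //.
apply: VG; [exact: xk0 (ltnW mn)|exact: mx|move=> r /andP[mr rm]].
have [h1 h2 h3] := hx m mn; have xm := xk0 m (ltnW mn).
apply: hd; [exact: le_trans mr|exact: le_trans h1|].
by rewrite ler_norml; apply/andP; split; lra.
Qed.

Lemma Riemann_integralB V W a b I J :
  Riemann_integral V a b I -> Riemann_integral W a b J ->
  Riemann_integral (fun t => V t - W t) a b (I - J).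
Proof.
move=> hV hW e e0; have e2 : 0 < e / 2 by rewrite divr_gt0.
have [d d0 hd] := hV _ e2; have [d' d'0 hd'] := hW _ e2.
exists (Num.min d d') => [|n x tag x0 xn hx]; first by rewrite lt_min d0.
have := hd n x tag x0 xn; have := hd' n x tag x0 xn.
under [X in X - (I - J)]eq_bigr do rewrite scalerBr.
rewrite sumrB => H1 H2.
have -> : forall S T : X, S - T - (I - J) = (S - I) - (T - J).
  by move=> S T; apply: (ip_ext ipq) => w; rewrite !ipEq; ring.
rewrite (le_lt_trans (ipnormDB ipq _ _)) // (splitr e) ltrD //.
  by apply: H2 => k /hx[? ?]; rewrite lt_min => /andP[].
by apply: H1 => k /hx[? ?]; rewrite lt_min => /andP[].
Qed.

Lemma Riemann_integral_pt V a I : Riemann_integral V a a I -> I = 0.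
Proof.
move=> h; apply: (ipnorm_eps0 ipq) => e e0; have [d d0 hd] := h e e0.
have := hd 0%N (fun=> a) (fun=> a) erefl erefl.
by rewrite big_ord0 sub0r (ipnormN ipq) => H; apply/ltW/H.
Qed.

(** Refining [0, s] and [s, t] uniformly and separately compares the integrals
    over [0, s] and [0, t]. *)
Lemma Riemann_increments V (I : R -> X) :
  (forall t, 0 <= t -> Riemann_integral V 0 t (I t)) -> increments_bounded V I.
Proof.
move=> hI s t z M s0 st hM; have t0 := le_trans s0 st.
apply: ipnorm_le_eps => e e0; have e2 : 0 < e / 2 by rewrite divr_gt0.
have [d d0 hd] := hI s s0 _ e2; have [d' d'0 hd'] := hI t t0 _ e2.
(* A grid on [0, t] through s, with n steps on each side, of mesh below c. *)
pose c := Num.min d d'; have c0 : 0 < c by rewrite lt_min d0.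
pose n := (Num.trunc (t / c)).+1.
have nc : t / n%:R < c.
  by rewrite ltr_pdivrMr ?ltr0n // mulrC -ltr_pdivrMr // truncnS_gt.
have n0 : n%:R != 0 :> R by rewrite pnatr_eq0.
pose x k : R := if (k <= n)%N then s * (k%:R / n%:R)
  else s + (t - s) * ((k - n)%:R / n%:R).
have x1 k : (k < n)%N -> x k.+1 - x k = s / n%:R.
  by move=> kn; rewrite /x kn (ltnW kn) -natr1; field.
have x2E k : x (n + k)%N = s + (t - s) * (k%:R / n%:R).
  rewrite /x; case: k => [|k]; last by rewrite addnS ltnNge leq_addr /= -addnS addKn.
  by rewrite addn0 leqnn divff // mulr1 mul0r mulr0 addr0.
have x2 k : x (n + k).+1 - x (n + k)%N = (t - s) / n%:R.
  by rewrite -addnS !x2E -natr1; field.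
have x00 : x 0%N = 0 by rewrite /x leq0n mul0r mulr0.
have xn : x n = s by rewrite /x leqnn divff // mulr1.
have xnn : x (n + n)%N = t by rewrite x2E divff // mulr1 addrC subrK.
have nV : 0 < n%:R^-1 :> R by rewrite invr_gt0 ltr0n.
have xmono k : (k < n + n)%N ->
    [/\ x k <= x k, x k <= x k.+1 & x k.+1 - x k < c].
  move=> kn; have [kn'|kn'] := ltnP k n.
    have := x1 k kn'; have : s / n%:R <= t / n%:R by rewrite ler_pM2r.
    have : 0 <= s / n%:R by rewrite mulr_ge0 // ltW.
    by split; [exact: lexx|lra|lra].
  have := x2 (k - n)%N; rewrite subnKC //.
  have : (t - s) / n%:R <= t / n%:R by rewrite ler_pM2r // gerBl.
  have : 0 <= (t - s) / n%:R by rewrite mulr_ge0 ?subr_ge0 // ltW.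
  by split; [exact: lexx|lra|lra].
have H1 := hd n x x x00 xn; have H2 := hd' (n + n)%N x x x00 xnn.
have {}H1 : N (\sum_(k < n) (x k.+1 - x k) *: V (x k) - I s) < e / 2.
  apply: H1 => k kn; have [|a1 a2] := xmono k; first by rewrite ltn_addr.
  by rewrite lt_min => /andP[].
have {}H2 : N (\sum_(k < n + n) (x k.+1 - x k) *: V (x k) - I t) < e / 2.
  by apply: H2 => k /xmono[a1 a2]; rewrite lt_min => /andP[].
rewrite big_split_ord /= in H2.
have H3 := @Riemann_sum_increment V n (fun k => x (n + k)%N) (fun k => x (n + k)%N) z M.
rewrite addn0 xn xnn in H3.
have {}H3 : N (\sum_(k < n) (x (n + k).+1 - x (n + k)%N) *: V (x (n + k)%N) -
    (t - s) *: z) <= (t - s) * M.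
  under eq_bigr do rewrite -addnS; apply: H3 => k kn.
    by rewrite addnS; have [] := xmono (n + k)%N _; rewrite ?ltn_add2l.
  apply: hM; rewrite x2E.
  have kn1 : k%:R / n%:R <= 1 :> R.
    by rewrite ler_pdivrMr ?ltr0n // mul1r ler_nat ltnW.
  have kn0 : 0 <= k%:R / n%:R :> R by rewrite divr_ge0.
  by apply/andP; split; nra.
move: H1 H2 H3.
set S1 := \sum_(k < n) (x k.+1 - x k) *: _.
set S2 := \sum_(k < n) (x (n + k).+1 - _) *: _.
move: S1 S2 => S1 S2 H1 H2 H3.
have -> : I t - I s - (t - s) *: z =
    (S2 - (t - s) *: z) + ((S1 - I s) - (S1 + S2 - I t)).
  by apply: (ip_ext ipq) => w; rewrite !ipEq; ring.
rewrite (le_trans (ipnormD ipq _ _)) //.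
have := ipnormDB ipq (S1 - I s) (S1 + S2 - I t); lra.
Qed.

(** The integral I of D is a strong trajectory, as I' = D = A I, and it starts
    at 0. Hence I vanishes, and so does D = A I. *)
Lemma mild_trajectory0 (A : X -> X -> Prop) (D I : R -> X) :
  dissipative_op q A -> curve_continuous D ->
  (forall t, 0 <= t -> Riemann_integral D 0 t (I t)) ->
  (forall t, 0 <= t -> A (I t) (D t)) ->
  forall t, 0 <= t -> D t = 0.
Proof.
move=> oA Dc hI AI t t0.
have dI := increments_derivative Dc (Riemann_increments hI).
have I0 : I 0 = 0 by exact: Riemann_integral_pt (hI 0 (lexx 0)).
have It := dissipative_trajectory0 oA dI AI I0 t0.
by apply: (op_fun oA); rewrite -It; exact: AI.
Qed.

End Trajectories.

(** * Square integrable functions *)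

Section SquareIntegrable.
Context d (T : measurableType d) (R : realType)
  (mu : {measure set T -> \bar R}) (D : set T) (mD : measurable D).
Implicit Types f g : T -> R.

Definition sqint f : Prop :=
  measurable_fun D f /\ mu.-integrable D (EFin \o (fun x => f x ^+ 2)).

Lemma sqint_le f g : measurable_fun D f -> sqint g ->
  (forall x, D x -> `|f x| <= `|g x|) -> sqint f.
Proof.
move=> mf [mg ig] fg; split => //.
apply: le_integrable ig => //.
  by apply/measurable_EFinP; exact: measurable_funX.
by move=> x Dx; rewrite lee_fin !normrX ler_pXn2r ?nnegrE // fg.
Qed.

Lemma sqintM f g : sqint f -> sqint g ->
  mu.-integrable D (EFin \o (fun x => f x * g x)).
Proof.
move=> [mf fi] [mg gi]; have := integrableD mD fi gi.
apply: le_integrable => //.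
  by apply/measurable_EFinP; exact: measurable_funM.
move=> x Dx /=; rewrite lee_fin [leRHS]ger0_norm ?addr_ge0 ?sqr_ge0 // ler_norml.
by apply/andP; split; nra.
Qed.

Lemma sqintZ (a : R) f : sqint f -> sqint (fun x => a * f x).
Proof.
move=> [mf fi]; split; first exact: measurable_funM.
have -> : EFin \o (fun x => (a * f x) ^+ 2) =
    fun x => ((a ^+ 2)%:E * (f x ^+ 2)%:E)%E.
  by apply/funext => x /=; rewrite exprMn EFinM.
exact: integrableZl.
Qed.

Lemma sqintD f g : sqint f -> sqint g -> sqint (fun x => f x + g x).
Proof.
move=> hf hg; have [mf fi] := hf; have [mg gi] := hg.
split; first exact: measurable_funD.
have [_ f2] := sqintZ 2 hf; have [_ g2] := sqintZ 2 hg.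
have := integrableD mD f2 g2.
apply: le_integrable => //.
  by apply/measurable_EFinP; apply: measurable_funX; exact: measurable_funD.
move=> x Dx /=; rewrite lee_fin !ger0_norm ?addr_ge0 ?sqr_ge0 //.
by have := sqr_ge0 (f x - g x); have := sqr_ge0 (f x + g x); nra.
Qed.

Lemma sqintN f : sqint f -> sqint (fun x => - f x).
Proof.
by move=> /(sqintZ (-1)); under eq_fun do rewrite mulN1r.
Qed.

Lemma sqintB f g : sqint f -> sqint g -> sqint (fun x => f x - g x).
Proof. by move=> hf hg; exact: sqintD hf (sqintN hg). Qed.

Lemma sqint0 : sqint (fun=> 0).
Proof.
split; first exact: measurable_cst.
have -> : EFin \o (fun=> 0 ^+ 2) = cst 0%E :> (T -> \bar R).
  by apply/funext => x /=; rewrite expr0n.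
exact: integrable0.
Qed.

Lemma sqint_Lfun f : f \_ D \in Lfun mu 2%:E <-> sqint f.
Proof.
have rE : (fun x => (f \_ D) x ^+ 2) = (fun x => f x ^+ 2) \_ D.
  by apply/funext => x; rewrite !patchE; case: ifP => //; rewrite expr0n.
split=> [h|[mf fi]].
  split.
    apply/(measurable_restrictT _ mD).
    by move: h; rewrite inE => /andP[/[!inE]].
  have := Lfun2_integrable_sqr h; rewrite rE => hi.
  by apply/(integrable_mkcond _ mD); rewrite -restrict_EFin in hi.
have mfD : measurable_fun setT (f \_ D) by apply/(measurable_restrictT _ mD).
rewrite inE; apply/andP; split; first by rewrite inE.
rewrite inE /= /finite_norm unlock /=.
apply: poweR_lty.
have /(integrable_mkcond _ mD) := fi; rewrite restrict_EFin -rE.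
move=> /integrableP[_]; apply: le_lt_trans.
rewrite le_eqVlt; apply/orP; left; apply/eqP; apply: eq_integral => x _ /=.
by rewrite powR_mulrn // normrX.
Qed.

Lemma Rintegral_sqr_ge0 f : 0 <= \int[mu]_(x in D) (f x ^+ 2).
Proof. by apply: Rintegral_ge0 => x _; exact: sqr_ge0. Qed.

Lemma EFin_Rintegral f : mu.-integrable D (EFin \o f) ->
  (\int[mu]_(x in D) f x)%:E = (\int[mu]_(x in D) (f x)%:E)%E.
Proof. by move=> fi; rewrite fineK //; exact: integrable_fin_num. Qed.

Lemma sqint_null f : sqint f -> \int[mu]_(x in D) (f x ^+ 2) = 0 ->
  f = (fun=> 0) %[ae mu in D].
Proof.
move=> [mf fi] f0; have f0E := EFin_Rintegral fi; rewrite f0 in f0E.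
have m2 : measurable_fun D (EFin \o (fun x => f x ^+ 2)) by exact: measurable_int fi.
have [+ _] := ae_eq_integral_abs mu mD m2.
have -> : (\int[mu]_(x in D) `|(EFin \o (fun x => f x ^+ 2)%R) x| = 0)%E.
  apply: etrans (esym f0E); apply: eq_integral => x _ /=.
  by rewrite ger0_norm ?sqr_ge0.
move=> /(_ erefl); apply: filterS => x + Dx => /(_ Dx) /= [].
by move=> /eqP; rewrite sqrf_eq0 => /eqP.
Qed.

(** If the integrals of (v_(n+1) - v_n)^2 are at most 8^-n then
    sum 4^n (v_(n+1) - v_n)^2 is integrable, hence finite almost everywhere,
    so that v_n converges geometrically there. *)
Lemma rapid_ae_cvg (v : nat -> T -> R) :
  (forall n, sqint (v n)) ->
  (forall n, \int[mu]_(x in D) ((v n.+1 x - v n x) ^+ 2) <= 8^-1 ^+ n) ->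
  {ae mu, forall x, D x -> cvgn (v ^~ x)}.
Proof.
move=> vi vs.
pose g n x := (4 ^+ n * (v n.+1 x - v n x) ^+ 2)%:E.
have gi n : mu.-integrable D (g n).
  rewrite /g; under eq_fun do rewrite EFinM.
  by apply: integrableZl => //; have [] := sqintB (vi n.+1) (vi n).
have g0 n x : D x -> (0 <= g n x)%E.
  by move=> _; rewrite /g lee_fin mulr_ge0 ?sqr_ge0 ?exprn_ge0.
have mg n : measurable_fun D (g n) by exact: measurable_int (gi n).
have Ig : (\int[mu]_(x in D) (\sum_(n <oo) g n x) < +oo)%E.
  rewrite integral_nneseries //.
  apply: (@le_lt_trans _ _ (\sum_(n <oo) (2^-1 ^+ n)%:E)%E).
    apply: lee_nneseries => [n _ _|n _]; first by apply: integral_ge0 => x Dx; exact: g0.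
    have [_ i2] := sqintB (vi n.+1) (vi n).
    have -> : (\int[mu]_(x in D) g n x =
        (4 ^+ n * \int[mu]_(x in D) ((v n.+1 x - v n x) ^+ 2))%:E)%E.
      rewrite EFinM EFin_Rintegral // -integralZl //.
    rewrite lee_fin (le_trans (ler_wpM2l _ (vs n))) ?exprn_ge0 //.
    have -> : 2^-1 = 4 * 8^-1 :> R by lra.
    by rewrite exprMn.
  apply: (@le_lt_trans _ _ 2%:E%E); last exact: ltry.
  apply: lime_le; first by apply: is_cvg_nneseries => n _ _; rewrite lee_fin exprn_ge0 ?invr_ge0.
  apply: nearW => n; rewrite sumEFin lee_fin.
  have hE : (1 - 2^-1)^-1 = 2 :> R.
    have -> : 1 - 2^-1 = 2^-1 :> R by lra.
    by rewrite invrK.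
  have := @geometric_le_lim R n 1 2^-1 ler01.
  rewrite ger0_norm ?invr_ge0 // hE mul1r /series /= => H.
  under eq_bigr do rewrite -[_ ^+ _]mul1r.
  by apply: H; rewrite ?invr_gt0 ?invf_lt1 ?ltr1n.
have mG : measurable_fun D (fun x => (\sum_(n <oo) g n x)%E).
  by apply: ge0_emeasurable_sum => [k x Dx _|k _]; [exact: g0|exact: mg].
have iG : mu.-integrable D (fun x => (\sum_(n <oo) g n x)%E).
  apply/integrableP; split => //. apply: le_lt_trans Ig.
  rewrite le_eqVlt; apply/orP; left; apply/eqP; apply: eq_integral => x.
  rewrite inE => Dx; rewrite gee0_abs //; apply: nneseries_ge0 => n _ _; exact: g0.
apply: filterS (integrable_ae mD iG) => x + Dx => /(_ Dx) /fineK.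
set M := fine _ => ME.
have gM n : 4 ^+ n * (v n.+1 x - v n x) ^+ 2 <= M.
  rewrite -lee_fin ME -/(g n x).
  apply: le_trans (nneseries_lim_ge n.+1 _) => [|k _ _]; last exact: g0.
  rewrite big_nat_recr //= leeDr // big_nat sume_ge0 // => k _; exact: g0.
have M0 : 0 <= M by apply: le_trans (gM 0%N); rewrite mul1r sqr_ge0.
have dM n : `|v n.+1 x - v n x| <= geometric (M + 1) 2^-1 n.
  rewrite /= -(@ler_pXn2r _ 2) ?nnegrE ?mulr_ge0 ?exprn_ge0 ?addr_ge0 ?invr_ge0 //.
  rewrite real_normK ?num_real // exprMn -exprAC.
  have -> : 2^-1 ^+ 2 = 4^-1 :> R by rewrite expr2; lra.
  rewrite exprVn ler_pdivlMr ?exprn_gt0 // mulrC (le_trans (gM n)) //.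
  nra.
have : cvgn (series (fun n => v n.+1 x - v n x)).
  apply: normed_cvg; apply: (@series_le_cvg _ _ (geometric (M + 1) 2^-1)).
  - by move=> n; exact: normr_ge0.
  - by move=> n; apply: geometric_ge0; rewrite ?addr_ge0 ?invr_ge0.
  - exact: dM.
  - by apply: is_cvg_geometric_series; rewrite ger0_norm ?invr_ge0 // invf_lt1 // ltr1n.
move=> /cvg_ex[l hl]; apply/cvg_ex; exists (l + v 0%N x).
have -> : v ^~ x = (fun n => series (fun n => v n.+1 x - v n x) n + v 0%N x).
  apply/funext => n; rewrite /series /= telescope_sumr // subrK //.
by apply: cvgD => //; exact: cvg_cst.
Qed.

(** The Riesz-Fischer theorem: a rapidly converging subsequence converges
    almost everywhere, and Fatou's lemma turns this into convergence in mean. *)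
Lemma sqint_complete (u : nat -> T -> R) :
  (forall n, sqint (u n)) ->
  (forall e : R, 0 < e -> exists n0, forall m n, (n0 <= m)%N -> (n0 <= n)%N ->
     \int[mu]_(x in D) ((u m x - u n x) ^+ 2) <= e) ->
  exists2 l, sqint l & forall e : R, 0 < e -> exists n0, forall n, (n0 <= n)%N ->
    \int[mu]_(x in D) ((u n x - l x) ^+ 2) <= e.
Proof.
move=> ui uc.
have /choice[k hk] : forall n, exists k, forall m m', (k <= m)%N -> (k <= m')%N ->
    \int[mu]_(x in D) ((u m x - u m' x) ^+ 2) <= 8^-1 ^+ n.
  by move=> n; apply: uc; rewrite exprn_gt0 // invr_gt0.
pose K n := (\sum_(i < n.+1) (k i).+1)%N.
have Kk j : (k j <= K j)%N.
  by rewrite /K big_ord_recr /= (leq_trans (leqnSn _)) // leq_addl.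
have KS j : (K j <= K j.+1)%N by rewrite {2}/K big_ord_recr /= leq_addr.
have Kn j : (j <= K j)%N.
  elim: j => // j IH; rewrite /K big_ord_recr /= -/(K j) addnS ltnS.
  exact: leq_trans IH (leq_addr _ _).
pose v n := u (K n).
have vi n : sqint (v n) by exact: ui.
have vae : {ae mu, forall x, D x -> cvgn (v ^~ x)}.
  by apply: rapid_ae_cvg => // n; apply: hk; [exact: leq_trans (Kk n) (KS n)|exact: Kk].
(* A limit superior is measurable, and it is the limit where there is one. *)
pose l x := fine (limn_esup (fun n => (v n x)%:E)).
have ml : measurable_fun D l.
  apply: (measurableT_comp (fine_measurable measurableT)).
  apply: measurable_fun_limn_esup => n; apply/measurable_EFinP.
  by have [] := vi n.
have vl : {ae mu, forall x, D x -> v n x @[n --> \oo] --> l x}.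
  apply: filterS vae => x + Dx => /(_ Dx) /cvg_ex[L vL].
  have [_ LE] : (limn_einf (fun n => (v n x)%:E) = L%:E) *
      (limn_esup (fun n => (v n x)%:E) = L%:E).
    by apply: cvg_limn_einf_sup; apply: cvg_EFin => //; exact: nearW.
  by rewrite /l LE.
have key m e : (forall n, (m <= n)%N -> \int[mu]_(x in D) ((u m x - u n x) ^+ 2) <= e) ->
    (\int[mu]_(x in D) ((u m x - l x) ^+ 2)%:E <= e%:E)%E.
  move=> hm; pose F n x := ((u m x - v n x) ^+ 2)%:E.
  have iF n : mu.-integrable D (F n) by have [] := sqintB (ui m) (vi n).
  have mF n : measurable_fun D (F n) by exact: measurable_int (iF n).
  have F0 n x : D x -> (0 <= F n x)%E by move=> _; rewrite lee_fin sqr_ge0.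
  have -> : (\int[mu]_(x in D) ((u m x - l x) ^+ 2)%:E =
      \int[mu]_(x in D) limn_einf (F ^~ x))%E.
    apply: ge0_ae_eq_integral => //.
    - apply/measurable_EFinP/measurable_funX/measurable_funB => //.
      by have [] := ui m.
    - apply: measurableT_comp => //; apply: measurable_fun_limn_esup => n.
      exact: measurableT_comp.
    - by move=> x _; rewrite lee_fin sqr_ge0.
    - move=> x Dx; rewrite limn_einf_lim; apply: lime_ge; first exact: is_cvg_einfs.
      by apply: nearW => n; apply: le_ereal_inf_tmp => _ [i _ <-]; exact: F0.
    apply: filterS vl => x + Dx => /(_ Dx) vx.
    suff [-> _] : (limn_einf (F ^~ x) = ((u m x - l x) ^+ 2)%:E) *
      (limn_esup (F ^~ x) = ((u m x - l x) ^+ 2)%:E) by [].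
    apply: cvg_limn_einf_sup; apply: cvg_EFin; first exact: nearW.
    have h : u m x - v n x @[n --> \oo] --> u m x - l x.
      by apply: cvgB => //; exact: cvg_cst.
    by rewrite expr2; exact: (cvgM h h).
  apply: le_trans (fatou mu mD mF F0) _.
  rewrite limn_einf_lim; apply: lime_le; first exact: is_cvg_einfs.
  exists m => // n /= mn; apply: (@le_trans _ _ (\int[mu]_(x in D) F n x)%E).
    by apply: ereal_inf_lbound; exists n => /=.
  have [_ i2] := sqintB (ui m) (vi n).
  by rewrite -EFin_Rintegral // lee_fin hm // (leq_trans mn).
have ul m e : (forall n, (m <= n)%N -> \int[mu]_(x in D) ((u m x - u n x) ^+ 2) <= e) ->
    sqint (fun x => u m x - l x).
  move=> /key; have mul : measurable_fun D (fun x => u m x - l x).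
    by apply: measurable_funB => //; have [] := ui m.
  move=> H; split => //; apply/integrableP; split.
    by apply/measurable_EFinP; exact: measurable_funX.
  apply: le_lt_trans (ltry e); apply: le_trans H.
  rewrite le_eqVlt; apply/orP; left; apply/eqP; apply: eq_integral => x _ /=.
  by rewrite ger0_norm ?sqr_ge0.
exists l.
  have [n0 hn0] := uc 1 ltr01.
  have hl := ul n0 1 (fun n => hn0 n0 n (leqnn n0)).
  have := sqintB (ui n0) hl; congr sqint; apply/funext => x.
  by rewrite opprB addrC subrK.
move=> e e0; have [n0 hn0] := uc e e0; exists n0 => n nn0.
have H j : (n <= j)%N -> \int[mu]_(x in D) ((u n x - u j x) ^+ 2) <= e.
  by move=> nj; apply: hn0 => //; exact: leq_trans nj.
have [_ i2] := ul n e H.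
by rewrite -lee_fin EFin_Rintegral //; exact: key.
Qed.

End SquareIntegrable.


(** * The energy space as a real Hilbert space *)

Section ComplexParts.
Context {R : realType}.
Implicit Types z w : R[i].

Lemma Re_add z w : Re (z + w) = Re z + Re w. Proof. by case: z; case: w. Qed.
Lemma Im_add z w : Im (z + w) = Im z + Im w. Proof. by case: z; case: w. Qed.
Lemma Re_opp z : Re (- z) = - Re z. Proof. by case: z. Qed.
Lemma Im_opp z : Im (- z) = - Im z. Proof. by case: z. Qed.
Lemma Re_mul z w : Re (z * w) = Re z * Re w - Im z * Im w.
Proof. by case: z; case: w. Qed.
Lemma Im_mul z w : Im (z * w) = Re z * Im w + Im z * Re w.
Proof. by case: z => a b; case: w => c d /=; rewrite addrC. Qed.
Lemma Re_real (a : R) : Re (a%:C)%C = a. Proof. by []. Qed.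
Lemma Im_real (a : R) : Im (a%:C)%C = 0. Proof. by []. Qed.
Lemma Re_unit : Re ('i%C : R[i]) = 0. Proof. by []. Qed.
Lemma Im_unit : Im ('i%C : R[i]) = 1. Proof. by []. Qed.
Lemma Re_zero : Re (0 : R[i]) = 0. Proof. by []. Qed.
Lemma Im_zero : Im (0 : R[i]) = 0. Proof. by []. Qed.
Lemma Re_scale (a : R) z : Re (a%:C%C * z) = a * Re z.
Proof. by rewrite Re_mul Re_real Im_real mul0r subr0. Qed.
Lemma Im_scale (a : R) z : Im (a%:C%C * z) = a * Im z.
Proof. by rewrite Im_mul Re_real Im_real mul0r addr0. Qed.
Lemma Re_conjM z w : Re (z * (w^*)%C) = Re z * Re w + Im z * Im w.
Proof. by case: z => a b; case: w => c d /=; rewrite mulrN opprK. Qed.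
Lemma complex_ext z w : Re z = Re w -> Im z = Im w -> z = w.
Proof. by case: z => a b; case: w => c d /= -> ->. Qed.

End ComplexParts.

Lemma ae_imply (R : realType) (P Q : R -> Prop) :
  (forall x, P x -> Q x) -> {ae @lebesgue_measure R, forall x, P x} ->
  {ae @lebesgue_measure R, forall x, Q x}.
Proof.
by move=> PQ; apply: filterS; first exact: (ae_filter_ringOfSetsType lebesgue_measure).
Qed.

Lemma ae_imply2 (R : realType) (P Q S : R -> Prop) :
  (forall x, P x -> Q x -> S x) ->
  {ae @lebesgue_measure R, forall x, P x} ->
  {ae @lebesgue_measure R, forall x, Q x} ->
  {ae @lebesgue_measure R, forall x, S x}.
Proof.
by move=> PQ; apply: filterS2; first exact: (ae_filter_ringOfSetsType lebesgue_measure).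
Qed.

Section StateSpace.
Context {R : realType}.
Local Notation leb := (@lebesgue_measure R).
Local Notation sqint := (sqint leb).
Local Notation I01 := (@I01 R).
Implicit Types (D : set R) (U W : state R).

Lemma measurable_I01 : measurable (I01 : set (measurableTypeR R)).
Proof. exact: measurable_itv. Qed.
#[local] Hint Resolve measurable_I01 : core.

Lemma L2_sqint D (f : R -> R[i]) : measurable (D : set (measurableTypeR R)) ->
  L2 D f <-> sqint D (fun x => Re (f x)) /\ sqint D (fun x => Im (f x)).
Proof. by move=> mD; rewrite /L2; split=> -[/(sqint_Lfun leb mD)? /(sqint_Lfun leb mD)?]. Qed.

Lemma L2D D (f g : R -> R[i]) : measurable (D : set (measurableTypeR R)) ->
  L2 D f -> L2 D g -> L2 D (fun x => f x + g x).
Proof.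
move=> mD /(L2_sqint _ mD)[f1 f2] /(L2_sqint _ mD)[g1 g2]; apply/L2_sqint => //.
split; [under eq_fun do rewrite Re_add|under eq_fun do rewrite Im_add]; exact: sqintD.
Qed.

Lemma L2Z D (a : R[i]) (f : R -> R[i]) : measurable (D : set (measurableTypeR R)) ->
  L2 D f -> L2 D (fun x => a * f x).
Proof.
move=> mD /(L2_sqint _ mD)[f1 f2]; apply/L2_sqint => //.
split.
  by under eq_fun do rewrite Re_mul; apply: sqintB => //; exact: sqintZ.
by under eq_fun do rewrite Im_mul; apply: sqintD => //; exact: sqintZ.
Qed.

Lemma L2_0 D : measurable (D : set (measurableTypeR R)) -> L2 D (fun=> 0 : R[i]).
Proof. by move=> mD; apply/L2_sqint => //; split; exact: sqint0. Qed.

Lemma inHD U W : inH U -> inH W -> inH (U + W).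
Proof. by move=> [? ?] [? ?]; split; apply: L2D. Qed.

Lemma inHZ (a : R[i]) U : inH U -> inH (a *: U).
Proof. by move=> [? ?]; split; apply: L2Z. Qed.

Lemma inHN U : inH U -> inH (- U).
Proof. by move=> /(inHZ (-1)); rewrite scaleN1r. Qed.

Lemma inHB U W : inH U -> inH W -> inH (U - W).
Proof. by move=> h /inHN; exact: inHD. Qed.

Lemma inH0 : inH (0 : state R).
Proof. by split; exact: L2_0. Qed.

Lemma eqH_refl U : eqH U U.
Proof. by split; apply: aeW. Qed.

Lemma eqH_sym U W : eqH U W -> eqH W U.
Proof. by move=> [h1 h2]; split; [move: h1|move: h2]; apply: ae_imply => x h /h. Qed.

Lemma eqH_trans U W Z : eqH U W -> eqH W Z -> eqH U Z.
Proof.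
move=> [h1 h2] [k1 k2]; split; [move: h1 k1|move: h2 k2]; apply: ae_imply2 => x h k Dx.
  by rewrite h ?k.
by rewrite h ?k.
Qed.

Lemma eqHD U W U' W' : eqH U U' -> eqH W W' -> eqH (U + W) (U' + W').
Proof.
move=> [h1 h2] [k1 k2]; split; [move: h1 k1|move: h2 k2]; apply: ae_imply2 => x h k Dx /=.
  by congr (_ + _); [exact: h|exact: k].
by congr (_ + _); [exact: h|exact: k].
Qed.

Lemma eqHZ (a : R[i]) U U' : eqH U U' -> eqH (a *: U) (a *: U').
Proof.
move=> [h1 h2]; split; [move: h1|move: h2]; apply: ae_imply => x h Dx /=.
  by congr (_ * _); exact: h.
by congr (_ * _); exact: h.
Qed.

Lemma eqHN U U' : eqH U U' -> eqH (- U) (- U').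
Proof. by move=> /(eqHZ (-1)); rewrite !scaleN1r. Qed.

Definition state_repr U : state R := xget 0 [set W | inH W /\ eqH U W].

Lemma state_repr_eq U W : eqH U W -> state_repr U = state_repr W.
Proof.
move=> UW; congr (xget _ _); apply/seteqP; split=> Z [Zi e]; split => //.
  exact: eqH_trans (eqH_sym UW) e.
exact: eqH_trans UW e.
Qed.

Lemma state_reprP U : inH U -> inH (state_repr U) /\ eqH U (state_repr U).
Proof.
by move=> h; apply: (xgetPex 0 (P := [set W | inH W /\ eqH U W])); exists U; split => //; exact: eqH_refl.
Qed.

(** One chosen representative for each class of states, so that equality of
    elements is equality almost everywhere. *)
Record energy_space : Type := EnergyElt {
  elt_state :> state R;
  _ : `[< inH elt_state /\ state_repr elt_state = elt_state >] }.

Lemma elt_inH (x : energy_space) : inH x.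
Proof. by case: x => U /= /asboolP[]. Qed.

Lemma elt_repr (x : energy_space) : state_repr x = x :> state R.
Proof. by case: x => U /= /asboolP[]. Qed.

Lemma elt_eq (x y : energy_space) : eqH x y -> x = y.
Proof.
move=> /state_repr_eq; rewrite !elt_repr; case: x => U hU; case: y => W hW /= UW.
by rewrite -{}UW in hW *; congr EnergyElt; exact: bool_irrelevance.
Qed.

Lemma class_ex U : exists x : energy_space, inH U -> eqH x U.
Proof.
have [h|h] := pselect (inH U).
  have [h1 h2] := state_reprP h.
  have p : `[< inH (state_repr U) /\ state_repr (state_repr U) = state_repr U >].
    by apply/asboolP; split => //; apply: state_repr_eq; exact: eqH_sym.
  by exists (EnergyElt p) => _; exact: eqH_sym.
have [h1 h2] := state_reprP inH0.
have p : `[< inH (state_repr 0) /\ state_repr (state_repr 0) = state_repr 0 >].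
  by apply/asboolP; split => //; apply: state_repr_eq; exact: eqH_sym.
by exists (EnergyElt p).
Qed.

Definition class U : energy_space := sval (cid (class_ex U)).

Lemma classP U : inH U -> eqH (class U) U.
Proof. exact: (svalP (cid (class_ex U))). Qed.

Lemma class_eq U W : inH U -> inH W -> eqH U W -> class U = class W.
Proof.
move=> hU hW e; apply: elt_eq; apply: eqH_trans (classP hU) _.
exact: eqH_trans e (eqH_sym (classP hW)).
Qed.

Lemma class_elt (x : energy_space) : class x = x.
Proof. by apply: elt_eq; apply: classP; exact: elt_inH. Qed.

End StateSpace.
Arguments energy_space R : clear implicits.

HB.instance Definition _ (R : realType) := gen_eqMixin (energy_space R).
HB.instance Definition _ (R : realType) := gen_choiceMixin (energy_space R).

Section EnergySpaceModule.
Context {R : realType}.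
Local Notation X := (energy_space R).
Implicit Types x y z : X.

Definition elt_zero : X := class 0.
Definition elt_add x y : X := class (elt_state x + elt_state y).
Definition elt_opp x : X := class (- elt_state x).
Definition elt_scale (a : R) x : X := class ((a%:C)%C *: elt_state x).

Lemma elt_addE x y : eqH (elt_add x y) (elt_state x + elt_state y).
Proof. by apply: classP; apply: inHD; exact: elt_inH. Qed.
Lemma elt_oppE x : eqH (elt_opp x) (- elt_state x).
Proof. by apply: classP; apply: inHN; exact: elt_inH. Qed.
Lemma elt_zeroE : eqH elt_zero 0.
Proof. by apply: classP; exact: inH0. Qed.
Lemma elt_scaleE a x : eqH (elt_scale a x) ((a%:C)%C *: elt_state x).
Proof. by apply: classP; apply: inHZ; exact: elt_inH. Qed.

Lemma elt_addA : associative elt_add.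
Proof.
move=> x y z; apply: elt_eq; apply: eqH_trans (elt_addE _ _) _.
apply: eqH_trans (eqHD (eqH_refl _) (elt_addE _ _)) _; rewrite addrA.
apply: eqH_sym; apply: eqH_trans (elt_addE _ _) _.
exact: eqHD (elt_addE _ _) (eqH_refl _).
Qed.

Lemma elt_addC : commutative elt_add.
Proof. by move=> x y; rewrite /elt_add addrC. Qed.

Lemma elt_add0 : left_id elt_zero elt_add.
Proof.
move=> x; apply: elt_eq; apply: eqH_trans (elt_addE _ _) _.
rewrite -[X in eqH _ X]add0r; exact: eqHD elt_zeroE (eqH_refl _).
Qed.

Lemma elt_addN : left_inverse elt_zero elt_opp elt_add.
Proof.
move=> x; apply: elt_eq; apply: eqH_trans (elt_addE _ _) _.
apply: eqH_trans (eqHD (elt_oppE _) (eqH_refl _)) _; rewrite addNr.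
exact: eqH_sym elt_zeroE.
Qed.

HB.instance Definition _ := GRing.isZmodule.Build X
  elt_addA elt_addC elt_add0 elt_addN.

Lemma elt_scaleA a b x : elt_scale a (elt_scale b x) = elt_scale (a * b) x.
Proof.
apply: elt_eq; apply: eqH_trans (elt_scaleE _ _) _.
apply: eqH_trans (eqHZ _ (elt_scaleE _ _)) _; rewrite scalerA -rmorphM.
exact: eqH_sym (elt_scaleE _ _).
Qed.

Lemma elt_scale1 : left_id 1 elt_scale.
Proof. by move=> x; rewrite /elt_scale rmorph1 scale1r class_elt. Qed.

Lemma elt_scaleDr : right_distributive elt_scale +%R.
Proof.
move=> a x y; apply: elt_eq; apply: eqH_trans (elt_scaleE _ _) _.
apply: eqH_trans (eqHZ _ (elt_addE _ _)) _; rewrite scalerDr.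
apply: eqH_sym; apply: eqH_trans (elt_addE _ _) _.
exact: eqHD (elt_scaleE _ _) (elt_scaleE _ _).
Qed.

Lemma elt_scaleDl x : {morph elt_scale^~ x : a b / a + b}.
Proof.
move=> a b; apply: elt_eq; apply: eqH_trans (elt_scaleE _ _) _.
rewrite rmorphD scalerDl.
apply: eqH_sym; apply: eqH_trans (elt_addE _ _) _.
exact: eqHD (elt_scaleE _ _) (elt_scaleE _ _).
Qed.

HB.instance Definition _ := GRing.Zmodule_isLmodule.Build R X
  elt_scaleA elt_scale1 elt_scaleDr elt_scaleDl.

Lemma elt_stateD x y : eqH (x + y : X) (elt_state x + elt_state y).
Proof. exact: elt_addE. Qed.
Lemma elt_stateN x : eqH (- x : X) (- elt_state x).
Proof. exact: elt_oppE. Qed.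
Lemma elt_stateB x y : eqH (x - y : X) (elt_state x - elt_state y).
Proof. exact: eqH_trans (elt_stateD _ _) (eqHD (eqH_refl _) (elt_stateN _)). Qed.
Lemma elt_state0 : eqH (0 : X) 0.
Proof. exact: elt_zeroE. Qed.
Lemma elt_stateZ a x : eqH (a *: x : X) ((a%:C)%C *: elt_state x).
Proof. exact: elt_scaleE. Qed.

Lemma classD (U W : state R) : inH U -> inH W -> class (U + W) = class U + class W.
Proof.
move=> hU hW; apply: elt_eq; apply: eqH_trans (classP (inHD hU hW)) _.
by apply: eqH_sym; apply: eqH_trans (elt_stateD _ _) _; apply: eqHD; exact: classP.
Qed.

Lemma classZ (a : R) (U : state R) :
  inH U -> class ((a%:C)%C *: U) = a *: class U.
Proof.
move=> hU; apply: elt_eq; apply: eqH_trans (classP (inHZ _ hU)) _.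
by apply: eqH_sym; apply: eqH_trans (elt_stateZ _ _) _; apply: eqHZ; exact: classP.
Qed.

Lemma classB (U W : state R) : inH U -> inH W -> class (U - W) = class U - class W.
Proof.
move=> hU hW; rewrite classD //; last exact: inHN.
congr (_ + _); apply: elt_eq; apply: eqH_trans (classP (inHN hW)) _.
by apply: eqH_sym; apply: eqH_trans (elt_stateN _) _; apply: eqHN; exact: classP.
Qed.

End EnergySpaceModule.

Section ComplexDot.
Context {R : realType} (D : set R) (mD : measurable (D : set (measurableTypeR R))).
Local Notation leb := (@lebesgue_measure R).
Implicit Types f g : R -> R[i].

(** The real part of the Hermitian product of L^2(D). *)
Definition rdot f g : R :=
  \int[leb]_(x in D) (Re (f x) * Re (g x) + Im (f x) * Im (g x)).

Lemma rdot_integrable f g : L2 D f -> L2 D g -> leb.-integrable D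
  (EFin \o (fun x => Re (f x) * Re (g x) + Im (f x) * Im (g x))).
Proof.
move=> /(L2_sqint _ mD)[f1 f2] /(L2_sqint _ mD)[g1 g2].
exact: integrableD (sqintM mD f1 g1) (sqintM mD f2 g2).
Qed.

Lemma rdotE f g : L2 D f -> L2 D g ->
  rdot f g = \int[leb]_(x in D) (Re (f x) * Re (g x)) +
             \int[leb]_(x in D) (Im (f x) * Im (g x)).
Proof.
move=> /(L2_sqint _ mD)[f1 f2] /(L2_sqint _ mD)[g1 g2].
by rewrite /rdot RintegralD //; exact: sqintM.
Qed.

Lemma rdotC f g : rdot f g = rdot g f.
Proof.
by apply: eq_Rintegral => x _; rewrite (mulrC (Re _)) (mulrC (Im _)).
Qed.

Lemma rdotDl f g k : L2 D f -> L2 D g -> L2 D k ->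
  rdot (fun x => f x + g x) k = rdot f k + rdot g k.
Proof.
move=> hf hg hk; rewrite /rdot -RintegralD //; [|exact: rdot_integrable..].
by apply: eq_Rintegral => x _; rewrite Re_add Im_add; ring.
Qed.

Lemma rdotZl (a : R) f k : L2 D f -> L2 D k ->
  rdot (fun x => (a%:C)%C * f x) k = a * rdot f k.
Proof.
move=> hf hk; rewrite /rdot -RintegralZl //; last exact: rdot_integrable.
by apply: eq_Rintegral => x _; rewrite Re_scale Im_scale; ring.
Qed.

Lemma rdot_ge0 f : 0 <= rdot f f.
Proof. by apply: Rintegral_ge0 => x _; rewrite -!expr2 addr_ge0 ?sqr_ge0. Qed.

Lemma rdot_sqr f : L2 D f -> rdot f f =
  \int[leb]_(x in D) (Re (f x) ^+ 2) + \int[leb]_(x in D) (Im (f x) ^+ 2).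
Proof.
by move=> hf; rewrite rdotE //; congr (_ + _); apply: eq_Rintegral.
Qed.

Lemma rdot_null f : L2 D f -> rdot f f = 0 -> f = (fun=> 0) %[ae leb in D].
Proof.
move=> hf; rewrite rdot_sqr //; have [f1 f2] := (L2_sqint _ mD).1 hf.
have p1 := Rintegral_sqr_ge0 leb D (fun x => Re (f x)).
have p2 := Rintegral_sqr_ge0 leb D (fun x => Im (f x)).
move=> /eqP; rewrite paddr_eq0 // => /andP[/eqP z1 /eqP z2].
apply: ae_imply2 (sqint_null mD f1 z1) (sqint_null mD f2 z2) => x a b Dx.
by apply: complex_ext; [exact: a|exact: b].
Qed.

Lemma rdot_ae f f' g : L2 D f -> L2 D f' -> L2 D g ->
  f = f' %[ae leb in D] -> rdot f g = rdot f' g.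
Proof.
move=> hf hf' hg e; rewrite /rdot /Rintegral; congr fine.
apply: ae_eq_integral => //.
- exact: measurable_int (rdot_integrable hf hg).
- exact: measurable_int (rdot_integrable hf' hg).
by apply: ae_imply e => x h Dx /=; rewrite h.
Qed.

Lemma L2_complete (f : nat -> R -> R[i]) :
  (forall n, L2 D (f n)) ->
  (forall e : R, 0 < e -> exists n0, forall m n, (n0 <= m)%N -> (n0 <= n)%N ->
     rdot (fun x => f m x - f n x) (fun x => f m x - f n x) <= e) ->
  exists2 l, L2 D l & forall e : R, 0 < e ->
    exists n0, forall n, (n0 <= n)%N ->
      rdot (fun x => f n x - l x) (fun x => f n x - l x) <= e.
Proof.
move=> hf hc.
have L2B g k : L2 D g -> L2 D k -> L2 D (fun x => g x - k x).
  move=> hg hk; have := L2D mD hg (L2Z (-1) mD hk).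
  by under eq_fun do rewrite mulN1r.
have dE g k : L2 D g -> L2 D k ->
    rdot (fun x => g x - k x) (fun x => g x - k x) =
    \int[leb]_(x in D) ((Re (g x) - Re (k x)) ^+ 2) +
    \int[leb]_(x in D) ((Im (g x) - Im (k x)) ^+ 2).
  move=> hg hk; rewrite rdot_sqr; last exact: L2B.
  by congr (_ + _); apply: eq_Rintegral => x _; rewrite ?Re_add ?Re_opp ?Im_add ?Im_opp.
have [|e e0|l1 l1i l1c] := @sqint_complete _ _ R leb D mD (fun n x => Re (f n x)).
- by move=> n; have [] := (L2_sqint _ mD).1 (hf n).
- have [n0 hn0] := hc e e0; exists n0 => m n h1 h2; have := hn0 m n h1 h2.
  rewrite dE //; apply: le_trans; rewrite lerDl; exact: Rintegral_sqr_ge0.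
have [|e e0|l2 l2i l2c] := @sqint_complete _ _ R leb D mD (fun n x => Im (f n x)).
- by move=> n; have [] := (L2_sqint _ mD).1 (hf n).
- have [n0 hn0] := hc e e0; exists n0 => m n h1 h2; have := hn0 m n h1 h2.
  rewrite dE //; apply: le_trans; rewrite lerDr; exact: Rintegral_sqr_ge0.
have hl : L2 D (fun x => (l1 x +i* l2 x)%C) by apply/L2_sqint.
exists (fun x => (l1 x +i* l2 x)%C) => // e e0.
have e2 : 0 < e / 2 by rewrite divr_gt0.
have [n1 h1] := l1c _ e2; have [n2 h2] := l2c _ e2.
exists (maxn n1 n2) => n; rewrite geq_max => /andP[/h1 {}h1 /h2 {}h2].
by rewrite dE // (splitr e) lerD.
Qed.

End ComplexDot.

Section EnergyInnerProduct.
Context {R : realType} (zeta : R) (zeta_gt0 : 0 < zeta).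
Local Notation leb := (@lebesgue_measure R).
Local Notation X := (energy_space R).
Implicit Types (U W : state R) (x y z : X).
#[local] Hint Resolve measurable_I01 : core.

(** The real part of the inner product has the same norm, and dissipativity
    only concerns the real part; the energy space is therefore treated as a
    real Hilbert space. *)
Definition re_dotH U W : R := Re (dotH zeta U W).

Lemma re_dotHE U W :
  re_dotH U W = rdot (@I01 R) U.1 W.1 + zeta * rdot setT U.2 W.2.
Proof.
rewrite /re_dotH /dotH Re_add Re_scale /cint /rdot /=.
by congr (_ + _ * _); apply: eq_Rintegral => x _; rewrite Re_conjM.
Qed.

Lemma re_dotHC U W : re_dotH U W = re_dotH W U.
Proof. by rewrite !re_dotHE !(rdotC _ W.1) !(rdotC _ W.2). Qed.

Lemma re_dotH_eq U U' W : inH U -> inH U' -> inH W -> eqH U U' ->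
  re_dotH U W = re_dotH U' W.
Proof.
move=> [h1 h2] [k1 k2] [w1 w2] [e1 e2]; rewrite !re_dotHE.
by congr (_ + _ * _); apply: rdot_ae.
Qed.

Definition energy_dot x y : R := re_dotH x y.

Lemma energy_dotE x y U W : inH U -> inH W -> eqH x U -> eqH y W ->
  energy_dot x y = re_dotH U W.
Proof.
move=> hU hW xU yW; rewrite /energy_dot.
rewrite (re_dotH_eq (elt_inH x) hU (elt_inH y) xU) re_dotHC.
by rewrite (re_dotH_eq (elt_inH y) hW hU yW) re_dotHC.
Qed.

Lemma energy_inner_product : inner_product energy_dot.
Proof.
split.
- by move=> x y; exact: re_dotHC.
- move=> x y z; have [[x1 x2] [y1 y2]] := (elt_inH x, elt_inH y).
  have [z1 z2] := elt_inH z.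
  rewrite (energy_dotE (inHD (elt_inH x) (elt_inH y)) (elt_inH z)
    (elt_stateD _ _) (eqH_refl z)) /energy_dot !re_dotHE.
  by rewrite rdotDl // rdotDl //; ring.
- move=> a x z; have [[x1 x2] [z1 z2]] := (elt_inH x, elt_inH z).
  rewrite (energy_dotE (inHZ _ (elt_inH x)) (elt_inH z)
    (elt_stateZ _ _) (eqH_refl z)) /energy_dot !re_dotHE.
  by rewrite rdotZl // rdotZl //; ring.
- move=> x; rewrite /energy_dot re_dotHE addr_ge0 ?rdot_ge0 //.
  by rewrite mulr_ge0 ?rdot_ge0 // ltW.
move=> x; have [x1 x2] := elt_inH x; rewrite /energy_dot re_dotHE => h.
have p1 := rdot_ge0 (@I01 R) (elt_state x).1; have p2 := rdot_ge0 setT (elt_state x).2.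
have p3 : 0 <= zeta * rdot setT (elt_state x).2 (elt_state x).2 by rewrite mulr_ge0 // ltW.
move/eqP: h; rewrite paddr_eq0 // mulf_eq0 (gt_eqF zeta_gt0) /=.
move=> /andP[/eqP z1 /eqP z2].
apply: elt_eq; apply: eqH_trans (eqH_sym elt_state0); split.
  exact: rdot_null z1.
exact: rdot_null z2.
Qed.

Lemma ipnorm_normH x U : inH U -> eqH x U -> ipnorm energy_dot x = normH zeta U.
Proof. by move=> hU xU; rewrite /ipnorm (energy_dotE hU hU xU xU). Qed.

Lemma energy_complete : complete energy_dot.
Proof.
move=> u uc; pose N := ipnorm energy_dot.
have NE m x U : inH U -> eqH x U -> N (u m - x) ^+ 2 =
   rdot (@I01 R) (fun t => (elt_state (u m)).1 t - U.1 t) (fun t => (elt_state (u m)).1 t - U.1 t) +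
   zeta * rdot setT (fun t => (elt_state (u m)).2 t - U.2 t) (fun t => (elt_state (u m)).2 t - U.2 t).
  move=> hU xU; rewrite (sqr_ipnorm energy_inner_product).
  have e : eqH (u m - x) (elt_state (u m) - U).
    apply: eqH_trans (elt_stateB _ _) _; apply: eqHD; first exact: eqH_refl.
    exact: eqHN.
  have h := inHB (elt_inH (u m)) hU.
  by rewrite (energy_dotE h h e e) re_dotHE.
have c2 e : 0 < e -> exists n0, forall m n, (n0 <= m)%N -> (n0 <= n)%N ->
    N (u m - u n) ^+ 2 <= e.
  move=> e0; have s0 : 0 < Num.sqrt e by rewrite sqrtr_gt0.
  have [n0 hn0] := uc _ s0; exists n0 => m n h1 h2.
  rewrite -[leRHS]sqr_sqrtr ?(ltW e0) // ler_pXn2r ?nnegrE ?ipnorm_ge0 ?sqrtr_ge0 //.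
  exact: hn0.
have [|e e0|l1 L1 c1] := @L2_complete R (@I01 R) measurable_I01 (fun n => (elt_state (u n)).1).
- by move=> n; have [] := elt_inH (u n).
- have [n0 hn0] := c2 e e0; exists n0 => m n h1 h2; have := hn0 m n h1 h2.
  rewrite (NE _ _ _ (elt_inH (u n)) (eqH_refl _)); apply: le_trans.
  by rewrite lerDl mulr_ge0 ?rdot_ge0 // ltW.
have [|e e0|l2 L2' c2'] := @L2_complete R setT measurableT (fun n => (elt_state (u n)).2).
- by move=> n; have [] := elt_inH (u n).
- have ez : 0 < e * zeta by rewrite mulr_gt0.
  have [n0 hn0] := c2 _ ez; exists n0 => m n h1 h2; have := hn0 m n h1 h2.
  rewrite (NE _ _ _ (elt_inH (u n)) (eqH_refl _)) => H.
  rewrite -(ler_pM2l zeta_gt0) (mulrC zeta e).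
  by apply: le_trans H; rewrite lerDr rdot_ge0.
have hl : inH ((l1, l2) : state R) by split.
exists (class (l1, l2)) => e e0.
have e2 : 0 < e ^+ 2 / 2 by rewrite divr_gt0 // exprn_gt0.
have e3 : 0 < e ^+ 2 / 2 / zeta by rewrite divr_gt0.
have [n1 h1] := c1 _ e2; have [n2 h2] := c2' _ e3.
exists (maxn n1 n2) => n; rewrite geq_max => /andP[/h1 {}h1 /h2 {}h2].
rewrite -(@ler_pXn2r _ 2) ?nnegrE ?ipnorm_ge0 ?(ltW e0) //.
rewrite -/N (NE _ _ _ hl (classP hl)) [leRHS]splitr lerD //.
by rewrite mulrC -ler_pdivlMr.
Qed.

End EnergyInnerProduct.

(** * Absolutely continuous functions *)

Section AbsoluteContinuity.
Context {R : realType}.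
Local Notation leb := (@lebesgue_measure R).
Implicit Types f g : R -> R.

Definition interval_chain (a b : R) (n : nat) (x y : nat -> R) : Prop :=
  (forall k, (k < n)%N -> [/\ a <= x k, x k <= y k & y k <= b]) /\
  (forall k, (k.+1 < n)%N -> y k <= x k.+1).

Definition real_abs_cont (a b : R) f : Prop :=
  forall e : R, 0 < e -> exists2 d : R, 0 < d &
    forall n x y, interval_chain a b n x y ->
      \sum_(k < n) (y k - x k) < d ->
      \sum_(k < n) `|f (y k) - f (x k)| < e.

Lemma normc_ReIm (z : R[i]) :
  [/\ `|Re z| <= Normc.normc z, `|Im z| <= Normc.normc z &
      Normc.normc z <= `|Re z| + `|Im z|].
Proof.
case: z => a b /=; have h : 0 <= a ^+ 2 + b ^+ 2 by rewrite addr_ge0 ?sqr_ge0.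
split.
- by rewrite -sqrtr_sqr ler_sqrt // lerDl sqr_ge0.
- by rewrite -sqrtr_sqr ler_sqrt // lerDr sqr_ge0.
rewrite -[leRHS]ger0_norm ?addr_ge0 // -sqrtr_sqr ler_sqrt ?sqr_ge0 //.
have ha : `|a| ^+ 2 = a ^+ 2 by rewrite real_normK ?num_real.
have hb : `|b| ^+ 2 = b ^+ 2 by rewrite real_normK ?num_real.
rewrite sqrrD ha hb addrAC lerDl mulrn_wge0 ?mulr_ge0 //.
Qed.

Lemma abs_cont_parts (a b : R) (f : R -> R[i]) : abs_cont a b f <->
  real_abs_cont a b (Re \o f) /\ real_abs_cont a b (Im \o f).
Proof.
split=> [h|[h1 h2] e e0].
  split=> e e0; have [d d0 hd] := h e e0; exists d => // n x y [h1 h2] h3;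
    apply: le_lt_trans (hd n x y h1 h2 h3); apply: ler_sum => k _ /=.
    by rewrite -Re_opp -Re_add; have [] := normc_ReIm (f (y k) - f (x k)).
  by rewrite -Im_opp -Im_add; have [] := normc_ReIm (f (y k) - f (x k)).
have e2 : 0 < e / 2 by rewrite divr_gt0.
have [d1 d10 k1] := h1 _ e2; have [d2 d20 k2] := h2 _ e2.
exists (Num.min d1 d2) => [|n x y c1 c2]; first by rewrite lt_min d10.
rewrite lt_min => /andP[/(k1 _ _ _ (conj c1 c2)) s1 /(k2 _ _ _ (conj c1 c2)) s2].
rewrite (splitr e); apply: le_lt_trans (ltrD s1 s2); rewrite -big_split /=.
apply: ler_sum => k _ /=; rewrite -Re_opp -Re_add -Im_opp -Im_add.
by have [] := normc_ReIm (f (y k) - f (x k)).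
Qed.

Lemma interval_chain_sub a b a' b' n x y : a <= a' -> b' <= b ->
  interval_chain a' b' n x y -> interval_chain a b n x y.
Proof.
move=> aa bb [h1 h2]; split => // k /h1[u v w]; split => //.
  exact: le_trans u.
exact: le_trans w bb.
Qed.

Lemma real_abs_cont_sub a b a' b' f : a <= a' -> b' <= b ->
  real_abs_cont a b f -> real_abs_cont a' b' f.
Proof.
move=> aa bb h e e0; have [d d0 hd] := h e e0; exists d => // n x y c.
by apply: hd; exact: interval_chain_sub c.
Qed.

Lemma interval_chain0 a b x y : interval_chain a b 0 x y. Proof. by []. Qed.

Lemma interval_chain_rcons a b c d n x y : a <= b -> b <= c -> c <= d ->
  interval_chain a b n x y ->
  interval_chain a d n.+1 (fun k => if (k < n)%N then x k else c)
    (fun k => if (k < n)%N then y k else d).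
Proof.
move=> ab bc cd [h1 h2]; split=> k; rewrite ltnS.
  case: ltnP => [/h1[u v w] _|_ _]; last by split => //; exact: le_trans bc.
  by split => //; rewrite (le_trans w) // (le_trans bc).
move=> kn; have [kn1|kn1] := ltnP k.+1 n; first by rewrite (ltnW kn1) h2.
by rewrite kn; have [_ _ w] := h1 k kn; exact: le_trans w bc.
Qed.

Lemma interval_chain_mono a b n x y : interval_chain a b n x y ->
  forall i j, (i < j)%N -> (j < n)%N -> y i <= x j.
Proof.
move=> [h1 h2] i j; elim: j => // j IH; rewrite ltnS leq_eqVlt.
move=> /orP[/eqP ->|ij] jn; first exact: h2.
rewrite (le_trans (IH ij (ltnW jn))) //.
by have [_ xy _] := h1 j (ltnW jn); rewrite (le_trans xy) // h2.
Qed.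

Lemma real_abs_cont_comb a b (c : R) f g :
  real_abs_cont a b f -> real_abs_cont a b g ->
  real_abs_cont a b (fun x => c * f x + g x).
Proof.
move=> hf hg e e0; have c1 : 0 < `|c| + 1 by rewrite ltr_wpDl.
have e2 : 0 < e / 2 by rewrite divr_gt0.
have [d1 d10 k1] := hf _ (divr_gt0 e2 c1); have [d2 d20 k2] := hg _ e2.
exists (Num.min d1 d2) => [|n x y h]; first by rewrite lt_min d10.
rewrite lt_min => /andP[/(k1 _ _ _ h) s1 /(k2 _ _ _ h) s2].
rewrite ltr_pdivlMr // in s1.
rewrite (splitr e); apply: le_lt_trans (ltrD s1 s2).
rewrite mulr_suml -big_split /=; apply: ler_sum => k _.
have -> : c * f (y k) + g (y k) - (c * f (x k) + g (x k)) =
  c * (f (y k) - f (x k)) + (g (y k) - g (x k)) by ring.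
rewrite (le_trans (ler_normD _ _)) // lerD2r normrM mulrC.
by rewrite ler_wpM2l // lerDl.
Qed.

Lemma real_abs_contD a b f g : real_abs_cont a b f -> real_abs_cont a b g ->
  real_abs_cont a b (fun x => f x + g x).
Proof.
by move=> hf hg; have := real_abs_cont_comb 1 hf hg; under eq_fun do rewrite mul1r.
Qed.

Lemma real_abs_contB a b f g : real_abs_cont a b f -> real_abs_cont a b g ->
  real_abs_cont a b (fun x => f x - g x).
Proof.
move=> hf hg; have := real_abs_cont_comb (-1) hg hf.
by under eq_fun do rewrite mulN1r addrC.
Qed.

Lemma real_abs_cont_cst a b (c : R) : real_abs_cont a b (fun=> c).
Proof. by move=> e e0; exists 1 => // n x y _ _; rewrite big1 // => i _; rewrite subrr normr0. Qed.

Lemma real_abs_contM a b f g (M : R) :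
  (forall x, a <= x <= b -> `|f x| <= M /\ `|g x| <= M) ->
  real_abs_cont a b f -> real_abs_cont a b g ->
  real_abs_cont a b (fun x => f x * g x).
Proof.
move=> hM hf hg e e0.
have [ab|ba] := leP a b; last first.
  exists 1 => // n x y [h1 _] _; case: n h1 => [|n] h1; first by rewrite big_ord0.
  by have [u v w] := h1 0%N isT; have := le_lt_trans (le_trans u (le_trans v w)) ba; rewrite ltxx.
have M0 : 0 <= M by apply: le_trans (hM a _).1; rewrite ?lexx.
have M1 : 0 < M + 1 by rewrite ltr_wpDl.
have e2 : 0 < e / 2 / (M + 1) by rewrite !divr_gt0.
have [d1 d10 k1] := hf _ e2; have [d2 d20 k2] := hg _ e2.
exists (Num.min d1 d2) => [|n x y c]; first by rewrite lt_min d10.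
rewrite lt_min => /andP[/(k1 _ _ _ c) s1 /(k2 _ _ _ c) s2].
set S1 := \sum_(k < n) _ in s1; set S2 := \sum_(k < n) _ in s2.
have -> : e = (M + 1) * (e / 2 / (M + 1)) + (M + 1) * (e / 2 / (M + 1)).
  by field; rewrite gt_eqF.
apply: (@le_lt_trans _ _ ((M + 1) * S1 + (M + 1) * S2)); last first.
  by rewrite ltrD // ltr_pM2l.
rewrite !mulr_sumr -big_split /=; apply: ler_sum => k _.
have [xk yk] : (a <= x k <= b) /\ (a <= y k <= b).
  have [u v w] := c.1 k (ltn_ord k).
  by rewrite u w (le_trans u v) (le_trans v w).
have -> : f (y k) * g (y k) - f (x k) * g (x k) =
    (f (y k) - f (x k)) * g (y k) + f (x k) * (g (y k) - g (x k)) by ring.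
rewrite (le_trans (ler_normD _ _)) // !normrM lerD //.
  by rewrite mulrC ler_wpM2r // (le_trans (hM _ yk).2) // lerDl.
by rewrite ler_wpM2r // (le_trans (hM _ xk).1) // lerDl.
Qed.

Lemma is_derive0_increment f (s e : R) : is_derive s 1 f 0 -> 0 < e ->
  exists2 d, 0 < d & forall t, `|t - s| < d -> `|f t - f s| <= e * `|t - s|.
Proof.
move=> [df fE] e0.
have : h^-1 *: (f (h *: 1 + s) - f s) @[h --> 0^'] --> 'D_1 f s by exact: df.
rewrite fE => /cvgrPdist_le /(_ e e0).
move=> /nbhs_ballP[d /= d0 hd]; exists d => // t ts.
have [->|ts0] := eqVneq t s; first by rewrite !subrr normr0 mulr0.
have := hd (t - s); rewrite /ball /= sub0r normrN => /(_ ts).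
rewrite subr_eq0 => /(_ ts0); rewrite sub0r normrN.
rewrite scaler1 subrK normrM normfV ler_pdivrMl ?normr_gt0 ?subr_eq0 //.
by rewrite mulrC.
Qed.

(** A null set can be covered by an open set U of measure less than d. Going
    from a to b, one crosses either a piece of U, which is recorded in a chain
    of intervals of total length at most |U|, or an interval around a point
    where the derivative vanishes. *)
Lemma real_abs_cont_derive0 (a b : R) f : a <= b -> real_abs_cont a b f ->
  {ae leb, forall x, a < x < b -> is_derive x 1 f 0} -> f b = f a.
Proof.
move=> ab hf [B [mB B0 hB]].
suff H e : 0 < e -> `|f b - f a| <= e * (b - a) + e.
  apply/eqP; rewrite -subr_eq0 -normr_le0; apply/ler_addgt0Pr => e e0.
  have c0 : 0 < b - a + 1 by rewrite ltr_wpDl ?subr_ge0.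
  have := H _ (divr_gt0 e0 c0); rewrite add0r => /le_trans; apply.
  by rewrite -[X in _ + X]mulr1 -mulrDr divfK // gt_eqF.
move=> e0; have [d d0 hd] := hf e e0.
pose N : set R := B `|` [set a] `|` [set b].
have mN : measurable (N : set (measurableTypeR R)).
  by apply: measurableU => //; apply: measurableU.
have N0 : leb N = 0%E.
  rewrite measureU0 ?measureU0 //; [exact: lebesgue_measure_set1|exact: measurableU|].
  exact: lebesgue_measure_set1.
have Nfin : (leb N < +oo)%E by rewrite N0 ltry.
have [U [oU NU Ud']] := lebesgue_regularity_outer mN Nfin d0.
have mU : measurable (U : set (measurableTypeR R)) by exact: open_measurable.
have Ud : (leb U < d%:E)%E.
  apply: le_lt_trans Ud'; rewrite -[leRHS]adde0 -[X in (_ <= _ + X)%E]N0.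
  have mUN : measurable (U `\` N : set (measurableTypeR R)) by exact: measurableD.
  apply: le_trans (measureU2 leb mUN mN).
  apply: le_measure; rewrite ?inE //; first exact: measurableU.
  by move=> x Ux; have [Nx|Nx] := pselect (N x); [right|left].
pose P c := exists n x y, [/\ interval_chain a c n x y,
  ((\sum_(k < n) (y k - x k))%:E <= leb (U `&` `]a, c]))%E &
  `|f c - f a| <= e * (c - a) + \sum_(k < n) `|f (y k) - f (x k)|].
have Pa : P a.
  exists 0%N, (fun=> a), (fun=> a); split; first exact: interval_chain0.
    by rewrite big_ord0 measure_ge0.
  by rewrite big_ord0 !subrr normr0 mulr0 addr0.
have Pstep c c' : a <= c -> c <= c' -> P c ->
    (`]c, c'] `<=` U) \/ (`|f c' - f c| <= e * (c' - c)) -> P c'.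
  move=> ac cc' [n [x [y [h1 h2 h3]]]].
  have sub : U `&` `]a, c] `<=` U `&` `]a, c'].
    by apply: setIS; apply: subset_itvl; rewrite bnd_simp.
  have m1 : measurable (U `&` `]a, c] : set (measurableTypeR R)) by exact: measurableI.
  have m2 : measurable (U `&` `]a, c'] : set (measurableTypeR R)) by exact: measurableI.
  case=> [cU|cf]; last first.
    exists n, x, y; split; first exact: interval_chain_sub h1.
      by rewrite (le_trans h2) // le_measure ?inE.
    have -> : f c' - f a = (f c' - f c) + (f c - f a) by ring.
    rewrite (le_trans (ler_normD _ _)) // (le_trans (lerD cf h3)) //.
    by rewrite le_eqVlt; apply/orP; left; apply/eqP; ring.
  exists n.+1, (fun k => if (k < n)%N then x k else c),
    (fun k => if (k < n)%N then y k else c').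
  have sumE (F : R -> R -> R) :
      \sum_(k < n.+1) F (if (k < n)%N then x k else c) (if (k < n)%N then y k else c') =
      \sum_(k < n) F (x k) (y k) + F c c'.
    rewrite big_ord_recr /= ltnn; congr (_ + _); apply: eq_bigr => k _.
    by rewrite ltn_ord.
  split; first exact: interval_chain_rcons h1.
    rewrite (sumE (fun u v => v - u)) EFinD.
    apply: (@le_trans _ _ (leb ((U `&` `]a, c]) `|` `]c, c']))).
      rewrite measureU //; last first.
        rewrite -subset0 => t [[_ /=]]; rewrite !in_itv /= => /andP[_ tc] /andP[ct _].
        by have := lt_le_trans ct tc; rewrite ltxx.
      apply: leeD => //; rewrite /= lebesgue_measure_itv /= lte_fin.
      by case: ltP => // c'c; rewrite lee_fin subr_le0.
    apply: le_measure; rewrite ?inE //; first by apply: measurableU.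
    move=> t [[tU ta]|tc]; split => //.
    - by move: ta; apply: subset_itvl; rewrite bnd_simp.
    - exact: cU.
    - by move: tc; apply: subset_itvr; rewrite bnd_simp.
  rewrite (sumE (fun u v => `|f v - f u|)).
  have -> : f c' - f a = (f c - f a) + (f c' - f c) by ring.
  rewrite (le_trans (ler_normD _ _)) // addrA lerD // (le_trans h3) // lerD2r.
  by rewrite ler_pM2l // lerD2r.
(* The supremum of the points that can be reached is b, since from any point
   s of [a, b] one can go on a little. *)
pose E := [set c | a <= c <= b /\ P c].
have hE : has_sup E.
  by split; [exists a; split => //; rewrite lexx|exists b => c [/andP[]]].
pose s := sup E.
have Ea : E a by split => //; rewrite lexx.
have as' : a <= s by exact: (ub_le_sup hE.2).
have sb : s <= b by apply: ge_sup; [exists a|move=> c [/andP[]]].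
have [r r0 hr] : exists2 r, 0 < r & forall c c', s - r < c -> c <= s ->
    s <= c' -> c' < s + r -> (`]c, c'] `<=` U) \/ (`|f c' - f c| <= e * (c' - c)).
  have [sU|nsU] := pselect (U s).
    have /nbhs_ballP[r /= r0 hr] : nbhs s U by exact: open_nbhs_nbhs.
    exists r => // c c' h1 h2 h3 h4; left => t /=; rewrite in_itv /= => /andP[ct tc'].
    apply: hr; rewrite /ball /= distrC ltr_norml; apply/andP; split.
      by rewrite ltrBrDl (lt_trans h1).
    by rewrite ltrBlDl (le_lt_trans tc').
  have nB : ~ B s by move=> Bs; apply: nsU; apply: NU; left; left.
  have sa : s != a by apply/eqP => saE; apply: nsU; apply: NU; left; right.
  have sb' : s != b by apply/eqP => sbE; apply: nsU; apply: NU; right.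
  have ds : is_derive s 1 f 0.
    have : ~ (~ (a < s < b -> is_derive s 1 f 0)) by move=> h; apply: nB; apply: hB.
    by move/contrapT; apply; rewrite !lt_neqAle eq_sym sa as' sb' sb.
  have [r r0 hr] := is_derive0_increment ds e0.
  exists r => // c c' h1 h2 h3 h4; right.
  have H1 : `|f c' - f s| <= e * (c' - s).
    rewrite -[c' - s]ger0_norm ?subr_ge0 //; apply: hr.
    by rewrite ger0_norm ?subr_ge0 // ltrBlDl.
  have H2 : `|f c - f s| <= e * (s - c).
    rewrite -[s - c]ger0_norm ?subr_ge0 // [X in e * X]distrC; apply: hr.
    by rewrite distrC ger0_norm ?subr_ge0 //; move: h1; rewrite ltrBlDl ltrBlDr.
  have -> : f c' - f c = (f c' - f s) - (f c - f s) by ring.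
  rewrite (le_trans (ler_normB _ _)) // (le_trans (lerD H1 H2)) //.
  by rewrite -mulrDr addrA subrK.
have [c [/andP[ac cb] Pc] sc] := sup_adherent r0 hE.
have cs : c <= s by apply: ub_le_sup; [exact: hE.2|split => //; rewrite ac].
pose c' := Num.min b (s + r / 2).
have r2 : 0 < r / 2 by rewrite divr_gt0.
have sc' : s <= c' by rewrite le_min sb lerDl ltW.
have c'r : c' < s + r.
  by rewrite gt_min; apply/orP; right; rewrite ltrD2l gtr_pMr // invf_lt1 // ltr1n.
have Pc' : P c' by apply: (Pstep c) => //; [exact: le_trans sc'|exact: hr].
have Ec' : E c'.
  by split => //; rewrite (le_trans as' sc') ge_min lexx.
have c'b : c' = b.
  have : c' <= s by apply: ub_le_sup => //; exact: hE.2.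
  rewrite /c' minEle; case: ifP => // _; rewrite gerDl => h.
  by have := lt_le_trans r2 h; rewrite ltxx.
move: Pc'; rewrite c'b => -[n [x [y [h1 h2 h3]]]].
rewrite (le_trans h3) // lerD2l ltW //; apply: hd => //.
rewrite -lte_fin (le_lt_trans h2) // (le_lt_trans _ Ud) //.
by apply: le_measure; rewrite ?inE //; apply: measurableI.
Qed.

End AbsoluteContinuity.

(** * Primitives of integrable functions *)

Section Primitives.
Context {R : realType}.
Local Notation leb := (@lebesgue_measure R).
Implicit Types f g : R -> R.

Lemma integrable_sub (A B : set R) g : measurable (A : set (measurableTypeR R)) ->
  measurable (B : set (measurableTypeR R)) ->
  A `<=` B -> leb.-integrable B (EFin \o g) -> leb.-integrable A (EFin \o g).
Proof. by move=> mA mB AB; exact: integrableS. Qed.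

Lemma integrable_patch (A : set R) g :
  measurable (A : set (measurableTypeR R)) ->
  leb.-integrable A (EFin \o g) <-> leb.-integrable setT (EFin \o (g \_ A)).
Proof. by move=> mA; rewrite -restrict_EFin; exact: integrable_mkcond. Qed.

Lemma Rintegral_subset (A B : set R) g :
  measurable (A : set (measurableTypeR R)) ->
  measurable (B : set (measurableTypeR R)) -> A `<=` B ->
  leb.-integrable B (EFin \o g) -> (forall x, 0 <= g x) ->
  \int[leb]_(x in A) g x <= \int[leb]_(x in B) g x.
Proof.
move=> mA mB AB gi g0; rewrite -lee_fin !EFin_Rintegral //; last exact: integrable_sub gi.
apply: ge0_subset_integral => //; first exact: measurable_int gi.
by move=> x _; rewrite lee_fin.
Qed.

Section Primitive.
Variables (g : R -> R) (a : R).
Hypothesis gi : leb.-integrable setT (EFin \o g).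

Definition primitive (x : R) : R := \int[leb]_(t in `[a, x]) g t.

Lemma primitive0 : primitive a = 0.
Proof. by rewrite /primitive set_itv1 Rintegral_set1. Qed.

Lemma primitive_increment x y : a <= x -> x <= y ->
  primitive y - primitive x = \int[leb]_(t in `]x, y]) g t.
Proof.
move=> ax xy; rewrite /primitive Rintegral_itvB // ?bnd_simp //.
exact: integrable_sub gi.
Qed.

(** Along a chain of intervals the increments are integrals over disjoint sets
    of small total measure. *)
Lemma primitive_abs_cont b : real_abs_cont a b primitive.
Proof.
move=> e e0; have [d [d0 hd]] := integral_normr_continuous gi e0.
exists d => // n x y c small.
have gn : leb.-integrable setT (EFin \o (fun t => `|g t|)).
  by have := integrable_norm gi.
suff [E [mE lE sE _]] : exists E : set R,
    [/\ measurable (E : set (measurableTypeR R)),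
     (leb E <= (\sum_(k < n) (y k - x k))%:E)%E,
     \sum_(k < n) `|primitive (y k) - primitive (x k)| <= \int[leb]_(t in E) `|g t| &
     forall t, E t -> exists2 k, (k < n)%N & t <= y k].
  apply: (le_lt_trans sE); apply: hd => //.
  by rewrite (le_lt_trans lE) // lte_fin.
move: c; elim: n {small} => [|n IH] c.
  exists set0; split => //; first by rewrite measure0 big_ord0.
  by rewrite big_ord0 Rintegral_set0.
have cn : interval_chain a b n x y.
  by case: c => c1 c2; split=> k kn; [apply: c1|apply: c2]; rewrite ltnS ltnW.
have [E [mE lE sE bE]] := IH cn.
have [axn xyn ynb] := c.1 n (ltnSn n).
have disj t : E t -> [set` `]x n, y n]] t -> False.
  move=> /bE[k kn tyk]; rewrite /= in_itv /= => /andP[xt _].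
  have := interval_chain_mono c kn (ltnSn n).
  by move=> /(le_trans tyk)/(lt_le_trans xt); rewrite ltxx.
exists (E `|` [set` `]x n, y n]]); split.
- exact: measurableU.
- rewrite big_ord_recr /= EFinD; apply: (le_trans (measureU2 _ _ _)) => //.
  apply: leeD => //; rewrite /= lebesgue_measure_itv /= lte_fin.
  by case: ltP => // h; rewrite lee_fin subr_ge0.
- rewrite big_ord_recr /= Rintegral_setU //.
  + apply: lerD => //; rewrite primitive_increment //.
    apply: le_normr_Rintegral => //; exact: integrable_sub gi.
  + by apply: integrable_sub gn => //; exact: measurableU.
  + by apply/disj_setPS => t [/= /disj].
move=> t [/bE[k kn tk]|]; first by exists k => //; rewrite ltnS ltnW.
by rewrite /= in_itv /= => /andP[_ ty]; exists n.
Qed.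

Lemma primitive_derive :
  {ae leb, forall x, a < x -> is_derive x 1 primitive (g x)}.
Proof.
have gy y : leb.-integrable [set` Interval (BLeft a) (BRight y)] (EFin \o g).
  exact: integrable_sub gi.
apply: ae_imply (FTC1 gy (open_integrable_locally openT gi)) => x h ax.
have hx : (BLeft a < BRight x)%E by rewrite lte_fin.
have [dF F'] := h hx.
by apply: DeriveDef; [exact: dF|rewrite -derive1E].
Qed.

Lemma primitive_cvg_right : primitive x @[x --> a^'+] --> (0 : R).
Proof.
have a1 : a < a + 1 by rewrite ltrDl.
apply: cvg_at_right_filter.
apply: (parameterized_integral_cvg_left a1); exact: integrable_sub gi.
Qed.

Lemma primitive_bounded x : `|primitive x| <= \int[leb]_t `|g t|.
Proof.
have gx : leb.-integrable `[a, x] (EFin \o g) by exact: integrable_sub gi.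
rewrite /primitive (le_trans (le_normr_Rintegral _ gx)) //.
by apply: Rintegral_subset => //; exact: integrable_norm gi.
Qed.

End Primitive.

(** Subtracting the primitive of g leaves an absolutely continuous function
    whose derivative vanishes almost everywhere. *)
Lemma abs_cont_FTC (a b : R) f g : a <= b -> real_abs_cont a b f ->
  {ae leb, forall x, a < x < b -> is_derive x 1 f (g x)} ->
  leb.-integrable `]a, b[ (EFin \o g) ->
  f b - f a = \int[leb]_(t in `]a, b[) g t.
Proof.
move=> ab hf df gi; pose g' := g \_ `]a, b[.
have g'i : leb.-integrable setT (EFin \o g') by apply: (integrable_patch g _).1 gi.
have := @real_abs_cont_derive0 R a b (fun x => f x - primitive g' a x) ab.
move=> /(_ _ _)H.
have /eqP : f b - primitive g' a b = f a - primitive g' a a.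
  apply: H; first exact: real_abs_contB hf (primitive_abs_cont a g'i b).
  apply: ae_imply2 df (primitive_derive a g'i) => x h1 h2 /[dup] xab /andP[ax xb].
  have := is_deriveB (h1 xab) (h2 ax).
  rewrite /g' patchE mem_set /= ?in_itv /= ?ax ?xb // subrr.
  exact.
rewrite (primitive0 g' a) subr0 subr_eq addrC -subr_eq => /eqP ->.
rewrite /primitive -Rintegral_mkcondr setIidr //; exact: subset_itv_oo_cc.
Qed.

End Primitives.

(** * Integrability of power weights *)

Section PowerWeights.
Context {R : realType}.
Local Notation leb := (@lebesgue_measure R).

Lemma powR_FTC (p u v : R) : p + 1 != 0 -> 0 < u -> u < v ->
  (\int[leb]_(x in `[u, v]) (x `^ p)%:E =
   (v `^ (p + 1) / (p + 1))%:E - (u `^ (p + 1) / (p + 1))%:E)%E.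
Proof.
move=> p1 u0 uv.
pose F (x : R) := x `^ (p + 1) / (p + 1).
have dF (x : R) : 0 < x -> is_derive x 1 F (x `^ p).
  move=> x0; have d1 := @is_derive1_powR R (p + 1) x x0.
  have : is_derive x 1 ((p + 1)^-1 *: (@powR R ^~ (p + 1)))
    ((p + 1)^-1 *: ((p + 1) * x `^ (p + 1 - 1))) by exact: is_deriveZ.
  have -> : (p + 1)^-1 *: ((p + 1) * x `^ (p + 1 - 1)) = x `^ p :> R.
    by rewrite /GRing.scale /= mulrA mulVf // mul1r addrK.
  by congr is_derive; apply/funext => y; rewrite /F mulrC.
have cts (f : R -> R) (x l : R) : is_derive x 1 f l -> {for x, continuous f}.
  by move=> [df _]; apply: differentiable_continuous; apply/derivable1_diffP.
apply: (@continuous_FTC2 R (@powR R ^~ p) F) => //.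
- apply: continuous_in_subspaceT => x; rewrite inE /= in_itv /= => /andP[ux _].
  by apply: cts; apply: is_derive1_powR; exact: lt_le_trans ux.
- split.
  + by move=> x; rewrite in_itv /= => /andP[ux _]; have [] := dF x (lt_trans u0 ux).
  + by apply: cvg_at_right_filter; apply: cts; exact: dF.
  + by apply: cvg_at_left_filter; apply: cts; apply: dF; exact: lt_trans uv.
move=> x; rewrite in_itv /= => /andP[ux _].
by rewrite derive1E; have [] := dF x (lt_trans u0 ux).
Qed.

(** Monotone convergence over growing intervals on which the antiderivative
    remains bounded. *)
Lemma powR_integral_lty (p M : R) (u v : nat -> R) : p + 1 != 0 ->
  (forall n, 0 < u n) -> (forall n, u n < v n) ->
  (forall n m, (n <= m)%N -> u m <= u n /\ v n <= v m) ->
  (forall n, `|v n `^ (p + 1) / (p + 1)| <= M /\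
             `|u n `^ (p + 1) / (p + 1)| <= M) ->
  (\int[leb]_(x in \bigcup_n [set` `[u n, v n]]) (x `^ p)%:E < +oo)%E.
Proof.
move=> p1 u0 uv uvm hM.
have mp (A : set R) : measurable_fun (A : set (measurableTypeR R))
    (fun x : R => (x `^ p)%:E).
  apply/measurable_EFinP; apply: measurable_funTS; exact: measurable_powR.
have cv : (\int[leb]_(x in [set` `[u n, v n]]) (x `^ p)%:E)%E @[n --> \oo] -->
    (\int[leb]_(x in \bigcup_n [set` `[u n, v n]]) (x `^ p)%:E)%E.
  apply: (@ge0_nondecreasing_set_cvg_integral _ (measurableTypeR R) R
    (fun n => [set` `[u n, v n]]) (fun x => (x `^ p)%:E) leb) => //.
  - move=> n m nm; apply/subsetPset; apply: subset_itv; rewrite bnd_simp;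
      by have [] := uvm n m nm.
  - by move=> i x _; rewrite lee_fin powR_ge0.
apply: (@le_lt_trans _ _ (M + M)%:E); last exact: ltry.
rewrite -(cvg_lim _ cv) //; apply: lime_le; first exact: cvgP cv.
apply: nearW => n; rewrite powR_FTC // -EFinB lee_fin.
have [h1 h2] := hM n; rewrite (le_trans (ler_norm _)) //.
by rewrite (le_trans (ler_normB _ _)) // lerD.
Qed.

Lemma powR_integral01_lty (p : R) : -1 < p ->
  (\int[leb]_(x in `]0%R, 1%R]) (x `^ p)%:E < +oo)%E.
Proof.
move=> p1; have p0 : 0 < p + 1 by lra.
have -> : `]0%R, 1%R]%classic = \bigcup_n [set` `[n.+2%:R^-1 : R, 1%R]].
  apply/seteqP; split=> [x|x [n _]] /=; rewrite !in_itv /=.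
    move=> /andP[x0 x1]; exists (Num.trunc x^-1) => //=.
    rewrite in_itv /= x1 andbT invf_ple ?posrE //.
    by rewrite (le_trans (ltW (truncnS_gt _))) // ler_nat.
  by move=> /andP[nx ->]; rewrite andbT (lt_le_trans _ nx).
apply: (@powR_integral_lty p (p + 1)^-1) => //.
- by rewrite gt_eqF.
- by move=> n; rewrite invf_lt1 // ltr1n.
- by move=> n m nm; split=> //; rewrite lef_pV2 ?posrE // ler_nat ltnS ltnS.
have c0 : 0 <= (p + 1)^-1 by rewrite invr_ge0 ltW.
move=> n; rewrite powR1 mul1r ger0_norm //; split => //.
rewrite ger0_norm ?mulr_ge0 ?powR_ge0 // ler_piMl //.
have h1 : 1 `^ (p + 1) = 1 :> R by rewrite powR1.
rewrite -[leRHS]h1; apply: ge0_ler_powR; rewrite ?nnegrE ?(ltW p0) ?invr_ge0 //.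
by rewrite invf_le1 // ler1n.
Qed.

Lemma powR_integral1y_lty (p : R) : p < -1 ->
  (\int[leb]_(x in `[1%R, +oo[) (x `^ p)%:E < +oo)%E.
Proof.
move=> p1; have p0 : p + 1 < 0 by lra.
have -> : `[1%R, +oo[%classic = \bigcup_n [set` `[1%R, n.+2%:R : R]].
  apply/seteqP; split=> [x|x [n _]] /=; rewrite !in_itv /= ?andbT.
    move=> x1; exists (Num.trunc x) => //=.
    rewrite in_itv /= x1 /= (le_trans (ltW (truncnS_gt _))) // ler_nat //.
  by move=> /andP[].
apply: (@powR_integral_lty p (- (p + 1)^-1)) => //.
- by rewrite lt_eqF.
- by move=> n; rewrite ltr1n.
- by move=> n m nm; split=> //; rewrite ler_nat ltnS ltnS.
have c0 : (p + 1)^-1 <= 0 by rewrite invr_le0 ltW.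
move=> n; rewrite powR1 mul1r (ler0_norm c0); split => //.
rewrite ler0_norm ?mulr_ge0_le0 ?powR_ge0 // lerN2.
rewrite -[leLHS]mul1r ler_wnM2r //.
rewrite -[leRHS](powRr0 n.+2%:R); apply: ler_powR; last exact: ltW.
by rewrite ler1n.
Qed.

Lemma powR_integrable01 (p : R) : -1 < p ->
  leb.-integrable `]0%R, 1%R[ (EFin \o (fun x => x `^ p)).
Proof.
move=> p1; apply/integrableP; split.
  apply/measurable_EFinP; apply: measurable_funTS; exact: measurable_powR.
apply: le_lt_trans (powR_integral01_lty p1).
under eq_integral do rewrite /= ger0_norm ?powR_ge0 //.
apply: ge0_subset_integral => //.
- apply/measurable_EFinP; apply: measurable_funTS; exact: measurable_powR.
- by move=> x _; rewrite lee_fin powR_ge0.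
by apply: subset_itvl; rewrite bnd_simp.
Qed.

(** Near 0 the exponent 2 a - 1 exceeds -1, and at infinity the function is
    bounded by |x|^(2 a - 3), whose exponent is less than -1. *)
Lemma weight_integrable (a : R) : 0 < a -> a < 1 ->
  leb.-integrable setT
    (EFin \o (fun x => `|x| `^ (2 * a - 1) / (1 + `|x|) ^+ 2)).
Proof.
move=> a0 a1; set k := fun x : R => `|x| `^ (2 * a - 1) / (1 + `|x|) ^+ 2.
have mnorm : measurable_fun setT (fun x : R => `|x|) by exact: normr_measurable.
have mk : measurable_fun setT k.
  apply: measurable_funM; first exact: (measurableT_comp (measurable_powR _)).
  have -> : (fun x : R => (1 + `|x|) ^- 2) = (fun x : R => (1 + `|x|) `^ (-2)).
    by apply/funext => x; rewrite powR_invn ?addr_ge0.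
  apply: (measurableT_comp (measurable_powR _)).
  by apply: measurable_funD.
have k0 x : 0 <= k x by rewrite mulr_ge0 ?powR_ge0 // invr_ge0 sqr_ge0.
have mkE (A : set R) : measurable_fun (A : set (measurableTypeR R)) (EFin \o k).
  by apply/measurable_EFinP; exact: measurable_funTS.
have k0E x : (0 <= (k x)%:E)%E by rewrite lee_fin.
have kp : (\int[leb]_(x in `[0%R, +oo[) (k x)%:E < +oo)%E.
  rewrite -integral_itv_obnd_cbnd; last exact: mkE.
  have -> : `]0%R, +oo[%classic = `]0%R, 1%R] `|` `]1%R, +oo[ :> set R.
    by rewrite -itv_bndbnd_setU // bnd_simp.
  rewrite ge0_integral_setU //; last first.
    apply/disj_setPS => x [/= + h2]; move: h2.
    rewrite !in_itv /= andbT => x1 /andP[_ x2].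
    by have := lt_le_trans x1 x2; rewrite ltxx.
  apply: lte_add_pinfty.
    apply: (@le_lt_trans _ _ (\int[leb]_(x in `]0%R, 1%R]) (x `^ (2 * a - 1))%:E)%E).
      apply: ge0_le_integral => //.
      - apply/measurable_EFinP; apply: measurable_funTS; exact: measurable_powR.
      move=> x /=; rewrite in_itv /= => /andP[x0 _]; rewrite lee_fin /k gtr0_norm //.
      rewrite ler_piMr ?powR_ge0 // invf_le1 ?exprn_gt0 ?addr_gt0 //.
      by rewrite exprn_ege1 // lerDl ltW.
    by apply: powR_integral01_lty; lra.
  apply: (@le_lt_trans _ _ (\int[leb]_(x in `[1%R, +oo[) (x `^ (2 * a - 3))%:E)%E).
    apply: (@le_trans _ _ (\int[leb]_(x in `[1%R, +oo[) (k x)%:E)%E).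
      by apply: ge0_subset_integral => //; apply: subset_itvr; rewrite bnd_simp.
    apply: ge0_le_integral => //.
    - apply/measurable_EFinP; apply: measurable_funTS; exact: measurable_powR.
    move=> x /=; rewrite in_itv /= andbT => x1; have x0 : 0 < x by lra.
    rewrite lee_fin /k gtr0_norm // ler_pdivrMr ?exprn_gt0 ?addr_gt0 //.
    have -> : 2 * a - 1 = (2 * a - 3) + 2 by ring.
    rewrite powRD; last by apply/implyP => _; rewrite gt_eqF.
    rewrite ler_wpM2l ?powR_ge0 // -[x `^ 2]/(x `^ 2%:R) powR_mulrn ?(ltW x0) //.
    by rewrite ler_pXn2r ?nnegrE ?addr_ge0 ?(ltW x0) // lerDr.
  by apply: powR_integral1y_lty; lra.
have kn : (\int[leb]_(x in `]-oo, 0%R]) (k x)%:E < +oo)%E.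
  have E := @ge0_integration_by_substitution0 R (EFin \o k) (mkE setT) k0E.
  move: kp; rewrite E.
  by under eq_integral do rewrite /= /k normrN -/(k _).
apply/integrableP; split => //.
under eq_integral do rewrite /= ger0_norm //.
have -> : [set: R] = `]-oo, 0%R] `|` `]0%R, +oo[.
  by rewrite -itv_bndbnd_setU // ?set_itvE.
rewrite ge0_integral_setU //; last first.
  apply/disj_setPS => x [/= + h2]; move: h2.
  rewrite !in_itv /= andbT => x1 x2.
  by have := lt_le_trans x1 x2; rewrite ltxx.
by apply: lte_add_pinfty => //; rewrite integral_itv_obnd_cbnd //; exact: mkE.
Qed.

End PowerWeights.

(** * Traces of absolutely continuous functions on the unit interval *)

Section UnitInterval.
Context {R : realType}.
Local Notation leb := (@lebesgue_measure R).
Local Notation I01 := (@I01 R).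
Implicit Types f g : R -> R.

Lemma I01P (x : R) : I01 x <-> 0 < x < 1.
Proof. by rewrite /I01 /= in_itv. Qed.

Definition ae_derivative_on01 f g : Prop :=
  {ae leb, forall x, I01 x -> is_derive x 1 f (g x)}.

Lemma patch_primitive f g (a b : R) : 0 <= a -> a <= b -> b <= 1 ->
  real_abs_cont a b f -> ae_derivative_on01 f g ->
  leb.-integrable I01 (EFin \o g) ->
  f b - f a = primitive (g \_ I01) 0 b - primitive (g \_ I01) 0 a.
Proof.
move=> a0 ab b1 hf df gi.
have Gi := (integrable_patch g (measurable_itv _)).1 gi.
have sub : `]a, b[%classic `<=` I01.
  by apply: subset_itv; rewrite bnd_simp.
rewrite (primitive_increment Gi) // (@abs_cont_FTC R a b f g) //.
- rewrite -Rintegral_itv_bndo_bndc; last first.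
    by apply: integrable_sub Gi.
  apply: eq_Rintegral => x; rewrite inE => xab; rewrite patchE mem_set //.
  exact: sub.
- apply: ae_imply df => x h xab; apply: h; apply: sub.
  by rewrite /= in_itv.
by apply: integrable_sub gi => //; exact: measurable_I01.
Qed.

(** The fundamental theorem applies away from 0, and the integrability of g up
    to 0 is what provides a trace there. *)
Lemma half_open_primitive f g :
  (forall e, 0 < e -> e <= 1 -> real_abs_cont e 1 f) ->
  ae_derivative_on01 f g -> leb.-integrable I01 (EFin \o g) ->
  exists c, forall x, 0 < x -> x <= 1 -> f x = c + primitive (g \_ I01) 0 x.
Proof.
move=> hf df gi; exists (f 1 - primitive (g \_ I01) 0 1) => x x0 x1.
have := patch_primitive (ltW x0) x1 (lexx 1) (hf x x0 x1) df gi.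
by move=> h; lra.
Qed.

Lemma closed_primitive f g : real_abs_cont 0 1 f ->
  ae_derivative_on01 f g -> leb.-integrable I01 (EFin \o g) ->
  forall x, 0 <= x -> x <= 1 -> f x = f 0 + primitive (g \_ I01) 0 x.
Proof.
move=> hf df gi x x0 x1.
have := patch_primitive (lexx 0) x0 x1 (real_abs_cont_sub (lexx 0) x1 hf) df gi.
by rewrite primitive0 => h; lra.
Qed.

Lemma primitive_trace f (G : R -> R) (c : R) :
  leb.-integrable setT (EFin \o G) ->
  (forall x, 0 < x -> x <= 1 -> f x = c + primitive G 0 x) ->
  f x @[x --> 0^'+] --> c.
Proof.
move=> Gi fE; rewrite -[c in _ --> c]addr0.
have h : (c + primitive G 0 x) @[x --> 0^'+] --> c + 0.
  by apply: cvgD; [exact: cvg_cst|exact: primitive_cvg_right].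
apply: cvg_trans h; apply: near_eq_cvg; near=> x.
rewrite fE //.
by near: x; exact: nbhs_right_le.
Unshelve. all: by end_near. Qed.

Lemma primitive_bound f (G : R -> R) (c : R) :
  leb.-integrable setT (EFin \o G) ->
  (forall x, 0 < x -> x <= 1 -> f x = c + primitive G 0 x) ->
  exists M, forall x, 0 < x -> x <= 1 -> `|f x| <= M.
Proof.
move=> Gi fE; exists (`|c| + \int[leb]_t `|G t|) => x x0 x1.
rewrite fE // (le_trans (ler_normD _ _)) // lerD2l.
exact: primitive_bounded.
Qed.

(** Every interval of positive length contains a zero. *)
Lemma abs_cont_ae_zero f :
  (forall e, 0 < e -> e <= 1 -> real_abs_cont e 1 f) ->
  {ae leb, forall x, I01 x -> f x = 0} -> forall x, I01 x -> f x = 0.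
Proof.
move=> hf [B [mB B0 hB]] x /I01P/andP[x0 x1].
have x2 : 0 < x / 2 by rewrite divr_gt0.
apply/eqP; rewrite -normr_le0; apply/ler_addgt0Pr => e e0; rewrite add0r.
have [|d d0 hd] := hf (x / 2) x2 _ e e0; first by lra.
pose a := Num.max (x / 2) (x - d / 2).
have ax : a < x by rewrite gt_max; apply/andP; split; lra.
have xa : x / 2 <= a by rewrite le_max lexx.
have [y /andP[ay yx] yB] : exists2 y, a < y < x & ~ B y.
  apply/not_exists2P => H.
  have sub : `]a, x[%classic `<=` B.
    by move=> y /=; rewrite in_itv /= => ayx; have [//|/contrapT] := H y.
  have : (leb `]a, x[ <= leb B)%E by apply: le_measure; rewrite ?inE.
  rewrite B0 lebesgue_measure_itv /= lte_fin ax -EFinB lee_fin subr_le0.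
  by rewrite leNgt ax.
have y0 : f y = 0.
  apply: contrapT => fy; apply: yB; apply: hB => /= H; apply: fy; apply: H.
  by apply/I01P; apply/andP; split; lra.
have dxy : x - y < d.
  have : x - d / 2 <= a by rewrite le_max lexx orbT.
  lra.
have := hd 1%N (fun=> y) (fun=> x); rewrite !big_ord1 y0 subr0 => H.
apply/ltW; apply: H => //; split => // k _; split; lra.
Qed.

Lemma derive_of_zero f (l : R) x :
  (forall y, I01 y -> f y = 0) -> I01 x -> is_derive x 1 f l -> l = 0.
Proof.
move=> f0 x01 [_ <-].
have -> : 'D_1 f x = 'D_1 (cst 0 : R -> R) x; last by rewrite derive_cst.
apply: near_eq_derive; have /I01P x01' := x01.
near=> y; rewrite f0 //.
near: y; apply: open_nbhs_nbhs; split => //; exact: interval_open.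
Unshelve. all: by end_near. Qed.

End UnitInterval.

(** * The degenerate Schroedinger operator with diffusive boundary feedback *)

Section DiffusiveWeight.
Context {R : realType} (alphat : R) (halphat0 : 0 < alphat) (halphat1 : alphat < 1).
Local Notation leb := (@lebesgue_measure R).
Local Notation mu := (weight alphat).

Lemma sqr_weight (x : R) : mu x ^+ 2 = `|x| `^ (2 * alphat - 1).
Proof. by rewrite /weight -powR_mulrn ?powR_ge0 // -powRrM divfK. Qed.

Lemma measurable_weight : measurable_fun setT (mu : R -> R).
Proof.
apply: (measurableT_comp (measurable_powR _)); exact: normr_measurable.
Qed.

Lemma sqint_weight : sqint leb setT (fun x => mu x / (1 + `|x|)).
Proof.
split.
  apply: measurable_funM; first exact: measurable_weight.
  have -> : (fun x : R => (1 + `|x|)^-1) = (fun x : R => (1 + `|x|) `^ (-1)).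
    by apply/funext => x; rewrite powR_inv1 // addr_ge0.
  apply: (measurableT_comp (measurable_powR _)).
  by apply: measurable_funD => //; exact: normr_measurable.
have := weight_integrable halphat0 halphat1.
by under [in X in _ -> X]eq_fun do rewrite exprMn sqr_weight exprVn.
Qed.

(** Write mu f as the product of mu / (1 + |x|) and (1 + |x|) f, which are both
    square integrable. *)
Lemma weight_pairing_integrable (f : R -> R) :
  sqint leb setT f -> sqint leb setT (fun x => `|x| * f x) ->
  leb.-integrable setT (EFin \o (fun x => mu x * f x)).
Proof.
move=> hf hxf; have := sqintM measurableT sqint_weight (sqintD measurableT hf hxf).
apply: eq_integrable => // x _ /=; congr EFin; field.
by rewrite gt_eqF // ltr_wpDr.
Qed.

End DiffusiveWeight.

Section BoundedOn01.
Context {R : realType}.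
Local Notation leb := (@lebesgue_measure R).
Local Notation I01 := (@I01 R).
Local Notation mI := (@measurable_I01 R).

Lemma bounded_integrable01 (f : R -> R) (M : R) : measurable_fun I01 f ->
  (forall x, I01 x -> `|f x| <= M) -> leb.-integrable I01 (EFin \o f).
Proof.
move=> mf hM; apply: measurable_bounded_integrable => //; first exact: mI.
  by rewrite /= lebesgue_measure_itv /= lte_fin ltr01 -EFinB ltry.
exists M; split; first exact: num_real.
by move=> y My x x01 /=; rewrite (le_trans (hM x x01)) // ltW.
Qed.

Lemma bounded_sqint01 (f : R -> R) (M : R) : measurable_fun I01 f ->
  (forall x, I01 x -> `|f x| <= M) -> sqint leb I01 f.
Proof.
move=> mf hM; split => //; apply: (@bounded_integrable01 _ (M ^+ 2)).
  exact: measurable_funX.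
move=> x x01; have h := hM x x01.
by rewrite normrX ler_pXn2r // nnegrE // (le_trans _ h).
Qed.

Lemma sqint_integrable01 (f : R -> R) : sqint leb I01 f ->
  leb.-integrable I01 (EFin \o f).
Proof.
move=> hf; have c1 : sqint leb I01 (fun=> 1).
  by apply: (@bounded_sqint01 _ 1) => // x _; rewrite normr1.
have := sqintM mI hf c1.
by under eq_fun do rewrite mulr1.
Qed.

Lemma Rintegral_cst01 (c : R) : \int[leb]_(x in I01) c = c.
Proof.
rewrite Rintegral_cst //; last exact: mI.
by rewrite /= lebesgue_measure_itv /= lte_fin ltr01 -EFinB /= subr0 mulr1.
Qed.

Lemma sqint_powR01 (p : R) : -1 < 2 * p -> sqint leb I01 (fun x => x `^ p).
Proof.
move=> p1; split; first by apply: measurable_funTS; exact: measurable_powR.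
have := powR_integrable01 p1; apply: eq_integrable; first exact: mI.
by move=> x _ /=; congr EFin; rewrite -powR_mulrn ?powR_ge0 // -powRrM mulrC.
Qed.

End BoundedOn01.

Section H2alphaTheory.
Context {R : realType} (alpha : R) (halpha0 : 0 < alpha) (halpha1 : alpha < 1).
Local Notation leb := (@lebesgue_measure R).
Local Notation I01 := (@I01 R).
Local Notation mI := (@measurable_I01 R).
Variables (v dv w dw : R -> R[i]).
Hypothesis hv : H2alpha alpha v dv w dw.

(** The function x^(- alpha / 2) is square integrable because alpha < 1. *)
Lemma integrable_derivative_from_weighted (g : R -> R) :
  sqint leb I01 (fun x => x `^ (alpha / 2) * g x) ->
  leb.-integrable I01 (EFin \o g).
Proof.
move=> hg.
have pE : sqint leb I01 (fun x => x `^ (- (alpha / 2))).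
  by apply: sqint_powR01; rewrite mulrN mulrC divfK // ltrN2.
have := sqintM mI pE hg; apply: eq_integrable; first exact: mI.
move=> x; rewrite inE => /I01P/andP[x0 _] /=; congr EFin.
rewrite mulrA -powRD; last by apply/implyP => _; rewrite gt_eqF.
by rewrite addNr powRr0 mul1r.
Qed.

Lemma H2alpha_v_integrable :
  leb.-integrable I01 (EFin \o (fun x => Re (dv x))) /\
  leb.-integrable I01 (EFin \o (fun x => Im (dv x))).
Proof.
have [[_ _ _ /(L2_sqint _ mI)[h1 h2]] _ _] := hv.
split; apply: integrable_derivative_from_weighted.
  by under eq_fun do rewrite -Re_scale.
by under eq_fun do rewrite -Im_scale.
Qed.

Lemma H2alpha_v_primitive : exists c : R[i], forall x, 0 < x -> x <= 1 ->
  Re (v x) = Re c + primitive ((fun x => Re (dv x)) \_ I01) 0 x /\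
  Im (v x) = Im c + primitive ((fun x => Im (dv x)) \_ I01) 0 x.
Proof.
have [[_ ac ad _] _ _] := hv; have [i1 i2] := H2alpha_v_integrable.
have [|||c1 h1] := @half_open_primitive R (fun x => Re (v x)) (fun x => Re (dv x)).
- by move=> e e0 e1; have /abs_cont_parts[] := ac e e0 e1.
- by apply: ae_imply ad => x h /h[].
- by [].
have [|||c2 h2] := @half_open_primitive R (fun x => Im (v x)) (fun x => Im (dv x)).
- by move=> e e0 e1; have /abs_cont_parts[] := ac e e0 e1.
- by apply: ae_imply ad => x h /h[].
- by [].
by exists (c1 +i* c2)%C => x x0 x1; rewrite h1 ?h2.
Qed.

Lemma H2alpha_trace0 : exists2 c : R[i], trace0 v = c &
  Re (v x) @[x --> 0^'+] --> Re c /\ Im (v x) @[x --> 0^'+] --> Im c.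
Proof.
have [c hc] := H2alpha_v_primitive; have [i1 i2] := H2alpha_v_integrable.
have c1 : Re (v x) @[x --> 0^'+] --> Re c.
  apply: primitive_trace ((integrable_patch _ mI).1 i1) _ => x x0 x1.
  by have [] := hc x x0 x1.
have c2 : Im (v x) @[x --> 0^'+] --> Im c.
  apply: primitive_trace ((integrable_patch _ mI).1 i2) _ => x x0 x1.
  by have [] := hc x x0 x1.
exists c => //; rewrite /trace0 (cvg_lim _ c1) // (cvg_lim _ c2) //.
by case: (c).
Qed.

Lemma H2alpha_trace0_cvg :
  Re (v x) @[x --> 0^'+] --> Re (trace0 v) /\
  Im (v x) @[x --> 0^'+] --> Im (trace0 v).
Proof. by have [c -> ] := H2alpha_trace0. Qed.

Lemma H2alpha_w_primitive :
  (forall x, 0 <= x -> x <= 1 -> Re (w x) = Re (w 0) +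
     primitive ((fun x => Re (dw x)) \_ I01) 0 x) /\
  (forall x, 0 <= x -> x <= 1 -> Im (w x) = Im (w 0) +
     primitive ((fun x => Im (dw x)) \_ I01) 0 x).
Proof.
have [_ _ [_ ac ad /(L2_sqint _ mI)[l1 l2]]] := hv.
have /abs_cont_parts[a1 a2] := ac.
split.
  apply: closed_primitive => //; last exact: sqint_integrable01.
  by apply: ae_imply ad => x h /h[].
apply: closed_primitive => //; last exact: sqint_integrable01.
by apply: ae_imply ad => x h /h[].
Qed.

(** Integration by parts. The function Im w Re v - Re w Im v has derivative
    Im w' Re v - Re w' Im v, because the two products w v' have the same
    argument and their contributions cancel. *)
Lemma H2alpha_boundary_term : dv 1 = 0 ->
  rdot I01 v (fun x => - 'i%C * dw x) =
  Re (w 0) * Im (trace0 v) - Im (w 0) * Re (trace0 v).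
Proof.
move=> dv1; have [[v2 vac vad _] wE [w2 wac wad dw2]] := hv.
set t := trace0 v; have [t1 t2] := H2alpha_trace0_cvg; rewrite -/t in t1 t2.
have [p1 p2] := H2alpha_w_primitive.
have idw : L2 I01 (fun x => - 'i%C * dw x) by apply: L2Z => //; exact: mI.
pose q x := Re (v x) * Re (- 'i%C * dw x) + Im (v x) * Im (- 'i%C * dw x).
have qi : leb.-integrable I01 (EFin \o q) by apply: rdot_integrable => //; exact: mI.
pose Q x := Im (w x) * Re (v x) - Re (w x) * Im (v x).
have /(L2_sqint _ mI)[l1 l2] := dw2.
have Gw1 := (integrable_patch _ mI).1 (sqint_integrable01 l1).
have Gw2 := (integrable_patch _ mI).1 (sqint_integrable01 l2).
have [M1 b1] := primitive_bound Gw1 (fun x x0 x1 => p1 x (ltW x0) x1).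
have [M2 b2] := primitive_bound Gw2 (fun x x0 x1 => p2 x (ltW x0) x1).
have [cv hcv] := H2alpha_v_primitive; have [i1 i2] := H2alpha_v_integrable.
have [M3 b3] := primitive_bound ((integrable_patch _ mI).1 i1)
  (fun x x0 x1 => (hcv x x0 x1).1).
have [M4 b4] := primitive_bound ((integrable_patch _ mI).1 i2)
  (fun x x0 x1 => (hcv x x0 x1).2).
pose M := `|M1| + `|M2| + `|M3| + `|M4|.
have MM : [/\ M1 <= M, M2 <= M, M3 <= M & M4 <= M].
  have [[n1 n2] [n3 n4]] := ((ler_norm M1, ler_norm M2), (ler_norm M3, ler_norm M4)).
  have [[m1 m2] [m3 m4]] := ((normr_ge0 M1, normr_ge0 M2), (normr_ge0 M3, normr_ge0 M4)).
  by rewrite /M; split; lra.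
have [c hQ] : exists c, forall x, 0 < x -> x <= 1 -> Q x = c + primitive (q \_ I01) 0 x.
  apply: half_open_primitive => //.
    move=> e e0 e1; have [M1M M2M M3M M4M] := MM.
    have /abs_cont_parts[v1e v2e] := vac e e0 e1.
    have /abs_cont_parts[w1 w2'] := wac.
    have w1e := real_abs_cont_sub (ltW e0) (lexx 1) w1.
    have w2e := real_abs_cont_sub (ltW e0) (lexx 1) w2'.
    apply: real_abs_contB; apply: (real_abs_contM (M := M)) => //;
      move=> x /andP[ex x1]; have x0 := lt_le_trans e0 ex; split.
    - exact: le_trans (b2 x x0 x1) M2M.
    - exact: le_trans (b3 x x0 x1) M3M.
    - exact: le_trans (b1 x x0 x1) M1M.
    - exact: le_trans (b4 x x0 x1) M4M.
  apply: ae_imply2 vad wad => x hvx hwx x01.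
  have [dv1x dv2x] := hvx x01; have [dw1x dw2x] := hwx x01.
  have := is_deriveB (is_deriveM dw2x dv1x) (is_deriveM dw1x dv2x).
  congr is_derive; rewrite /q /GRing.scale /=.
  have /I01P/andP[x0 x1] := x01; rewrite (wE x x0 (ltW x1)).
  by rewrite !Re_mul !Im_mul ?Re_scale ?Im_scale !Re_opp !Im_opp Re_unit Im_unit Re_real Im_real; ring.
have cE : c = Im (w 0) * Re t - Re (w 0) * Im t.
  have Qc : Q x @[x --> 0^'+] --> c.
    exact: primitive_trace ((integrable_patch _ mI).1 qi) hQ.
  have w1c : Re (w x) @[x --> 0^'+] --> Re (w 0).
    by apply: primitive_trace Gw1 _ => x x0 x1; apply: p1 => //; exact: ltW.
  have w2c : Im (w x) @[x --> 0^'+] --> Im (w 0).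
    by apply: primitive_trace Gw2 _ => x x0 x1; apply: p2 => //; exact: ltW.
  have := cvgB (cvgM w2c t1) (cvgM w1c t2) => Qc'.
  by rewrite -(cvg_lim (@Rhausdorff R) Qc); apply: (cvg_lim (@Rhausdorff R)); exact: Qc'.
have w1 : w 1 = 0 by rewrite wE // dv1 mulr0.
have := hQ 1 ltr01 (lexx 1); rewrite /Q w1 Re_zero Im_zero !mul0r subr0 cE.
have -> : primitive (q \_ I01) 0 1 = rdot I01 v (fun x => - 'i%C * dw x).
  rewrite /primitive -Rintegral_mkcondr setIidr //; exact: subset_itv_oo_cc.
by move=> h; lra.
Qed.

End H2alphaTheory.

Section OperatorGraph.
Context {R : realType} (alpha alphat rho eta : R)
    (halpha0 : 0 < alpha) (halpha1 : alpha < 1)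
    (halphat0 : 0 < alphat) (halphat1 : alphat < 1)
    (hrho : 0 < rho) (heta : 0 <= eta).
Local Notation leb := (@lebesgue_measure R).
Local Notation I01 := (@I01 R).
Local Notation mI := (@measurable_I01 R).
Local Notation graphA := (graphA alpha alphat rho eta).
Local Notation zeta := (zeta alphat rho).
Local Notation mu := (weight alphat).
Local Notation diffusive := (diffusive alphat eta).
Implicit Types (U F : state R) (phi : R -> R[i]).

Lemma zeta_gt0 : 0 < zeta.
Proof.
rewrite /Defs.zeta mulr_gt0 ?mulr_gt0 ?invr_gt0 ?pi_gt0 // sin_gt0_pi //.
by rewrite mulr_gt0 ?pi_gt0 //= gtr_pMl ?pi_gt0.
Qed.

(** The integral in the boundary condition at 0. *)
Definition flux_moment phi : R[i] := cint setT (fun xi => (mu xi)%:C%C * phi xi).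

Lemma flux_moment_parts phi :
  Re (flux_moment phi) = \int[leb]_xi (mu xi * Re (phi xi)) /\
  Im (flux_moment phi) = \int[leb]_xi (mu xi * Im (phi xi)).
Proof.
by split; apply: eq_Rintegral => x _; [exact: Re_scale|exact: Im_scale].
Qed.

Lemma flux_integrable phi : L2 setT phi -> L2 setT (fun xi => `|xi|%:C%C * phi xi) ->
  leb.-integrable setT (EFin \o (fun x => mu x * Re (phi x))) /\
  leb.-integrable setT (EFin \o (fun x => mu x * Im (phi x))).
Proof.
move=> /(L2_sqint _ measurableT)[p1 p2] /(L2_sqint _ measurableT)[q1 q2].
split; apply: weight_pairing_integrable => //.
  by under eq_fun do rewrite -Re_scale.
by under eq_fun do rewrite -Im_scale.
Qed.

Lemma diffusive_parts phi c xi :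
  Re (diffusive phi c xi) = - (xi ^+ 2 + eta) * Re (phi xi) + mu xi * Re c /\
  Im (diffusive phi c xi) = - (xi ^+ 2 + eta) * Im (phi xi) + mu xi * Im c.
Proof.
by rewrite /Defs.diffusive Re_add Im_add !Re_scale !Im_scale !mulNr Re_opp Im_opp
  Re_scale Im_scale.
Qed.

(** The damping term - (xi^2 + eta) |phi|^2 is discarded. *)
Lemma rdot_diffusive_le phi c : L2 setT phi ->
  L2 setT (fun xi => `|xi|%:C%C * phi xi) -> L2 setT (diffusive phi c) ->
  rdot setT phi (diffusive phi c) <=
  Re (flux_moment phi) * Re c + Im (flux_moment phi) * Im c.
Proof.
move=> hp hxp hd; have [f1 f2] := flux_integrable hp hxp.
have [-> ->] := flux_moment_parts phi.
have f1c := integrableZr measurableT (Re c) f1.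
have f2c := integrableZr measurableT (Im c) f2.
rewrite -!RintegralZr // -RintegralD //.
apply: le_Rintegral => //.
- exact: rdot_integrable.
- exact: (integrableD measurableT f1c f2c).
move=> x _ /=; have [-> ->] := diffusive_parts phi c x.
have : 0 <= (x ^+ 2 + eta) * (Re (phi x) ^+ 2 + Im (phi x) ^+ 2).
  by rewrite mulr_ge0 ?addr_ge0 ?sqr_ge0.
by nra.
Qed.

(** Integrating by parts in the first component leaves a boundary term at 0.
    The boundary condition expresses w(0) by the moment of phi, so that this
    term cancels the coupling mu v(0) of the second component. *)
Lemma graphA_dissipative U F : graphA U F -> re_dotH zeta U F <= 0.
Proof.
move=> [hF [v [dv [w [dw [[[hU Uv hH2] [dv1 w0 dL2 xL2]] FE]]]]]].
have [[vL2 _ _ _] _ [_ _ _ dwL2]] := hH2; have [_ phiL2] := hU.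
set t := trace0 v in dL2 FE *.
have hV : inH ((v, U.2) : state R) by split.
have hF0 : inH ((fun x => - 'i%C * dw x, diffusive U.2 t) : state R).
  by split => //=; apply: L2Z => //; exact: mI.
have -> : re_dotH zeta U F = re_dotH zeta (v, U.2)
    (fun x => - 'i%C * dw x, diffusive U.2 t).
  rewrite (re_dotH_eq zeta hU hV hF) ?(re_dotHC _ (v, U.2)); last first.
    by split => //; apply: aeW.
  by rewrite (re_dotH_eq zeta hF hF0 hV FE).
rewrite re_dotHE /= (H2alpha_boundary_term halpha1 hH2 dv1) -/t.
have := rdot_diffusive_le phiL2 xL2 dL2.
have [-> ->] : Re (w 0) = - zeta * Im (flux_moment U.2) /\
    Im (w 0) = zeta * Re (flux_moment U.2).
  rewrite w0 -/(flux_moment U.2) -mulrA.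
  split; first by rewrite Re_mul Re_scale Im_scale Re_unit Im_unit; ring.
  by rewrite Im_mul Re_scale Im_scale Re_unit Im_unit; ring.
rewrite -(ler_pM2l zeta_gt0).
move: (rdot _ _ _) (zeta) => a b H; lra.
Qed.

Lemma sqint_ae (D : set R) (f g : R -> R) :
  measurable (D : set (measurableTypeR R)) ->
  sqint leb D f -> measurable_fun D g -> f = g %[ae leb in D] -> sqint leb D g.
Proof.
move=> mD [mf fi] mg fg; split => //.
have m2 (h : R -> R) : measurable_fun (D : set (measurableTypeR R)) h ->
    measurable_fun (D : set (measurableTypeR R)) (EFin \o (fun x : R => h x ^+ 2)).
  by move=> mh; apply/measurable_EFinP; exact: measurable_funX.
apply/integrableP; split; first exact: m2.
move/integrableP : fi => [_]; apply: le_lt_trans.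
rewrite le_eqVlt; apply/orP; left; apply/eqP; apply: ge0_ae_eq_integral => //.
- by apply: measurableT_comp => //; exact: m2.
- by apply: measurableT_comp => //; exact: m2.
by apply: ae_imply fg => x h Dx /=; rewrite h.
Qed.

Lemma L2_ae (D : set R) (f g : R -> R[i]) :
  measurable (D : set (measurableTypeR R)) -> L2 D f ->
  measurable_fun D (fun x => Re (g x)) -> measurable_fun D (fun x => Im (g x)) ->
  f = g %[ae leb in D] -> L2 D g.
Proof.
move=> mD /(L2_sqint _ mD)[f1 f2] m1 m2 e; apply/L2_sqint => //; split.
  by apply: sqint_ae f1 _ _ => //; apply: ae_imply e => x h Dx /=; rewrite h.
by apply: sqint_ae f2 _ _ => //; apply: ae_imply e => x h Dx /=; rewrite h.
Qed.

Lemma graphA_eq U U' F F' : graphA U F -> inH U' -> inH F' ->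
  eqH U U' -> eqH F F' -> graphA U' F'.
Proof.
move=> [hF [v [dv [w [dw [[[hU Uv hH2] [dv1 w0 dL2 xL2]] FE]]]]]] hU' hF' eU eF.
have [_ /(L2_sqint _ measurableT)[m1 m2]] := hU'.
have {}m1 := m1.1; have {}m2 := m2.1; have [e1 e2] := eU; have phiL2 := hU.2.
have mw := @measurable_weight R alphat.
have dE : diffusive U.2 (trace0 v) = diffusive U'.2 (trace0 v) %[ae leb in setT].
  by apply: ae_imply e2 => x h Dx; rewrite /Defs.diffusive h.
split => //; exists v, dv, w, dw; split; last first.
  apply: eqH_trans (eqH_sym eF) _; apply: eqH_trans FE _; split => //=.
  by apply: aeW.
split; split => //.
- by apply: ae_imply2 Uv e1 => x h1 h2 Dx; rewrite -h2 ?h1.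
- rewrite w0; congr (_ * _).
  have [f1 f2] := flux_integrable phiL2 xL2.
  have mm1 : measurable_fun setT (fun x : R => mu x * Re (U'.2 x)) by exact: measurable_funM.
  have mm2 : measurable_fun setT (fun x : R => mu x * Im (U'.2 x)) by exact: measurable_funM.
  have [a1 a2] := flux_moment_parts U.2; have [b1 b2] := flux_moment_parts U'.2.
  rewrite -/(flux_moment U.2) -/(flux_moment U'.2).
  apply: complex_ext; rewrite ?a1 ?b1 ?a2 ?b2; congr fine; apply: ae_eq_integral => //.
  + exact: measurable_int f1.
  + exact/measurable_EFinP.
  + by apply: ae_imply e2 => x h Dx /=; rewrite h.
  + exact: measurable_int f2.
  + exact/measurable_EFinP.
  + by apply: ae_imply e2 => x h Dx /=; rewrite h.
- apply: L2_ae dL2 _ _ dE => //.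
    under eq_fun do rewrite (diffusive_parts _ _ _).1.
    apply: measurable_funD; last exact: measurable_funM.
    apply: measurable_funM => //; apply: measurableT_comp => //.
    by apply: measurable_funD => //; exact: measurable_funX.
  under eq_fun do rewrite (diffusive_parts _ _ _).2.
  apply: measurable_funD; last exact: measurable_funM.
  apply: measurable_funM => //; apply: measurableT_comp => //.
  by apply: measurable_funD => //; exact: measurable_funX.
have mn : measurable_fun setT (fun x : R => `|x|) by exact: normr_measurable.
apply: L2_ae xL2 _ _ _ => //.
- by under eq_fun do rewrite Re_scale; exact: measurable_funM.
- by under eq_fun do rewrite Im_scale; exact: measurable_funM.
by apply: ae_imply e2 => x h Dx /=; rewrite h.
Qed.

Lemma L2_comb (D : set R) (a : R[i]) (f g : R -> R[i]) :
  measurable (D : set (measurableTypeR R)) -> L2 D f -> L2 D g ->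
  L2 D (fun x => a * f x + g x).
Proof. by move=> mD hf hg; apply: L2D => //; exact: L2Z. Qed.

Lemma abs_cont_comb (a b c : R) (f g : R -> R[i]) :
  abs_cont a b f -> abs_cont a b g -> abs_cont a b (fun x => c%:C%C * f x + g x).
Proof.
move=> /abs_cont_parts[f1 f2] /abs_cont_parts[g1 g2]; apply/abs_cont_parts.
split.
  have -> : Re \o (fun x => c%:C%C * f x + g x) =
      (fun x => c * (Re \o f) x + (Re \o g) x).
    by apply/funext => x /=; rewrite Re_add Re_scale.
  exact: real_abs_cont_comb.
have -> : Im \o (fun x => c%:C%C * f x + g x) =
    (fun x => c * (Im \o f) x + (Im \o g) x).
  by apply/funext => x /=; rewrite Im_add Im_scale.
exact: real_abs_cont_comb.
Qed.

Lemma ae_derivative_comb (c : R) (f g df dg : R -> R[i]) :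
  ae_derivative f df -> ae_derivative g dg ->
  ae_derivative (fun x => c%:C%C * f x + g x) (fun x => c%:C%C * df x + dg x).
Proof.
apply: ae_imply2 => x hf hg x01.
have [f1 f2] := hf x01; have [g1 g2] := hg x01.
split.
  rewrite Re_add Re_scale; have := is_deriveD (is_deriveZ c f1) g1.
  congr is_derive; apply/funext => y; rewrite /= Re_add Re_scale //.
rewrite Im_add Im_scale; have := is_deriveD (is_deriveZ c f2) g2.
congr is_derive; apply/funext => y; rewrite /= Im_add Im_scale //.
Qed.

Lemma H2alpha_comb (c : R) (v dv w dw v' dv' w' dw' : R -> R[i]) :
  H2alpha alpha v dv w dw -> H2alpha alpha v' dv' w' dw' ->
  H2alpha alpha (fun x => c%:C%C * v x + v' x) (fun x => c%:C%C * dv x + dv' x)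
    (fun x => c%:C%C * w x + w' x) (fun x => c%:C%C * dw x + dw' x).
Proof.
move=> [[a1 a2 a3 a4] a5 [a6 a7 a8 a9]] [[b1 b2 b3 b4] b5 [b6 b7 b8 b9]].
split; [split|move=> x x0 x1|split].
- by apply: L2_comb => //; exact: mI.
- by move=> e e0 e1; apply: abs_cont_comb; [exact: a2|exact: b2].
- exact: ae_derivative_comb.
- have := L2_comb (c%:C%C) mI a4 b4.
  by under eq_fun do rewrite mulrCA -mulrDr.
- by rewrite a5 // b5 //; ring.
- by apply: L2_comb => //; exact: mI.
- exact: abs_cont_comb.
- exact: ae_derivative_comb.
- by apply: L2_comb => //; exact: mI.
Qed.

Lemma trace0_comb (c : R) (v dv w dw v' dv' w' dw' : R -> R[i]) :
  H2alpha alpha v dv w dw -> H2alpha alpha v' dv' w' dw' ->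
  trace0 (fun x => c%:C%C * v x + v' x) = c%:C%C * trace0 v + trace0 v'.
Proof.
move=> h h'.
have [r i] := H2alpha_trace0_cvg halpha1 (H2alpha_comb c h h').
have [r1 i1] := H2alpha_trace0_cvg halpha1 h.
have [r2 i2] := H2alpha_trace0_cvg halpha1 h'.
apply: complex_ext.
  rewrite -(cvg_lim (@Rhausdorff R) r); apply: (cvg_lim (@Rhausdorff R)).
  under eq_fun do rewrite Re_add Re_scale.
  rewrite Re_add Re_scale.
  by apply: cvgD r2; apply: cvgM r1; exact: cvg_cst.
rewrite -(cvg_lim (@Rhausdorff R) i); apply: (cvg_lim (@Rhausdorff R)).
under eq_fun do rewrite Im_add Im_scale.
rewrite Im_add Im_scale.
by apply: cvgD i2; apply: cvgM i1; exact: cvg_cst.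
Qed.

Lemma graphA_comb (c : R) U F U' F' : graphA U F -> graphA U' F' ->
  graphA (c%:C%C *: U + U') (c%:C%C *: F + F').
Proof.
move=> [hF [v [dv [w [dw [[[hU Uv hH2] [dv1 w0 dL2 xL2]] FE]]]]]].
move=> [hF' [v' [dv' [w' [dw' [[[hU' Uv' hH2'] [dv1' w0' dL2' xL2']] FE']]]]]].
have tE := trace0_comb c hH2 hH2'.
have dE : diffusive (c%:C%C *: U + U').2 (trace0 (fun x => c%:C%C * v x + v' x)) =
    (fun x => c%:C%C * diffusive U.2 (trace0 v) x + diffusive U'.2 (trace0 v') x).
  apply/funext => x; rewrite tE /Defs.diffusive.
  have -> : (c%:C%C *: U + U').2 x = c%:C%C * U.2 x + U'.2 x by [].
  by ring.
split; first by apply: inHD => //; exact: inHZ.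
exists (fun x => c%:C%C * v x + v' x), (fun x => c%:C%C * dv x + dv' x),
  (fun x => c%:C%C * w x + w' x), (fun x => c%:C%C * dw x + dw' x).
split; last first.
  rewrite dE; apply: eqH_trans (eqHD (eqHZ _ FE) FE') _; split; apply: aeW => x _ //.
  change (c%:C%C * (- 'i%C * dw x) + - 'i%C * dw' x =
    - 'i%C * (c%:C%C * dw x + dw' x)); by ring.
split; split.
- by apply: inHD => //; exact: inHZ.
- apply: ae_imply2 Uv Uv' => x h h' Dx.
  by rewrite -(h Dx) -(h' Dx).
- exact: H2alpha_comb.
- by rewrite dv1 dv1' mulr0 addr0.
- rewrite w0 w0' -/(flux_moment U.2) -/(flux_moment U'.2) -/(flux_moment _).
  suff -> : flux_moment (c%:C%C *: U + U').2 = c%:C%C * flux_moment U.2 + flux_moment U'.2.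
    by ring.
  have [f1 f2] := flux_integrable hU.2 xL2; have [g1 g2] := flux_integrable hU'.2 xL2'.
  have [a1 a2] := flux_moment_parts U.2; have [b1 b2] := flux_moment_parts U'.2.
  have [k1 k2] := flux_moment_parts (c%:C%C *: U + U').2.
  apply: complex_ext.
    rewrite k1 Re_add Re_scale a1 b1 -RintegralZl // -RintegralD //; last exact: (integrableZl measurableT c f1).
    by apply: eq_Rintegral => x _; rewrite /= Re_add Re_scale; ring.
  rewrite k2 Im_add Im_scale a2 b2 -RintegralZl // -RintegralD //; last exact: (integrableZl measurableT c f2).
  by apply: eq_Rintegral => x _; rewrite /= Im_add Im_scale; ring.
- by rewrite dE; exact: L2_comb.
have := L2_comb (c%:C%C) measurableT xL2 xL2'.
by under eq_fun do rewrite mulrCA -mulrDr.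
Qed.

(** This makes A well defined on classes. If U vanishes almost everywhere, then
    v, being continuous, vanishes on (0, 1), hence so do dv, w and dw, and the
    trace of v. *)
Lemma graphA_single U F : graphA U F -> eqH U 0 -> eqH F 0.
Proof.
move=> [hF [v [dv [w [dw [[[hU Uv hH2] [dv1 w0 dL2 xL2]] FE]]]]]] [U0 p0].
have [[vL2 vac vad _] wE [w2 wac wad dwL2]] := hH2.
have vz : {ae leb, forall x, I01 x -> v x = 0}.
  by apply: ae_imply2 Uv U0 => x h h' Dx; rewrite -h ?h'.
have v1 x : I01 x -> Re (v x) = 0.
  apply: (@abs_cont_ae_zero R (fun x => Re (v x))); last by apply: ae_imply vz => y h /h ->.
  by move=> e e0 e1; have /abs_cont_parts[] := vac e e0 e1.
have v2 x : I01 x -> Im (v x) = 0.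
  apply: (@abs_cont_ae_zero R (fun x => Im (v x))); last by apply: ae_imply vz => y h /h ->.
  by move=> e e0 e1; have /abs_cont_parts[] := vac e e0 e1.
have wz : {ae leb, forall x, I01 x -> w x = 0}.
  apply: ae_imply vad => x h x01; have [d1 d2] := h x01.
  have /I01P/andP[x0 x1] := x01; rewrite wE ?ltW //.
  suff -> : dv x = 0 by rewrite mulr0.
  by apply: complex_ext; [exact: derive_of_zero v1 x01 d1|exact: derive_of_zero v2 x01 d2].
have /abs_cont_parts[wa1 wa2] := wac.
have z1 x : I01 x -> Re (w x) = 0.
  apply: (@abs_cont_ae_zero R (fun x => Re (w x))); last by apply: ae_imply wz => y h /h ->.
  by move=> e e0 e1; exact: real_abs_cont_sub (ltW e0) (lexx 1) wa1.
have z2 x : I01 x -> Im (w x) = 0.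
  apply: (@abs_cont_ae_zero R (fun x => Im (w x))); last by apply: ae_imply wz => y h /h ->.
  by move=> e e0 e1; exact: real_abs_cont_sub (ltW e0) (lexx 1) wa2.
have dwz : {ae leb, forall x, I01 x -> dw x = 0}.
  apply: ae_imply wad => x h x01; have [d1 d2] := h x01.
  by apply: complex_ext; [exact: derive_of_zero z1 x01 d1|exact: derive_of_zero z2 x01 d2].
have t0 : trace0 v = 0.
  have [r i] := H2alpha_trace0_cvg halpha1 hH2.
  have near01 (f : R -> R) : (forall x, I01 x -> f x = 0) -> f x @[x --> 0^'+] --> (0 : R).
    move=> f0; have h : (cst 0 : R -> R) x @[x --> 0^'+] --> (0 : R) by exact: cvg_cst.
    apply: cvg_trans h; apply: near_eq_cvg; near=> x.
    by rewrite /= f0 //; apply/I01P; apply/andP; split.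
  apply: complex_ext.
    by rewrite -(cvg_lim (@Rhausdorff R) r); apply: (cvg_lim (@Rhausdorff R)); exact: near01.
  by rewrite -(cvg_lim (@Rhausdorff R) i); apply: (cvg_lim (@Rhausdorff R)); exact: near01.
apply: eqH_trans FE _; split => /=.
  by apply: ae_imply dwz => x h Dx; rewrite h // mulr0.
by apply: ae_imply p0 => x h Dx; rewrite /Defs.diffusive t0 h // !mulr0 addr0.
Unshelve. all: by end_near. Qed.

End OperatorGraph.

(** * Solving the resolvent equation *)

Section FluxAndLift.
Context {R : realType} (alpha : R) (halpha1 : alpha < 1).
Local Notation leb := (@lebesgue_measure R).
Local Notation I01 := (@I01 R).
Local Notation mI := (@measurable_I01 R).
Implicit Types k : R -> R.

Lemma abs_cont_measurable01 (f : R -> R) :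
  (forall e, 0 < e -> e <= 1 -> real_abs_cont e 1 f) -> measurable_fun I01 f.
Proof.
move=> hf; apply: open_continuous_measurable_fun; first exact: interval_open.
move=> x; rewrite inE => /I01P/andP[x0 x1].
have x2 : 0 < x / 2 by rewrite divr_gt0.
apply/cvgrPdist_le => e e0.
have [|d d0 hd] := hf (x / 2) x2 _ e e0; first by lra.
pose r := Num.min d (Num.min (x / 2) (1 - x)).
have r0 : 0 < r by rewrite !lt_min d0 x2 subr_gt0.
have rE : [/\ r <= d, r <= x / 2 & r <= 1 - x].
  by rewrite /r; split; rewrite ?ge_min ?lexx ?orbT.
have [rd rx r1] := rE.
apply/nbhs_ballP; exists r => // y; rewrite /ball /= => xy.
have {}xy : - r < x - y /\ x - y < r by move: xy; rewrite ltr_norml => /andP[].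
have [yx|xy'] := leP y x.
  have := hd 1%N (fun=> y) (fun=> x); rewrite !big_ord1 => H; apply/ltW; apply: H.
    by split => // k _; split; lra.
  by lra.
have := hd 1%N (fun=> x) (fun=> y); rewrite !big_ord1 => H; rewrite distrC.
apply/ltW; apply: H; last by lra.
by split => // k _; split; lra.
Qed.

Lemma primitive_patchB k k' x : leb.-integrable I01 (EFin \o k) ->
  leb.-integrable I01 (EFin \o k') ->
  primitive ((fun t => k t - k' t) \_ I01) 0 x =
  primitive (k \_ I01) 0 x - primitive (k' \_ I01) 0 x.
Proof.
move=> ki k'i; rewrite /primitive -RintegralB //.
- by apply: eq_Rintegral => t _; rewrite !patchE; case: ifP => // _; rewrite subr0.
- by apply: integrable_sub ((integrable_patch _ mI).1 ki).
by apply: integrable_sub ((integrable_patch _ mI).1 k'i).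
Qed.

Lemma Rintegral_norm_patch k : \int[leb]_t `|(k \_ I01) t| = \int[leb]_(t in I01) `|k t|.
Proof.
rewrite [RHS]Rintegral_mkcond; apply: eq_Rintegral => t _; rewrite !patchE.
by case: ifP => // _; rewrite normr0.
Qed.

(** The solution of w' = - k on (0, 1) with w(1) = 0. *)
Definition tail k (x : R) : R := primitive (k \_ I01) 0 1 - primitive (k \_ I01) 0 x.

(** The solution of x^alpha v' = tail k with v(0) = 0. *)
Definition profile_integrand k (x : R) : R := x `^ (- alpha) * tail k x.
Definition profile k (x : R) : R := primitive (profile_integrand k \_ I01) 0 x.

Lemma primitive_patch1 k : primitive (k \_ I01) 0 1 = \int[leb]_(t in I01) k t.
Proof. by rewrite /primitive -Rintegral_mkcondr setIidr //; exact: subset_itv_oo_cc. Qed.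

Lemma tail1 k : tail k 1 = 0. Proof. by rewrite /tail subrr. Qed.

Lemma tail0 k : tail k 0 = \int[leb]_(t in I01) k t.
Proof. by rewrite /tail primitive0 subr0 primitive_patch1. Qed.

Section Integrable.
Variable k : R -> R.
Hypothesis ki : leb.-integrable I01 (EFin \o k).
Let Gi := (integrable_patch _ mI).1 ki.

Lemma tail_abs_cont : real_abs_cont 0 1 (tail k).
Proof. exact: real_abs_contB (real_abs_cont_cst _ _ _) (primitive_abs_cont 0 Gi 1). Qed.

Lemma tail_derivative : ae_derivative_on01 (tail k) (fun x => - k x).
Proof.
apply: ae_imply (primitive_derive 0 Gi) => x h x01.
have /I01P/andP[x0 x1] := x01.
have := is_deriveB (is_derive_cst (primitive (k \_ I01) 0 1) x 1) (h x0).
by rewrite sub0r patchE mem_set.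
Qed.

Lemma tail_bound x : `|tail k x| <= 2 * \int[leb]_(t in I01) `|k t|.
Proof.
rewrite -Rintegral_norm_patch mulr_natl mulr2n (le_trans (ler_normB _ _)) // lerD //.
  exact: primitive_bounded.
exact: primitive_bounded.
Qed.

Lemma tail_measurable : measurable_fun I01 (tail k).
Proof.
apply: abs_cont_measurable01 => e e0 e1.
exact: real_abs_cont_sub (ltW e0) (lexx 1) tail_abs_cont.
Qed.

Lemma powR_tail_measurable (p : R) : measurable_fun I01 (fun x => x `^ p * tail k x).
Proof.
apply: measurable_funM; last exact: tail_measurable.
by apply: measurable_funTS; exact: measurable_powR.
Qed.

Lemma profile_integrandi : leb.-integrable I01 (EFin \o (profile_integrand k)).
Proof.
have pa : -1 < - alpha by rewrite ltrN2.
have := integrableZl mI (2 * \int[leb]_(t in I01) `|k t|) (powR_integrable01 pa).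
apply: le_integrable; first exact: mI.
  by apply/measurable_EFinP; exact: powR_tail_measurable.
move=> x _ /=; rewrite lee_fin /profile_integrand !normrM mulrC ler_wpM2r //.
by rewrite -normrM (le_trans (tail_bound x)) // ler_norm.
Qed.

Let Li := (integrable_patch _ mI).1 profile_integrandi.

Lemma profile_abs_cont : real_abs_cont 0 1 (profile k).
Proof. exact: primitive_abs_cont. Qed.

Lemma profile_derivative : ae_derivative_on01 (profile k) (profile_integrand k).
Proof.
apply: ae_imply (primitive_derive 0 Li) => x h x01.
have /I01P/andP[x0 x1] := x01.
by have := h x0; rewrite patchE mem_set.
Qed.

Lemma profile_cvg0 : profile k x @[x --> 0^'+] --> (0 : R).
Proof. exact: primitive_cvg_right. Qed.

Lemma profile_measurable : measurable_fun I01 (profile k).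
Proof.
apply: abs_cont_measurable01 => e e0 e1.
exact: real_abs_cont_sub (ltW e0) (lexx 1) profile_abs_cont.
Qed.

Lemma profile_bound x : `|profile k x| <=
  2 * (\int[leb]_(t in I01) `|k t|) * \int[leb]_(t in I01) (t `^ (- alpha)).
Proof.
rewrite (le_trans (primitive_bounded 0 Li x)) // Rintegral_norm_patch.
have pa : -1 < - alpha by rewrite ltrN2.
rewrite -RintegralZl //; [|exact: mI|exact: powR_integrable01].
apply: le_Rintegral; first exact: mI.
- exact: (integrable_norm profile_integrandi).
- exact: (integrableZl mI _ (powR_integrable01 pa)).
move=> t _; rewrite /profile_integrand normrM (ger0_norm (powR_ge0 _ _)) mulrC.
by rewrite ler_wpM2r ?powR_ge0 // tail_bound.
Qed.

End Integrable.

Lemma profileB k k' x : leb.-integrable I01 (EFin \o k) ->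
  leb.-integrable I01 (EFin \o k') ->
  profile k x - profile k' x = profile (fun t => k t - k' t) x.
Proof.
move=> ki k'i.
rewrite /profile -primitive_patchB; [|exact: profile_integrandi..].
congr (primitive (_ \_ _) 0 x); apply/funext => t.
rewrite /profile_integrand /tail !primitive_patchB //; ring.
Qed.

(** The Cauchy-Schwarz inequality against the constant 1. *)
Lemma L1_le_L2 k : sqint leb I01 k ->
  (\int[leb]_(t in I01) `|k t|) ^+ 2 <= \int[leb]_(t in I01) (k t ^+ 2).
Proof.
move=> hk; set m := \int[leb]_(t in I01) `|k t|.
have ki := integrable_norm (sqint_integrable01 hk).
have c1 : leb.-integrable I01 (EFin \o (fun=> m ^+ 2)).
  by apply: (@bounded_integrable01 R _ `|m ^+ 2|) => //.
have kim := integrableZl mI (2 * m) ki.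
have : 2 * m * m <= \int[leb]_(t in I01) (k t ^+ 2) + m ^+ 2.
  rewrite -[X in _ * X]/(\int[leb]_(t in I01) `|k t|) -RintegralZl //; last exact: mI.
  rewrite -[X in _ + X]Rintegral_cst01 -RintegralD //; [|exact: mI|exact: hk.2].
  apply: le_Rintegral; first exact: mI.
  - exact: kim.
  - exact: (integrableD mI hk.2 c1).
  move=> t _; have := sqr_ge0 (`|k t| - m).
  have : `|k t| ^+ 2 = k t ^+ 2 by rewrite real_normK ?num_real.
  by nra.
by move=> h; nra.
Qed.

End FluxAndLift.

Section DiffusiveResolvent.
Context {R : realType} (alphat eta : R)
    (halphat0 : 0 < alphat) (halphat1 : alphat < 1) (heta : 0 <= eta).
Local Notation leb := (@lebesgue_measure R).
Local Notation mu := (weight alphat).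
Implicit Types lam : R.

Definition symbol lam (xi : R) : R := lam + eta + xi ^+ 2.

Lemma symbol_gt0 lam xi : 0 < lam -> 0 < symbol lam xi.
Proof. by move=> l0; rewrite /symbol -addrA ltr_wpDr // addr_ge0 ?sqr_ge0. Qed.

(** All the bounds come from lam (1 + |xi|)^2 <= 2 (lam + eta + xi^2). *)
Lemma symbol_ge lam xi : 0 < lam -> lam <= 1 ->
  [/\ lam <= symbol lam xi, 1 + `|xi| <= 2 / lam * symbol lam xi,
      `|xi| <= 2 / lam * symbol lam xi &
      `|xi| * (1 + `|xi|) <= 2 / lam * symbol lam xi].
Proof.
move=> l0 l1.
have key (n : R) : (1 + n) ^+ 2 * lam <= 2 * (lam + eta + n ^+ 2).
  have h1 : 0 <= lam * (1 - n) ^+ 2 by rewrite mulr_ge0 ?sqr_ge0 // ltW.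
  have h2 : 0 <= (1 - lam) * n ^+ 2 by rewrite mulr_ge0 ?sqr_ge0 // subr_ge0.
  rewrite -subr_ge0.
  have -> : 2 * (lam + eta + n ^+ 2) - (1 + n) ^+ 2 * lam =
    lam * (1 - n) ^+ 2 + 2 * ((1 - lam) * n ^+ 2) + 2 * eta by ring.
  by rewrite !addr_ge0 // mulr_ge0.
have h : (1 + `|xi|) ^+ 2 <= 2 / lam * symbol lam xi.
  by rewrite mulrAC ler_pdivlMr // /symbol -[xi ^+ 2]real_normK ?num_real.
have x0 : 0 <= `|xi| by [].
split.
- by rewrite /symbol -addrA lerDl addr_ge0 ?sqr_ge0.
- by apply: le_trans h; nra.
- by apply: le_trans h; nra.
by apply: le_trans h; nra.
Qed.

Lemma measurable_symbolV lam : 0 < lam -> measurable_fun setT (fun xi : R => (symbol lam xi)^-1).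
Proof.
move=> l0.
have -> : (fun xi : R => (symbol lam xi)^-1) = (fun xi : R => symbol lam xi `^ (-1)).
  by apply/funext => x; rewrite powR_inv1 // ltW // symbol_gt0.
apply: (measurableT_comp (measurable_powR _)).
by apply: measurable_funD => //; exact: measurable_funX.
Qed.

Lemma sqint_weight_symbol lam : 0 < lam -> lam <= 1 ->
  sqint leb setT (fun xi => mu xi / symbol lam xi) /\
  sqint leb setT (fun xi => `|xi| * (mu xi / symbol lam xi)).
Proof.
move=> l0 l1; have wL2 := sqint_weight halphat0 halphat1.
have := sqintZ measurableT (2 / lam) wL2.
have m1 : measurable_fun setT (fun xi : R => mu xi / symbol lam xi).
  by apply: measurable_funM; [exact: measurable_weight|exact: measurable_symbolV].
have mn : measurable_fun setT (fun x : R => `|x|) by exact: normr_measurable.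
have bnd xi (c : R) : 0 <= c -> c * (1 + `|xi|) <= 2 / lam * symbol lam xi ->
    c * (mu xi / symbol lam xi) <= 2 / lam * (mu xi / (1 + `|xi|)).
  move=> c0 h; have d0 := symbol_gt0 xi l0.
  have n0 : 0 < 1 + `|xi| by rewrite ltr_wpDr.
  have -> : c * (mu xi / symbol lam xi) = mu xi * (c / symbol lam xi) by ring.
  have -> : 2 / lam * (mu xi / (1 + `|xi|)) = mu xi * (2 / lam / (1 + `|xi|)) by ring.
  rewrite ler_wpM2l ?powR_ge0 // ler_pdivlMr // mulrAC ler_pdivrMr //.
have nonneg xi : 0 <= mu xi / symbol lam xi.
  by rewrite divr_ge0 ?powR_ge0 // ltW // symbol_gt0.
have nonneg' xi : 0 <= 2 / lam * (mu xi / (1 + `|xi|)).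
  by rewrite mulr_ge0 ?divr_ge0 ?powR_ge0 // ltW.
move=> H0; split.
  apply: sqint_le H0 _ => // xi _; have [_ h _ _] := symbol_ge xi l0 l1.
  by rewrite (ger0_norm (nonneg xi)) (ger0_norm (nonneg' xi)) -[leLHS]mul1r bnd // mul1r.
apply: sqint_le H0 _ => //; first exact: measurable_funM.
move=> xi _; have [_ _ _ h] := symbol_ge xi l0 l1.
rewrite (ger0_norm (nonneg' xi)) ger0_norm; last by rewrite mulr_ge0.
by rewrite bnd.
Qed.

Lemma sqint_symbolV lam (f : R -> R) : 0 < lam -> lam <= 1 -> sqint leb setT f ->
  sqint leb setT (fun xi => (symbol lam xi)^-1 * f xi) /\
  sqint leb setT (fun xi => `|xi| * ((symbol lam xi)^-1 * f xi)).
Proof.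
move=> l0 l1 hf; have H0 := sqintZ measurableT (2 / lam) hf.
have m1 : measurable_fun setT (fun xi : R => (symbol lam xi)^-1 * f xi).
  by apply: measurable_funM; [exact: measurable_symbolV|exact: hf.1].
have mn : measurable_fun setT (fun x : R => `|x|) by exact: normr_measurable.
have bnd xi (c : R) : 0 <= c -> c <= 2 / lam * symbol lam xi ->
    `|c * ((symbol lam xi)^-1 * f xi)| <= `|2 / lam * f xi|.
  move=> c0 h; have d0 := symbol_gt0 xi l0.
  rewrite mulrA !normrM ler_wpM2r // -normrM ger0_norm; last first.
    by rewrite divr_ge0 // ltW.
  by rewrite -normrM (le_trans _ (ler_norm _)) // ler_pdivrMr.
split.
  apply: sqint_le H0 _ => // xi _; have [_ h _ _] := symbol_ge xi l0 l1.
  by rewrite -[(symbol _ _)^-1 * _]mul1r bnd // (le_trans _ h) // lerDl.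
apply: sqint_le H0 _ => //; first exact: measurable_funM.
by move=> xi _; have [_ _ h _] := symbol_ge xi l0 l1; rewrite bnd.
Qed.

(** The solution of (lam + eta + xi^2) phi = g + mu c. *)
Definition diffusive_solution lam (g : R -> R[i]) (c : R[i]) (xi : R) : R[i] :=
  ((symbol lam xi)^-1)%:C%C * (g xi + (mu xi)%:C%C * c).

Lemma diffusive_solution_parts lam g c xi :
  Re (diffusive_solution lam g c xi) =
    (symbol lam xi)^-1 * Re (g xi) + (mu xi / symbol lam xi) * Re c /\
  Im (diffusive_solution lam g c xi) =
    (symbol lam xi)^-1 * Im (g xi) + (mu xi / symbol lam xi) * Im c.
Proof.
rewrite /diffusive_solution Re_scale Im_scale Re_add Im_add Re_scale Im_scale.
by split; ring.
Qed.

Lemma diffusive_solution_L2 lam g c : 0 < lam -> lam <= 1 -> L2 setT g ->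
  L2 setT (diffusive_solution lam g c) /\
  L2 setT (fun xi => `|xi|%:C%C * diffusive_solution lam g c xi).
Proof.
move=> l0 l1 /(L2_sqint _ measurableT)[g1 g2].
have [w1 w2] := sqint_weight_symbol l0 l1.
have [a1 b1] := sqint_symbolV l0 l1 g1; have [a2 b2] := sqint_symbolV l0 l1 g2.
have comb (f k : R -> R) (x : R) : sqint leb setT f -> sqint leb setT k ->
    sqint leb setT (fun xi => f xi + k xi * x).
  move=> hf hk; apply: sqintD => //; have := sqintZ measurableT x hk.
  by under eq_fun do rewrite mulrC.
split; apply/(L2_sqint _ measurableT); split.
- under eq_fun do rewrite (diffusive_solution_parts _ _ _ _).1; exact: comb.
- under eq_fun do rewrite (diffusive_solution_parts _ _ _ _).2; exact: comb.
- under eq_fun do rewrite Re_scale (diffusive_solution_parts _ _ _ _).1 mulrDr mulrA.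
  have := comb _ _ (Re c) b1 w2; congr sqint; apply/funext => xi; ring.
under eq_fun do rewrite Im_scale (diffusive_solution_parts _ _ _ _).2 mulrDr mulrA.
have := comb _ _ (Im c) b2 w2; congr sqint; apply/funext => xi; ring.
Qed.

Lemma diffusive_solutionE lam g c xi : 0 < lam ->
  diffusive alphat eta (diffusive_solution lam g c) c xi =
  lam%:C%C * diffusive_solution lam g c xi - g xi.
Proof.
move=> l0; have d0 : symbol lam xi != 0 by rewrite gt_eqF // symbol_gt0.
have [r i] := diffusive_parts alphat eta (diffusive_solution lam g c) c xi.
have [rs is_] := diffusive_solution_parts lam g c xi.
have RR : Re (lam%:C%C * diffusive_solution lam g c xi - g xi) =
    lam * Re (diffusive_solution lam g c xi) - Re (g xi).
  by rewrite Re_add Re_opp (Re_scale lam).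
have II : Im (lam%:C%C * diffusive_solution lam g c xi - g xi) =
    lam * Im (diffusive_solution lam g c xi) - Im (g xi).
  by rewrite Im_add Im_opp (Im_scale lam).
apply: complex_ext; rewrite ?r ?RR ?i ?II ?rs ?is_ /symbol; rewrite /symbol in d0;
  by field.
Qed.

(** The slope of the moment of diffusive_solution as an affine function of the
    boundary value c. *)
Definition impedance lam : R := \int[leb]_xi (mu xi * (mu xi / symbol lam xi)).

Lemma impedance_integrable lam : 0 < lam -> lam <= 1 ->
  leb.-integrable setT (EFin \o (fun xi => mu xi * (mu xi / symbol lam xi))).
Proof.
move=> l0 l1; have [w1 w2] := sqint_weight_symbol l0 l1.
exact: weight_pairing_integrable.
Qed.

Lemma impedance_mono lam : 0 < lam -> lam <= 1 -> impedance 1 <= impedance lam.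
Proof.
move=> l0 l1; apply: le_Rintegral => //.
- exact: impedance_integrable.
- exact: impedance_integrable.
move=> xi _; rewrite ler_wpM2l ?powR_ge0 // ler_wpM2l ?powR_ge0 //.
by rewrite lef_pV2 ?posrE ?symbol_gt0 // /symbol !lerD2r.
Qed.

Lemma impedance_gt0 : 0 < impedance 1.
Proof.
have [w1 w2] := sqint_weight_symbol ltr01 (lexx 1).
have s1 (xi : R) : 1 <= symbol 1 xi by rewrite /symbol -addrA lerDl addr_ge0 ?sqr_ge0.
have s0 (xi : R) : 0 < symbol 1 xi by exact: lt_le_trans (s1 xi).
have le0 : 0 <= impedance 1.
  by apply: Rintegral_ge0 => xi _; rewrite !mulr_ge0 ?powR_ge0 // invr_ge0 ltW.
rewrite lt_neqAle le0 andbT eq_sym; apply/eqP => z.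
have z2 : \int[leb]_xi ((mu xi / symbol 1 xi) ^+ 2) = 0.
  apply/eqP; rewrite eq_le Rintegral_sqr_ge0 andbT -z.
  apply: le_Rintegral => //; [exact: w1.2|exact: impedance_integrable|].
  move=> xi _; rewrite expr2 ler_wpM2r ?divr_ge0 ?powR_ge0 ?(ltW (s0 xi)) //.
  by rewrite ler_pdivrMr // ler_peMr // powR_ge0.
have [B [mB B0 hB]] := sqint_null measurableT w1 z2.
have sub : `]0%R, 1%R[%classic `<=` B.
  move=> x; rewrite /= in_itv /= => /andP[x0 _]; apply: hB => /= /(_ I) /eqP.
  rewrite mulf_eq0 invr_eq0 (gt_eqF (s0 x)) orbF /weight.
  by rewrite gt_eqF // powR_gt0 // normr_gt0 gt_eqF.
have : (leb `]0%R, 1%R[ <= leb B)%E by apply: le_measure; rewrite ?inE.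
by rewrite B0 lebesgue_measure_itv /= lte_fin ltr01 -EFinB lee_fin subr0 ler10.
Qed.

(** The moment of diffusive_solution for c = 0. *)
Definition source_moment lam (g : R -> R[i]) : R[i] :=
  flux_moment alphat (fun xi => ((symbol lam xi)^-1)%:C%C * g xi).

Lemma flux_moment_solution lam g c : 0 < lam -> lam <= 1 -> L2 setT g ->
  flux_moment alphat (diffusive_solution lam g c) =
  source_moment lam g + (impedance lam)%:C%C * c.
Proof.
move=> l0 l1 /(L2_sqint _ measurableT)[g1 g2].
have [a1 b1] := sqint_symbolV l0 l1 g1; have [a2 b2] := sqint_symbolV l0 l1 g2.
have [k1 k2] := flux_moment_parts alphat (diffusive_solution lam g c).
have [m1 m2] := flux_moment_parts alphat (fun xi => ((symbol lam xi)^-1)%:C%C * g xi).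
have i1 := weight_pairing_integrable halphat0 halphat1 a1 b1.
have i2 := weight_pairing_integrable halphat0 halphat1 a2 b2.
have iw := impedance_integrable l0 l1.
apply: complex_ext.
  rewrite k1 Re_add Re_scale m1 /impedance -RintegralZr //.
  have -> : (fun xi : R => mu xi * Re (((symbol lam xi)^-1)%:C%C * g xi)) =
    (fun xi : R => mu xi * ((symbol lam xi)^-1 * Re (g xi))).
    by apply/funext => xi; rewrite Re_scale.
  rewrite -RintegralD //; last exact: (integrableZr measurableT (Re c) iw).
  apply: eq_Rintegral => xi _.
  by rewrite (diffusive_solution_parts _ _ _ _).1; ring.
rewrite k2 Im_add Im_scale m2 /impedance -RintegralZr //.
have -> : (fun xi : R => mu xi * Im (((symbol lam xi)^-1)%:C%C * g xi)) =
  (fun xi : R => mu xi * ((symbol lam xi)^-1 * Im (g xi))).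
  by apply/funext => xi; rewrite Im_scale.
rewrite -RintegralD //; last exact: (integrableZr measurableT (Im c) iw).
apply: eq_Rintegral => xi _.
by rewrite (diffusive_solution_parts _ _ _ _).2; ring.
Qed.

End DiffusiveResolvent.

Section ResolventEquation.
Context {R : realType} (alpha alphat rho eta : R)
    (halpha0 : 0 < alpha) (halpha1 : alpha < 1)
    (halphat0 : 0 < alphat) (halphat1 : alphat < 1)
    (hrho : 0 < rho) (heta : 0 <= eta).
Local Notation leb := (@lebesgue_measure R).
Local Notation I01 := (@I01 R).
Local Notation mI := (@measurable_I01 R).
Local Notation graphA := (graphA alpha alphat rho eta).
Local Notation zeta := (zeta alphat rho).
Local Notation mu := (weight alphat).

Local Notation profile := (profile alpha).

Section Solution.
Variables (lam : R) (f g : R -> R[i]).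
Hypotheses (lam0 : 0 < lam) (lam1 : lam <= 1) (hf : L2 I01 f) (hg : L2 setT g).
Implicit Types v : R -> R[i].

(** In the first component i w' + lam u = f of the resolvent equation, the zero
    order term is frozen at u = v, so that i w' = res_source v. *)
Definition res_source v (x : R) : R[i] := f x - lam%:C%C * v x.

Local Notation kr v := (fun x => Re (res_source v x)).
Local Notation ki v := (fun x => Im (res_source v x)).

Definition trace_part (k : R) (m : R) : R :=
  (k / zeta - m) / impedance alphat eta lam.

(** The value c = v(0) forced by w(0) = i zeta int mu phi when phi is
    diffusive_solution with that c: the moment of phi is affine in c with slope
    the impedance. *)
Definition res_trace v : R[i] := Complex
  (trace_part (\int[leb]_(t in I01) kr v t) (Re (source_moment alphat eta lam g)))
  (trace_part (\int[leb]_(t in I01) ki v t) (Im (source_moment alphat eta lam g))).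

(** The solution w of i w' = res_source v with w(1) = 0. *)
Definition res_flux v (x : R) : R[i] := Complex (- tail (ki v) x) (tail (kr v) x).

(** The solution of x^alpha u' = res_flux v with u(0) = res_trace v. *)
Definition res_state v (x : R) : R[i] :=
  Complex (Re (res_trace v) - profile (ki v) x) (Im (res_trace v) + profile (kr v) x).

Definition res_derivative v (x : R) : R[i] := (x `^ (- alpha))%:C%C * res_flux v x.

Lemma res_source_L2 v : L2 I01 v -> L2 I01 (res_source v).
Proof.
move=> hv; have := L2D mI hf (L2Z (- lam%:C%C) mI hv).
by under eq_fun do rewrite mulNr.
Qed.

Lemma res_source_sqint v : L2 I01 v -> sqint leb I01 (kr v) /\ sqint leb I01 (ki v).
Proof. by move=> /res_source_L2/(L2_sqint _ mI). Qed.

Lemma bounded_L2 (u : R -> R[i]) (M : R) :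
  measurable_fun I01 (fun x => Re (u x)) -> measurable_fun I01 (fun x => Im (u x)) ->
  (forall x, I01 x -> `|Re (u x)| <= M /\ `|Im (u x)| <= M) -> L2 I01 u.
Proof.
move=> m1 m2 hM; apply/(L2_sqint _ mI); split; apply: (@bounded_sqint01 R _ M) => // x x01;
  by have [] := hM x x01.
Qed.

Lemma res_state_L2 v : L2 I01 v -> L2 I01 (res_state v).
Proof.
move=> /res_source_sqint[/sqint_integrable01 k1 /sqint_integrable01 k2].
set A := \int[leb]_(t in I01) (t `^ (- alpha)).
pose M1 := `|Re (res_trace v)| + 2 * (\int[leb]_(t in I01) `|ki v t|) * A.
pose M2 := `|Im (res_trace v)| + 2 * (\int[leb]_(t in I01) `|kr v t|) * A.
apply: (@bounded_L2 _ (`|M1| + `|M2|)).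
- by apply: measurable_funB => //; exact: profile_measurable.
- by apply: measurable_funD => //; exact: profile_measurable.
move=> x _ /=; split.
  rewrite (le_trans (ler_normB _ _)) // (@le_trans _ _ M1) ?lerD2l ?profile_bound //.
  by rewrite (le_trans (ler_norm _)) // lerDl.
rewrite (le_trans (ler_normD _ _)) // (@le_trans _ _ M2) ?lerD2l ?profile_bound //.
by rewrite (le_trans (ler_norm _)) // lerDr.
Qed.

Lemma weighted_tail_sqint (k : R -> R) : leb.-integrable I01 (EFin \o k) ->
  sqint leb I01 (fun x => x `^ (alpha / 2) * (x `^ (- alpha) * tail k x)).
Proof.
move=> hk; set M := 2 * \int[leb]_(t in I01) `|k t|.
have pE : sqint leb I01 (fun x => M * x `^ (- (alpha / 2))).
  by apply: sqintZ; [exact: mI|apply: sqint_powR01; rewrite mulrN mulrC divfK // ltrN2].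
apply: sqint_le pE _; first exact: mI.
  apply: measurable_funM; last exact: powR_tail_measurable.
  by apply: measurable_funTS; exact: measurable_powR.
move=> x /I01P/andP[x0 _]; rewrite mulrA -powRD; last by apply/implyP => _; rewrite gt_eqF.
have -> : alpha / 2 + - alpha = - (alpha / 2) by lra.
rewrite mulrC !normrM ler_wpM2r // (le_trans (tail_bound hk x)) //.
by rewrite -normrM ler_norm.
Qed.

Lemma res_H2alpha v : L2 I01 v ->
  H2alpha alpha (res_state v) (res_derivative v) (res_flux v)
    (fun x => - 'i%C * res_source v x).
Proof.
move=> hv; have [/sqint_integrable01 k1 /sqint_integrable01 k2] := res_source_sqint hv.
split; first split.
- exact: res_state_L2.
- move=> e e0 e1; apply/abs_cont_parts; split.
    apply: real_abs_contB (real_abs_cont_cst _ _ _) _.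
    exact: real_abs_cont_sub (ltW e0) (lexx 1) (profile_abs_cont halpha1 k2).
  apply: real_abs_contD (real_abs_cont_cst _ _ _) _.
  exact: real_abs_cont_sub (ltW e0) (lexx 1) (profile_abs_cont halpha1 k1).
- apply: ae_imply2 (profile_derivative halpha1 k2) (profile_derivative halpha1 k1).
  move=> x h1 h2 x01; split.
    have := is_deriveB (is_derive_cst (Re (res_trace v)) x 1) (h1 x01).
    by rewrite /res_derivative Re_scale /= mulrN sub0r.
  have := is_deriveD (is_derive_cst (Im (res_trace v)) x 1) (h2 x01).
  by rewrite /res_derivative Im_scale /= add0r.
- apply/(L2_sqint _ mI); split.
    have := sqintN mI (weighted_tail_sqint k2); congr sqint; apply/funext => x.
    by rewrite Re_scale /res_derivative Re_scale /= !mulrN.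
  have := weighted_tail_sqint k1; congr sqint; apply/funext => x.
  by rewrite Im_scale /res_derivative Im_scale.
- move=> x x0 x1; rewrite /res_derivative mulrA -rmorphM /= -powRD; last first.
    by apply/implyP => _; rewrite gt_eqF.
  by rewrite addrN powRr0 rmorph1 mul1r.
split.
- apply: (@bounded_L2 _ (`|2 * (\int[leb]_(t in I01) `|ki v t|)| +
    `|2 * (\int[leb]_(t in I01) `|kr v t|)|)).
  + by apply: measurableT_comp => //; exact: tail_measurable.
  + exact: tail_measurable.
  move=> x _ /=; rewrite normrN; split.
    by rewrite (le_trans (tail_bound k2 x)) // (le_trans (ler_norm _)) // lerDl.
  by rewrite (le_trans (tail_bound k1 x)) // (le_trans (ler_norm _)) // lerDr.
- apply/abs_cont_parts; split; last exact: tail_abs_cont.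
  have := real_abs_contB (real_abs_cont_cst 0 1 0) (tail_abs_cont k2).
  by under eq_fun do rewrite sub0r.
- apply: ae_imply2 (tail_derivative k2) (tail_derivative k1) => x h1 h2 x01; split.
    have := is_deriveN (h1 x01); congr is_derive.
    by rewrite Re_mul Re_opp Im_opp Re_unit Im_unit; ring.
  have := h2 x01; congr is_derive.
  by rewrite Im_mul Re_opp Im_opp Re_unit Im_unit; ring.
by apply: L2Z; [exact: mI|exact: res_source_L2].
Qed.

Lemma res_trace0 v : L2 I01 v -> trace0 (res_state v) = res_trace v.
Proof.
move=> hv; have [/sqint_integrable01 k1 /sqint_integrable01 k2] := res_source_sqint hv.
have [r i] := H2alpha_trace0_cvg halpha1 (res_H2alpha hv).
apply: complex_ext.
  rewrite -(cvg_lim (@Rhausdorff R) r); apply: (cvg_lim (@Rhausdorff R)).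
  rewrite -[X in _ --> X]subr0; apply: cvgB; [exact: cvg_cst|exact: profile_cvg0].
rewrite -(cvg_lim (@Rhausdorff R) i); apply: (cvg_lim (@Rhausdorff R)).
rewrite -[X in _ --> X]addr0; apply: cvgD; [exact: cvg_cst|exact: profile_cvg0].
Qed.

Lemma res_flux0 v : L2 I01 v -> res_flux v 0 = 'i%C * zeta%:C%C *
  flux_moment alphat (diffusive_solution alphat eta lam g (res_trace v)).
Proof.
move=> hv; rewrite flux_moment_solution // -mulrA /res_flux !tail0.
have z0 : zeta != 0 by rewrite gt_eqF // zeta_gt0.
have c0 : impedance alphat eta lam != 0.
  by rewrite gt_eqF // (lt_le_trans (impedance_gt0 halphat0 halphat1 heta)) // impedance_mono.
have key (k m : R) : k = zeta * (m + impedance alphat eta lam * trace_part k m).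
  rewrite /trace_part; move: z0 c0; move: (zeta) (impedance _ _ _) => z c z0 c0; field; by rewrite ?z0 ?c0.
apply: complex_ext.
  rewrite Re_mul Re_scale Im_scale Re_unit Im_unit Im_add Im_scale mul0r sub0r mul1r.
  by rewrite -key.
by rewrite Im_mul Re_scale Im_scale Re_unit Im_unit Re_add Re_scale mul0r add0r mul1r -key.
Qed.

Lemma graphA_resolvent v : L2 I01 v -> res_state v = v %[ae leb in I01] ->
  let phi := diffusive_solution alphat eta lam g (res_trace v) in
  graphA (res_state v, phi)
    (fun x => lam%:C%C * res_state v x - f x, fun xi => lam%:C%C * phi xi - g xi).
Proof.
move=> hv vE phi; have [phi1 phi2] : L2 setT phi /\ L2 setT (fun xi => `|xi|%:C%C * phi xi).
  exact: diffusive_solution_L2.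
have sL2 := res_state_L2 hv; have tE := res_trace0 hv.
have dE : diffusive alphat eta phi (res_trace v) = (fun xi => lam%:C%C * phi xi - g xi).
  by apply/funext => xi; rewrite diffusive_solutionE.
have L2B D (a : R[i]) (p r : R -> R[i]) : measurable (D : set (measurableTypeR R)) ->
    L2 D p -> L2 D r -> L2 D (fun x => a * p x - r x).
  move=> mD hp hr; have := L2D mD (L2Z a mD hp) (L2Z (-1) mD hr).
  by under eq_fun do rewrite mulN1r.
split.
  by split => /=; apply: L2B => //; exact: mI.
exists (res_state v), (res_derivative v), (res_flux v), (fun x => - 'i%C * res_source v x).
split; last first.
  rewrite tE dE; split => /=; last by apply: aeW.
  apply: ae_imply vE => x h Dx; rewrite h // /res_source.
  by rewrite mulrA mulrNN -expr2 sqr_i mulN1r opprB.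
split; split => //.
- by apply: aeW.
- exact: res_H2alpha.
- rewrite /res_derivative /res_flux !tail1 oppr0.
  by apply: complex_ext; rewrite ?Re_scale ?Im_scale mulr0.
- exact: res_flux0.
by rewrite tE dE; apply: L2B.
Qed.

Definition res_bound : R :=
  (zeta * impedance alphat eta 1)^-1 + 2 * \int[leb]_(t in I01) (t `^ (- alpha)).

(** A change of v changes the source by lam times it, and both the trace and
    the profile depend on the source through its L^1 norm. *)
Lemma res_part_lipschitz (k k' d : R -> R) (m M x : R) :
  leb.-integrable I01 (EFin \o k) -> leb.-integrable I01 (EFin \o k') ->
  sqint leb I01 d -> (forall t, k t - k' t = - lam * d t) ->
  0 <= M -> \int[leb]_(t in I01) (d t ^+ 2) <= M ^+ 2 ->
  `|trace_part (\int[leb]_(t in I01) k t) m - trace_part (\int[leb]_(t in I01) k' t) m|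
    <= lam * M * (zeta * impedance alphat eta 1)^-1 /\
  `|profile k x - profile k' x| <= lam * M * (2 * \int[leb]_(t in I01) (t `^ (- alpha))).
Proof.
move=> hk hk' hd kE M0 hM.
have dM : \int[leb]_(t in I01) `|d t| <= M.
  rewrite -(@ler_pXn2r _ 2) ?nnegrE ?Rintegral_ge0 //.
  exact: le_trans (L1_le_L2 hd) hM.
have kkE : \int[leb]_(t in I01) `|k t - k' t| <= lam * M.
  have -> : \int[leb]_(t in I01) `|k t - k' t| = lam * \int[leb]_(t in I01) `|d t|.
    rewrite -RintegralZl; [|exact: mI|exact: (integrable_norm (sqint_integrable01 hd))].
    by apply: eq_Rintegral => t _; rewrite kE normrM normrN (gtr0_norm lam0).
  by rewrite ler_wpM2l // ltW.
have hkk : leb.-integrable I01 (EFin \o (fun t => k t - k' t)).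
  exact: (integrableB mI hk hk').
have A0 : 0 <= \int[leb]_(t in I01) (t `^ (- alpha)).
  by apply: Rintegral_ge0 => t _; exact: powR_ge0.
have z0 := zeta_gt0 halphat0 halphat1 hrho.
have i1 := impedance_gt0 halphat0 halphat1 heta.
have il := impedance_mono halphat0 halphat1 heta lam0 lam1.
split.
  have -> : trace_part (\int[leb]_(t in I01) k t) m - trace_part (\int[leb]_(t in I01) k' t) m =
      (\int[leb]_(t in I01) (k t - k' t)) / (zeta * impedance alphat eta lam).
    rewrite RintegralB //; last exact: mI.
    have factor (a b m' z c : R) : (a / z - m') / c - (b / z - m') / c = (a - b) / (z * c).
      by rewrite invfM; ring.
    exact: factor.
  rewrite normrM ler_pM //.
    exact: le_trans (le_normr_Rintegral mI hkk) kkE.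
  rewrite ger0_norm; last by rewrite invr_ge0 ltW // (mulr_gt0 z0) // (lt_le_trans i1).
  have il0 := lt_le_trans i1 il.
  by rewrite lef_pV2 ?posrE ?(mulr_gt0 z0) // ler_wpM2l // ltW.
rewrite profileB // (le_trans (profile_bound halpha1 hkk x)) //.
by rewrite mulrA [lam * M * 2]mulrC ler_wpM2r // ler_wpM2l.
Qed.

(** The constant lam * res_bound tends to 0 with lam, because impedance is
    nonincreasing in lam; so res_state is a contraction for small lam. *)
Lemma res_state_lipschitz v u (M : R) : L2 I01 v -> L2 I01 u ->
  0 <= M -> rdot I01 (fun x => v x - u x) (fun x => v x - u x) <= M ^+ 2 ->
  forall x, `|Re (res_state v x - res_state u x)| <= lam * M * res_bound /\
    `|Im (res_state v x - res_state u x)| <= lam * M * res_bound.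
Proof.
move=> hv hu M0 hM x.
have [/sqint_integrable01 kv1 /sqint_integrable01 kv2] := res_source_sqint hv.
have [/sqint_integrable01 ku1 /sqint_integrable01 ku2] := res_source_sqint hu.
have L2d : L2 I01 (fun x => v x - u x).
  have := L2D mI hv (L2Z (-1) mI hu).
  by under eq_fun do rewrite mulN1r.
have [d1 d2] := (L2_sqint _ mI).1 L2d.
rewrite (rdot_sqr mI L2d) in hM.
have q1 := Rintegral_sqr_ge0 leb I01 (fun x => Re (v x - u x)).
have q2 := Rintegral_sqr_ge0 leb I01 (fun x => Im (v x - u x)).
have e1 t : kr v t - kr u t = - lam * Re (v t - u t).
  rewrite /res_source !Re_add !Re_opp !Re_scale; ring.
have e2 t : ki v t - ki u t = - lam * Im (v t - u t).
  rewrite /res_source !Im_add !Im_opp !Im_scale; ring.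
have lerDl_ge0 (a b : R) : 0 <= b -> a <= a + b by move=> b0; rewrite lerDl.
have lerDr_ge0 (a b : R) : 0 <= a -> b <= a + b by move=> a0; rewrite lerDr.
have [c1 p1] := res_part_lipschitz (Re (source_moment alphat eta lam g)) x
  kv1 ku1 d1 e1 M0 (le_trans (lerDl_ge0 _ _ q2) hM).
have [c2 p2] := res_part_lipschitz (Im (source_moment alphat eta lam g)) x
  kv2 ku2 d2 e2 M0 (le_trans (lerDr_ge0 _ _ q1) hM).
have bound (a b a' b' : R) : `|a - b| <= lam * M * (zeta * impedance alphat eta 1)^-1 ->
  `|a' - b'| <= lam * M * (2 * \int[leb]_(t in I01) (t `^ (- alpha))) ->
  `|(a - a') - (b - b')| <= lam * M * res_bound /\
  `|(a + a') - (b + b')| <= lam * M * res_bound.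
  move=> h h'; rewrite mulrDr; split.
    have -> : (a - a') - (b - b') = (a - b) - (a' - b') by ring.
    by rewrite (le_trans (ler_normB _ _)) // lerD.
  have -> : (a + a') - (b + b') = (a - b) + (a' - b') by ring.
  by rewrite (le_trans (ler_normD _ _)) // lerD.
rewrite Re_add Re_opp Im_add Im_opp; split.
  exact: (bound _ _ _ _ c1 p2).1.
exact: (bound _ _ _ _ c2 p1).2.
Qed.

End Solution.
End ResolventEquation.

(** * Maximal dissipativity of the operator *)

Section Generator.
Context {R : realType} (alpha alphat rho eta : R)
    (halpha0 : 0 < alpha) (halpha1 : alpha < 1)
    (halphat0 : 0 < alphat) (halphat1 : alphat < 1)
    (hrho : 0 < rho) (heta : 0 <= eta).
Local Notation leb := (@lebesgue_measure R).
Local Notation I01 := (@I01 R).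
Local Notation mI := (@measurable_I01 R).
Local Notation graphA := (graphA alpha alphat rho eta).
Local Notation zeta := (zeta alphat rho).
Local Notation X := (energy_space R).
Local Notation N := (ipnorm (energy_dot zeta)).
Let z0 : 0 < zeta := zeta_gt0 halphat0 halphat1 hrho.

(** The operator A seen as a graph on the energy space. *)
Definition generator (x y : X) : Prop := graphA (elt_state x) (elt_state y).

Lemma generator_class U F : graphA U F -> generator (class U) (class F).
Proof.
move=> h; have hF : inH F := h.1.
have hU : inH U by have [_ [? [? [? [? [[[]]]]]]]] := h.
apply: graphA_eq h _ _ _ _ => //; try exact: elt_inH; apply: eqH_sym; exact: classP.
Qed.

Lemma generator_comb (c : R) x y x' y' : generator x y -> generator x' y' ->
  generator (c *: x + x') (c *: y + y').
Proof.
move=> h h'; have := graphA_comb halpha1 halphat0 halphat1 c h h'.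
have state_comb (u v : X) : eqH (c%:C%C *: elt_state u + elt_state v) (c *: u + v).
  apply: eqH_sym; apply: eqH_trans (elt_stateD _ _) _.
  exact: eqHD (elt_stateZ _ _) (eqH_refl _).
by move=> /graphA_eq; apply => //; exact: elt_inH.
Qed.

Lemma generator_dissipative : dissipative_op (energy_dot zeta) generator.
Proof.
split.
- by move=> u v f g hu hv; have := generator_comb 1 hu hv; rewrite !scale1r.
- move=> a u f hu; have splitZ (w : X) : a *: w = (a - 1) *: w + w.
    by rewrite scalerBl scale1r subrK.
  by rewrite !splitZ; exact: generator_comb.
- move=> f hf; apply: elt_eq; apply: eqH_trans (eqH_sym elt_state0).
  exact: graphA_single hf elt_state0.
by move=> u f; exact: graphA_dissipative.
Qed.

Lemma bounded_Rintegral_sqr (f : R -> R) (C : R) : sqint leb I01 f -> 0 <= C ->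
  (forall x, `|f x| <= C) -> \int[leb]_(x in I01) (f x ^+ 2) <= C ^+ 2.
Proof.
move=> hf C0 fC; have icst : leb.-integrable I01 (EFin \o (fun=> C ^+ 2)).
  by apply: (@bounded_integrable01 R _ (C ^+ 2)) => // x _; rewrite ger0_norm ?sqr_ge0.
have := le_Rintegral mI hf.2 icst.
rewrite /= Rintegral_cst01.
by apply => x _; rewrite -real_normK ?num_real // lerXn2r ?nnegrE //.
Qed.

(** For small lam the first component v of a solution is a fixed point of
    res_state; the second one is then explicit. *)
Lemma generator_resolvable : exists2 h, 0 < h & resolvable generator h.
Proof.
have B0 : 0 <= res_bound alpha alphat rho eta.
  apply: addr_ge0; last first.
    by apply: mulr_ge0 => //; apply: Rintegral_ge0 => t _; exact: powR_ge0.
  rewrite invr_ge0; apply: mulr_ge0; first exact: ltW.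
  exact: ltW (impedance_gt0 halphat0 halphat1 heta).
set B := res_bound _ _ _ _ in B0.
(* With lam * B <= 1/4 both parts of the difference are at most M / 4, and
   2 (M / 4)^2 <= (M / 2)^2. *)
pose lam := (4 * (B + 1))^-1.
have B1 : 0 < 4 * (B + 1) by rewrite mulr_gt0 // ltr_wpDl.
have lam0 : 0 < lam by rewrite invr_gt0.
have lam1 : lam <= 1 by rewrite invf_le1 //; lra.
have lamB : lam * B <= 4^-1.
  by rewrite /lam mulrC ler_pdivrMr // mulrA mulVf ?mul1r ?lerDl // pnatr_eq0.
exists lam^-1; first by rewrite invr_gt0.
move=> x; rewrite /generator invrK.
pose f t := lam%:C%C * (elt_state x).1 t; pose g t := lam%:C%C * (elt_state x).2 t.
have [x1 x2] := elt_inH x.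
have hf : L2 I01 f by apply: L2Z => //; exact: mI.
have hg : L2 setT g by apply: L2Z.
pose S := res_state alpha alphat rho eta lam f g.
pose T (y : X) : X := class (S (elt_state y).1, fun=> 0).
have TinH (y : X) : inH (S (elt_state y).1, fun=> 0 : R[i]).
  have [y1 _] := elt_inH y; split; last exact: L2_0.
  exact: res_state_L2.
have [y yE] : exists y, T y = y.
  apply: (contraction_fixpoint (energy_inner_product z0) (energy_complete z0)) => y z.
  have [y1 y2] := elt_inH y; have [v1 v2] := elt_inH z.
  have yz : inH (elt_state y - elt_state z) by apply: inHB; exact: elt_inH.
  rewrite /T -classB; [|exact: TinH..].
  rewrite (ipnorm_normH _ (inHB (TinH y) (TinH z)) (classP _)); last exact: inHB.
  rewrite (ipnorm_normH _ yz (elt_stateB y z)) /normH.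
  rewrite -![Re (dotH _ _ _)]/(re_dotH _ _ _) !re_dotHE.
  have d0 : rdot setT ((fun=> 0) - (fun=> 0) : R -> R[i]) ((fun=> 0) - (fun=> 0) : R -> R[i]) = 0.
    transitivity (\int[leb]_(x in setT) (cst 0 : R -> R) x).
      by apply: eq_Rintegral => t _; rewrite subrr /= mulr0 addr0.
    by rewrite Rintegral_cst // mul0r.
  rewrite [rdot setT _.2 _.2]d0 mulr0 addr0.
  set D1 := rdot I01 _.1 _.1; set D2 := rdot I01 _.1 _.1.
  have D20 : 0 <= D2 by exact: rdot_ge0.
  have M0 := sqrtr_ge0 D2; set M := Num.sqrt D2 in M0.
  have DM : D2 <= M ^+ 2 by rewrite sqr_sqrtr.
  have bnd := res_state_lipschitz halpha1 halphat0 halphat1 hrho heta g lam0 lam1 hf y1 v1 M0 DM.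
  have dL2 : L2 I01 (fun t => S (elt_state y).1 t - S (elt_state z).1 t).
    by have [] := inHB (TinH y) (TinH z).
  have [r1 r2] := (L2_sqint _ mI).1 dL2.
  have C0 : 0 <= M / 4 by rewrite divr_ge0.
  have lM : lam * M * B <= M / 4 by rewrite mulrAC mulrC ler_wpM2l.
  have D1M : D1 <= (M / 4) ^+ 2 + (M / 4) ^+ 2.
    rewrite /D1 (rdot_sqr mI dL2) lerD //; apply: bounded_Rintegral_sqr => // t;
      by rewrite (le_trans _ lM) //; have [] := bnd t.
  have D12 : D1 <= (M / 2) ^+ 2 by apply: le_trans D1M _; rewrite -subr_ge0; nra.
  apply: (@le_trans _ _ (M / 2)).
    by rewrite -[leRHS]ger0_norm ?divr_ge0 // -sqrtr_sqr ler_sqrt ?sqr_ge0.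
  rewrite mulrC ler_wpM2l // ler_wsqrtr // lerDl.
  by apply: mulr_ge0; [exact: ltW|exact: rdot_ge0].
have [y1 y2] := elt_inH y.
have yS : S (elt_state y).1 = (elt_state y).1 %[ae leb in I01].
  have [e _] := classP (TinH y); rewrite -/(T y) yE in e.
  by apply: ae_imply e => t h /h.
have := graphA_resolvent halpha1 halphat0 halphat1 hrho heta lam0 lam1 hf hg y1 yS.
set phi := diffusive_solution _ _ _ _ _ => /= hA.
set U := (_, phi) in hA; exists (class U).
have hU : inH U by have [_ [? [? [? [? [[[]]]]]]]] := hA.
apply: (graphA_eq halphat0 halphat1 hA); try exact: elt_inH.
  exact: eqH_sym (classP hU).
apply: eqH_sym; apply: eqH_trans (elt_stateZ _ _) _.
apply: eqH_trans (eqHZ _ (elt_stateB _ _)) _.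
apply: eqH_trans (eqHZ _ (eqHD (classP hU) (eqH_refl _))) _.
by split; apply: aeW => t _ /=; rewrite -mulrBr.
Qed.

End Generator.

(** * Well-posedness of the Cauchy problem *)

Section FlowCurves.
Context {R : realType} {X : lmodType R} {q : X -> X -> R}
  (ipq : inner_product q) (cX : complete q)
  {A : X -> X -> Prop} (oA : dissipative_op q A)
  {h0 : R} (h0_gt0 : 0 < h0) (rA : resolvable A h0).
Local Notation N := (ipnorm q).
Local Notation flow := (flow ipq cX oA h0_gt0 rA).
Local Notation flow_int := (flow_int ipq cX oA h0_gt0 rA).

Lemma flow_increments_bounded x :
  increments_bounded q (flow^~ x) (flow_int^~ x).
Proof. by move=> s t z M; exact: flow_int_increment. Qed.

Lemma flow_continuous x : curve_continuous q (flow^~ x).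
Proof.
move=> t e t0 e0; have [d d0 hd] := flow_uniform_continuous ipq cX oA h0_gt0 rA x e0.
by exists d => // s s0 /ltW; exact: hd.
Qed.

Lemma flow_derivative x y : A x y -> curve_derivative q (flow^~ x) (flow^~ y).
Proof.
move=> Axy t e t0 e0.
have [d d0 hd] := increments_derivative ipq (@flow_continuous y)
  (@flow_increments_bounded y) t0 e0.
exists d => // s s0 st; have := hd s s0 st.
rewrite -(flow_increment _ _ _ _ _ s0 Axy) -(flow_increment _ _ _ _ _ t0 Axy).
by rewrite opprB addrA subrK.
Qed.

Lemma flow_Riemann x (b : R) : 0 <= b -> Riemann_integral q (flow^~ x) 0 b (flow_int b x).
Proof.
move=> b0; have := increments_Riemann ipq b0 (@flow_increments_bounded x).
rewrite flow_int0 subr0; apply => e e0; exact: flow_uniform_continuous.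
Qed.

End FlowCurves.

Lemma curve_derivativeB (R : realType) (X : lmodType R) (q : X -> X -> R) V dV W dW :
  inner_product q -> curve_derivative q V dV -> curve_derivative q W dW ->
  curve_derivative q (fun t => V t - W t) (fun t => dV t - dW t).
Proof.
move=> ipq hV hW t e t0 e0; have e2 : 0 < e / 2 by rewrite divr_gt0.
have [d d0 hd] := hV t _ t0 e2; have [d' d'0 hd'] := hW t _ t0 e2.
exists (Num.min d d'); first by rewrite lt_min d0.
move=> s s0; rewrite lt_min => /andP[/(hd _ s0) h /(hd' _ s0) h'].
have -> : V s - W s - (V t - W t) - (s - t) *: (dV t - dW t) =
  (V s - V t - (s - t) *: dV t) - (W s - W t - (s - t) *: dW t).
  by apply: (ip_ext ipq) => w; rewrite !(ipE ipq); ring.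
by rewrite (le_trans (ipnormDB ipq _ _)) // [in leRHS](splitr e) mulrDl lerD.
Qed.

Lemma curve_continuousB (R : realType) (X : lmodType R) (q : X -> X -> R) V W :
  inner_product q -> curve_continuous q V -> curve_continuous q W ->
  curve_continuous q (fun t => V t - W t).
Proof.
move=> ipq hV hW t e t0 e0; have e2 : 0 < e / 2 by rewrite divr_gt0.
have [d d0 hd] := hV t _ t0 e2; have [d' d'0 hd'] := hW t _ t0 e2.
exists (Num.min d d'); first by rewrite lt_min d0.
move=> s s0; rewrite lt_min => /andP[/(hd _ s0) h /(hd' _ s0) h'].
have -> : V s - W s - (V t - W t) = (V s - V t) - (W s - W t).
  by apply: (ip_ext ipq) => w; rewrite !(ipE ipq); ring.
by rewrite (le_trans (ipnormDB ipq _ _)) // [in leRHS](splitr e) lerD.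
Qed.

Lemma cvg0_dist (R : realType) (F : set_system R) (f : R -> R) : Filter F ->
  (f s @[s --> F] --> (0 : R)) <-> (forall e, 0 < e -> F (fun s => `|f s| <= e)).
Proof.
move=> FF; split => [/cvgrPdist_le h e /h|h].
  by apply: filterS => s; rewrite sub0r normrN.
by apply/cvgrPdist_le => e /h; apply: filterS => s; rewrite sub0r normrN.
Qed.

Lemma nbhs_dist (R : realType) (t : R) (P : R -> Prop) :
  nbhs t P <-> exists2 d, 0 < d & forall s, `|s - t| < d -> P s.
Proof.
split => [/nbhs_ballP[d d0 hd]|[d d0 hd]].
  by exists d => // s st; apply: hd; rewrite /ball /= distrC.
by apply/nbhs_ballP; exists d => // s; rewrite /ball /= distrC => /hd.
Qed.

Section Curves.
Context {R : realType} (zeta : R) (zeta_gt0 : 0 < zeta).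
Local Notation X := (energy_space R).
Local Notation q := (energy_dot zeta).
Local Notation N := (ipnorm q).
Let ipq : inner_product q := energy_inner_product zeta_gt0.
Implicit Types (V : R -> state R) (C : R -> X).

Lemma normH_class (U : state R) : inH U -> normH zeta U = N (class U).
Proof. by move=> hU; rewrite (ipnorm_normH _ hU (classP hU)). Qed.

Lemma half_line (s : R) : (`[0, +oo[%classic : set R) s <-> 0 <= s.
Proof. by rewrite /= in_itv /= andbT. Qed.

Lemma contH_class V : contH zeta V -> curve_continuous q (fun t => class (V t)).
Proof.
move=> [hV cV] t e t0 e0; have /cvg0_dist/(_ e e0)/nbhs_dist[d d0 hd] := cV t t0.
exists d => // s s0 /hd/(_ ((half_line s).2 s0)).
rewrite normH_class ?classB; [|exact: hV..|by apply: inHB; exact: hV].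
exact: le_trans (ler_norm _).
Qed.

Lemma contH_elt C : curve_continuous q C -> contH zeta (fun t => elt_state (C t)).
Proof.
move=> hC; split=> t t0; first exact: elt_inH.
apply/cvg0_dist => e e0; apply/nbhs_dist; have [d d0 hd] := hC t e t0 e0.
exists d => // s st /half_line s0; have := hd s s0 st.
rewrite normH_class ?classB ?class_elt; try exact: elt_inH; last by apply: inHB; exact: elt_inH.
by rewrite ger0_norm // ipnorm_ge0.
Qed.

Lemma slope_norm (C dC : R -> X) s t : s != t ->
  N (C s - C t - (s - t) *: dC t) = N ((s - t)^-1 *: (C s - C t) - dC t) * `|s - t|.
Proof.
move=> st; rewrite mulrC -(ipnormZ ipq) scalerBr scalerA divff ?scale1r //.
by rewrite subr_eq0.
Qed.

Lemma class_slope V dV (s t : R) : inH (V s) -> inH (V t) -> inH (dV t) ->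
  normH zeta (((s - t)^-1)%:C%C *: (V s - V t) - dV t) =
  N ((s - t)^-1 *: (class (V s) - class (V t)) - class (dV t)).
Proof.
move=> hs ht hd; have hB := inHB hs ht.
by rewrite normH_class ?classB ?classZ ?classB //; [exact: inHZ|apply: inHB => //; exact: inHZ].
Qed.

Lemma is_derivH_class V dV : (forall t, 0 <= t -> inH (V t)) ->
  (forall t, 0 <= t -> inH (dV t)) -> is_derivH zeta V dV ->
  curve_derivative q (fun t => class (V t)) (fun t => class (dV t)).
Proof.
move=> hV hdV dVV t e t0 e0; have /cvg0_dist/(_ e e0)/nbhs_dist[d d0 hd] := dVV t t0.
exists d => // s s0 st; have [->|nst] := eqVneq s t.
  by rewrite !subrr scale0r subrr (ipnorm0 ipq) normr0 mulr0.
rewrite (@slope_norm (fun t => class (V t)) (fun t => class (dV t))) // ler_wpM2r //.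
have := hd s st nst ((half_line s).2 s0); rewrite class_slope; [|exact: hV|exact: hV|exact: hdV].
exact: le_trans (ler_norm _).
Qed.

Lemma is_derivH_elt (C dC : R -> X) : curve_derivative q C dC ->
  is_derivH zeta (fun t => elt_state (C t)) (fun t => elt_state (dC t)).
Proof.
move=> hC t t0; apply/cvg0_dist => e e0; apply/nbhs_dist; have [d d0 hd] := hC t e t0 e0.
exists d => // s st nst /half_line s0; have := hd s s0 st.
rewrite slope_norm // ler_pM2r ?normr_gt0 ?subr_eq0 //.
rewrite (@class_slope (fun t => elt_state (C t)) (fun t => elt_state (dC t))); try exact: elt_inH.
by rewrite !class_elt ger0_norm // ipnorm_ge0.
Qed.

Lemma class_sum n (c : nat -> R) (U : nat -> state R) :
  (forall k, (k < n)%N -> inH (U k)) ->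
  inH (\sum_(k < n) (c k)%:C%C *: U k) /\
  class (\sum_(k < n) (c k)%:C%C *: U k) = \sum_(k < n) c k *: class (U k).
Proof.
elim: n => [|n IH] hU.
  by rewrite !big_ord0; split; [exact: inH0|apply: elt_eq; apply: eqH_trans (classP inH0) (eqH_sym elt_state0)].
have [|h1 h2] := IH; first by move=> k kn; apply: hU; exact: ltnW.
have hn := hU n (ltnSn n); rewrite !big_ord_recr /=; split.
  by apply: inHD => //; exact: inHZ.
by rewrite classD ?h2 ?classZ //; exact: inHZ.
Qed.

Lemma class_Riemann_sum n (c : nat -> R) (U : nat -> state R) I :
  (forall k, (k < n)%N -> inH (U k)) -> inH I ->
  normH zeta (\sum_(k < n) (c k)%:C%C *: U k - I) =
  N (\sum_(k < n) c k *: class (U k) - class I).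
Proof.
by move=> hU hI; have [h1 h2] := class_sum c hU; rewrite normH_class ?classB ?h2 //; exact: inHB.
Qed.

Lemma is_RintH_class V (t : R) I : (forall s, 0 <= s -> inH (V s)) ->
  is_RintH zeta V 0 t I -> Riemann_integral q (fun s => class (V s)) 0 t (class I).
Proof.
move=> hV [hI hR] e /hR[d d0 hd]; exists d => // n x tag x0 xn hx.
have xmono k : (k < n)%N -> x k <= x k.+1 by move=> /hx[a b _]; exact: le_trans b.
have := hd n x tag x0 xn hx.
rewrite (@class_Riemann_sum n (fun k => x k.+1 - x k) (fun k => V (tag k))) // => k kn.
apply: hV; have [a _ _] := hx k kn; apply: le_trans a.
by rewrite -x0; apply: (chain_mono xmono) => //; exact: ltnW.
Qed.

Lemma is_RintH_elt C (t : R) (J : X) : Riemann_integral q C 0 t J ->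
  is_RintH zeta (fun s => elt_state (C s)) 0 t J.
Proof.
move=> hR; split=> [|e /hR[d d0 hd]]; first exact: elt_inH.
exists d => // n x tag x0 xn hx; have := hd n x tag x0 xn hx.
have hC k : (k < n)%N -> inH (elt_state (C (tag k))) by move=> _; exact: elt_inH.
have := class_Riemann_sum (fun k => x k.+1 - x k) hC (elt_inH J).
rewrite class_elt.
have -> : \sum_(k < n) (x k.+1 - x k) *: class (elt_state (C (tag k))) =
    \sum_(k < n) (x k.+1 - x k) *: C (tag k).
  by apply: eq_bigr => k _; rewrite class_elt.
by move=> ->.
Qed.

End Curves.

Section Solutions.
Context {R : realType} (alpha alphat rho eta : R)
    (halpha0 : 0 < alpha) (halpha1 : alpha < 1)
    (halphat0 : 0 < alphat) (halphat1 : alphat < 1)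
    (hrho : 0 < rho) (heta : 0 <= eta).
Local Notation graphA := (graphA alpha alphat rho eta).
Local Notation domA := (domA alpha alphat rho eta).
Local Notation opA := (opA alpha alphat rho eta).
Local Notation generator := (generator alpha alphat rho eta).
Local Notation zeta := (zeta alphat rho).
Local Notation X := (energy_space R).
Local Notation q := (energy_dot zeta).
Local Notation N := (ipnorm q).
Let z0 : 0 < zeta := zeta_gt0 halphat0 halphat1 hrho.
Let ipq : inner_product q := energy_inner_product z0.
Let cX : complete q := energy_complete z0.
Let oA : dissipative_op q generator :=
  generator_dissipative halpha1 halphat0 halphat1 hrho heta.

Lemma graphA_inH U F : graphA U F -> inH U.
Proof. by move=> [_ [? [? [? [? [[[]]]]]]]]. Qed.

Lemma graphA_domA U F : graphA U F -> domA U.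
Proof. by move=> [_ [v [dv [w [dw []]]]]]; exists v, dv, w, dw. Qed.

Lemma opA_graph U : domA U -> graphA U (opA U).
Proof.
move=> [v [dv [w [dw h]]]]; apply: (xgetPex 0 (P := [set F | graphA U F])).
have [[hU _ [_ _ [_ _ _ dwL2]]] [_ _ dL2 _]] := h.
exists (fun x => - 'i%C * dw x, diffusive alphat eta U.2 (trace0 v)); split.
  by split => //=; apply: L2Z => //; exact: measurable_I01.
by exists v, dv, w, dw; split => //; exact: eqH_refl.
Qed.

Lemma domA_inH U : domA U -> inH U.
Proof. by move=> /opA_graph/graphA_inH. Qed.

Lemma opA_inH U : domA U -> inH (opA U).
Proof. by move=> /opA_graph[]. Qed.

Lemma generator_opA U : domA U -> generator (class U) (class (opA U)).
Proof. by move=> /opA_graph; exact: generator_class. Qed.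

Lemma generator_domA U y : inH U -> generator (class U) y ->
  domA U /\ class (opA U) = y.
Proof.
move=> hU h; have hA : graphA U y.
  by apply: (graphA_eq halphat0 halphat1 h); [|exact: elt_inH|exact: classP|exact: eqH_refl].
have dU := graphA_domA hA; split => //.
exact: (op_single oA (generator_opA dU) h).
Qed.

Lemma strong_solution_uniq V0 V W :
  strong_solution alpha alphat rho eta V0 V -> strong_solution alpha alphat rho eta V0 W ->
  forall t, 0 <= t -> eqH (W t) (V t).
Proof.
move=> [[dV _] cV V00 [V' [cV' hV' V'E]]] [[dW _] cW W00 [W' [cW' hW' W'E]]] t t0.
have hV s : 0 <= s -> inH (V s) by move=> s0; apply: domA_inH; exact: dV.
have hW s : 0 <= s -> inH (W s) by move=> s0; apply: domA_inH; exact: dW.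
have DV := is_derivH_class z0 hV cV'.1 hV'; have DW := is_derivH_class z0 hW cW'.1 hW'.
have D0 : class (W 0) - class (V 0) = 0.
  rewrite (class_eq (hW 0 (lexx 0)) (hV 0 (lexx 0))) ?subrr //.
  exact: eqH_trans W00 (eqH_sym V00).
have gen U U' s : 0 <= s -> domA (U s) -> inH (U' s) -> eqH (U' s) (opA (U s)) ->
    generator (class (U s)) (class (U' s)).
  move=> s0 dU hU' e; rewrite (class_eq hU' (opA_inH dU) e); exact: generator_opA.
have AD s : 0 <= s -> generator (class (W s) - class (V s)) (class (W' s) - class (V' s)).
  move=> s0; apply: (opB oA); apply: gen => //.
  - exact: dW.
  - exact: cW'.1.
  - exact: W'E.
  - exact: dV.
  - exact: cV'.1.
  exact: V'E.
have := dissipative_trajectory0 ipq oA (curve_derivativeB ipq DW DV) AD D0 t0.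
move=> /eqP; rewrite subr_eq0 => /eqP WV.
by apply: eqH_trans (eqH_sym (classP (hW t t0))) _; rewrite WV; apply: classP; exact: hV.
Qed.

Lemma weak_solution_uniq V0 V W : inH V0 ->
  weak_solution alpha alphat rho eta V0 V -> weak_solution alpha alphat rho eta V0 W ->
  forall t, 0 <= t -> eqH (W t) (V t).
Proof.
move=> hV0 [cV iV] [cW iW] t t0.
have integral U : contH zeta U -> (forall t, 0 <= t -> exists I : state R,
    [/\ is_RintH zeta U 0 t I, domA I & eqH (U t) (V0 + opA I)]) ->
    exists I : R -> X, forall s, 0 <= s ->
    Riemann_integral q (fun r => class (U r)) 0 s (I s) /\
    generator (I s) (class (U s) - class V0).
  move=> cU iU; suff /choice[I hI] : forall s, exists I : X, 0 <= s ->
      Riemann_integral q (fun r => class (U r)) 0 s I /\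
      generator I (class (U s) - class V0) by exists I.
  move=> s; have [s0|ns0] := pselect (0 <= s); last by exists 0 => s0.
  have [I [RI dI UE]] := iU s s0; exists (class I) => _; split.
    exact: (is_RintH_class cU.1 RI).
  have -> : class (U s) - class V0 = class (opA I).
    rewrite (class_eq (cU.1 s s0) (inHD hV0 (opA_inH dI)) UE) classD //; last exact: opA_inH.
    by rewrite addrAC subrr add0r.
  exact: generator_opA.
have [I hI] := integral V cV iV; have [J hJ] := integral W cW iW.
have Dc := curve_continuousB ipq (contH_class cW) (contH_class cV).
have hR s : 0 <= s -> Riemann_integral q (fun r => class (W r) - class (V r)) 0 s (J s - I s).
  by move=> s0; apply: (Riemann_integralB ipq); [exact: (hJ s s0).1|exact: (hI s s0).1].
have hA s : 0 <= s -> generator (J s - I s) (class (W s) - class (V s)).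
  have cancel (a b c : X) : a - c - (b - c) = a - b by rewrite opprB addrA subrK.
  by move=> s0; have := opB oA (hJ s s0).2 (hI s s0).2; rewrite cancel.
have := mild_trajectory0 ipq oA Dc hR hA t0; move=> /eqP; rewrite subr_eq0 => /eqP WV.
apply: eqH_trans (eqH_sym (classP (cW.1 t t0))) _.
by rewrite WV; apply: classP; exact: cV.1.
Qed.

Section Existence.
Variables (h0 : R) (h0_gt0 : 0 < h0) (rA : resolvable generator h0).
Local Notation flow := (flow ipq cX oA h0_gt0 rA).
Local Notation flow_int := (flow_int ipq cX oA h0_gt0 rA).

Lemma flow_strong_solution V0 : domA V0 ->
  strong_solution alpha alphat rho eta V0 (fun t => elt_state (flow t (class V0))).
Proof.
move=> dV0; pose x := class V0; pose y := class (opA V0).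
have Axy : generator x y by exact: generator_opA.
have Axyt t : 0 <= t -> generator (flow t x) (flow t y) by move=> t0; exact: flow_op.
have dt t : 0 <= t -> domA (flow t x) /\ class (opA (flow t x)) = flow t y.
  move=> t0; apply: generator_domA; first exact: elt_inH.
  by rewrite class_elt; exact: Axyt.
have cx := flow_continuous ipq cX oA h0_gt0 rA x.
have cy := flow_continuous ipq cX oA h0_gt0 rA y.
split.
- split=> t t0; first by have [] := dt t t0.
  apply/cvg0_dist => e e0; apply/nbhs_dist; have e2 : 0 < e / 2 by rewrite divr_gt0.
  have [d d0 hd] := cx t _ t0 e2; have [d' d'0 hd'] := cy t _ t0 e2.
  exists (Num.min d d'); first by rewrite lt_min d0.
  move=> s; rewrite lt_min => /andP[sd sd'] /half_line s0.
  have hB : inH (elt_state (flow s x) - elt_state (flow t x)).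
    by apply: inHB; exact: elt_inH.
  have [dB BE] : domA (elt_state (flow s x) - elt_state (flow t x)) /\
      class (opA (elt_state (flow s x) - elt_state (flow t x))) = flow s y - flow t y.
    apply: generator_domA => //; rewrite classB ?class_elt; [|exact: elt_inH..].
    by apply: (opB oA); exact: Axyt.
  rewrite /graph_norm (normH_class _ hB) (normH_class _ (opA_inH dB)) BE.
  rewrite classB ?class_elt; [|exact: elt_inH..].
  rewrite ger0_norm ?addr_ge0 ?ipnorm_ge0 // [leRHS](splitr e) lerD //.
    exact: hd.
  exact: hd'.
- exact: (contH_elt cx).
- by rewrite flow0; apply: classP; exact: (domA_inH dV0).
exists (fun t => elt_state (flow t y)); split.
- exact: (contH_elt cy).
- exact: (is_derivH_elt z0 (flow_derivative ipq cX oA h0_gt0 rA Axy)).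
by move=> t t0; have [dx <-] := dt t t0; apply: classP; exact: (opA_inH dx).
Qed.

Lemma flow_weak_solution V0 : inH V0 ->
  weak_solution alpha alphat rho eta V0 (fun t => elt_state (flow t (class V0))).
Proof.
move=> hV0; split; first exact: (contH_elt (flow_continuous ipq cX oA h0_gt0 rA (class V0))).
move=> t t0; set x := class V0; have := flow_int_op ipq cX oA h0_gt0 rA x t0.
rewrite -{1}(class_elt (flow_int t x)) => /(generator_domA (elt_inH _))[dI IE].
exists (flow_int t x); split => //.
  exact: (is_RintH_elt (flow_Riemann ipq cX oA h0_gt0 rA x t0)).
have hI := opA_inH dI; have -> : flow t x = class (V0 + opA (flow_int t x)).
  by rewrite classD // IE addrC subrK.
by apply: classP; exact: (inHD hV0 hI).
Qed.

End Existence.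
End Solutions.

Theorem theorem3p1 (R : realType) (alpha alphat rho eta : R)
    (halpha0 : 0 < alpha) (halpha1 : alpha < 1)
    (halphat0 : 0 < alphat) (halphat1 : alphat < 1)
    (hrho : 0 < rho) (heta : 0 <= eta) :
  (forall V0 : state R, domA alpha alphat rho eta V0 ->
     exists V : R -> state R,
       strong_solution alpha alphat rho eta V0 V /\
       (forall W : R -> state R,
          strong_solution alpha alphat rho eta V0 W ->
          forall t : R, 0 <= t -> eqH (W t) (V t))) /\
  (forall V0 : state R, inH V0 ->
     exists V : R -> state R,
       weak_solution alpha alphat rho eta V0 V /\
       (forall W : R -> state R,
          weak_solution alpha alphat rho eta V0 W ->
          forall t : R, 0 <= t -> eqH (W t) (V t))).
Proof.
have [h h0 rA] := generator_resolvable halpha1 halphat0 halphat1 hrho heta.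
split=> V0 hV0.
  have VS := flow_strong_solution halpha1 halphat0 halphat1 hrho heta h0 rA hV0.
  by eexists; split; [exact: VS|move=> W; exact: (strong_solution_uniq halpha1 halphat0 halphat1 hrho heta VS)].
have VS := flow_weak_solution halpha1 halphat0 halphat1 hrho heta h0 rA hV0.
by eexists; split; [exact: VS|move=> W; exact: (weak_solution_uniq halpha1 halphat0 halphat1 hrho heta hV0 VS)].
Qed.
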